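(* Let $P_1$ and $P_0$ be equivalent Gaussian measures on $\mathbb{R}^p$ and let $g^*=1_{\{\mathcal{L}_{10}\ge0\}}$, $\mathcal{L}_{10}=\log\frac{dP_1}{dP_0}$, be the optimal rule in the binary classification problem. 1. If $P_1$ and $P_0$ have the same (symmetric positive definite) covariance $C$ and respective means $\mu_1$ and $\mu_0$, then for all measurable functions $g:\mathbb{R}^p\to\{0,1\}$, $$\mathcal{C}(g)-\mathcal{C}(g^* )\ge\min\left\{\frac{\sqrt{2\pi}}{2\cdot16^2}\,\|C^{-1/2}m_{10}\|_{\mathbb{R}^p}\,e^{\frac{\|C^{-1/2}m_{10}\|_{\mathbb{R}^p}^2}{8}}\,\mathcal{R}(g)^2,\ \frac{\mathcal{R}(g)}8\right\},$$ where $m_{10}=\mu_1-\mu_0$. 2. Let $c_1>0$ and let $\mathcal{P}(c_1)$ be the set of couples $(P,Q)$ of Gaussian measures on $\mathbb{R}^p$ such that $d_1(P,Q)>c_1$. If $(P_1,P_0)\in\mathcal{P}(c_1)$, then there exists a constant $c(c_1)>0$, depending only on $c_1$, such that for all measurable functions $g:\mathbb{R}^p\to\{0,1\}$, $$\mathcal{C}(g)-\mathcal{C}(g^* )\ge\min\left\{c(c_1)\,\mathcal{R}(g)^8,\ \frac{\mathcal{R}(g)}8\right\}.$$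
   Context: For measurable $g:\mathbb{R}^p\to\{0,1\}$: $\mathcal{C}(g)=\frac12\big(P_1(g(X)\ne1)+P_0(g(X)\ne0)\big)$, and the learning error is $\mathcal{R}(g)=\frac12\big(P_1(g(X)\ne1\text{ and }g^*(X)=1)+P_0(g(X)\ne0\text{ and }g^*(X)=0)\big)$. $d_1(P,Q)=\int|dP-dQ|$. *)

(* Defs.v *)
From HB Require Import structures.
From mathcomp Require Import all_boot all_order all_algebra.
From mathcomp Require Import all_classical all_reals all_analysis.

Set Implicit Arguments.
Unset Strict Implicit.
Unset Printing Implicit Defensive.

Import Order.TTheory GRing.Theory Num.Theory.
Import numFieldNormedType.Exports.

Local Open Scope classical_set_scope.
Local Open Scope ring_scope.

(* R^p with the product (= Borel) sigma-algebra. *)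
Notation Rvec R p := (p.-tuple (measurableTypeR R)) (only parsing).

Section linear_algebra.
Context {R : realType} {p : nat}.

(* `|v| on matrices is the sup norm of the library, hence this definition. *)
Definition eucl_norm (v : 'cV[R]_p) : R := Num.sqrt (\sum_(i < p) v i 0 ^+ 2).

Definition sym_posdef (C : 'M[R]_p) : Prop :=
  C^T = C /\ forall v : 'cV[R]_p, v != 0 -> 0 < (v^T *m C *m v) 0 0.

(* C^{1/2}: the unique symmetric positive definite square root of a symmetric
   positive definite C (junk value 0 if there is none). *)
Definition sqrtmx (C : 'M[R]_p) : 'M[R]_p :=
  xget 0 [set S : 'M[R]_p | sym_posdef S /\ S *m S = C].

End linear_algebra.

Section gaussian.
Context {R : realType} {p : nat}.

(* By uniqueness of product measures, the values on boxes determine the law of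
   p independent N(0,1) variables. *)
Definition std_gaussian (gam : probability (Rvec R p) R) : Prop :=
  forall B : 'I_p -> set (measurableTypeR R), (forall i, measurable (B i)) ->
    gam [set z | forall i, B i (tnth z i)] =
    (\prod_(i < p) normal_prob 0 1 (B i))%E.

Definition affine_map (mu : 'cV[R]_p) (A : 'M[R]_p) (z : Rvec R p) : Rvec R p :=
  [tuple (mu + A *m (\col_j (tnth z j : R))) i 0 | i < p].

(* P = N(mu, C), the law of mu + A Z with Z standard Gaussian and A A^T = C;
   C may be singular. *)
Definition gaussian_law (mu : 'cV[R]_p) (C : 'M[R]_p)
    (P : probability (Rvec R p) R) : Prop :=
  exists (gam : probability (Rvec R p) R) (A : 'M[R]_p),
    [/\ std_gaussian gam, A *m A^T = C &
        forall B : set (Rvec R p), measurable B ->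
          P B = gam (affine_map mu A @^-1` B)].

Definition gaussian (P : probability (Rvec R p) R) : Prop :=
  exists mu C, gaussian_law mu C P.

End gaussian.

Section sum_finite_measures.
Context d (T : measurableType d) (R : realType).
Variables P Q : {finite_measure set T -> \bar R}.

Let fin_num_fun_measure_add : fin_num_fun (measure_add P Q).
Proof. by move=> A mA; rewrite measure_addE fin_numD !fin_num_measure. Qed.

HB.instance Definition _ := Measure.on (measure_add P Q).
HB.instance Definition _ :=
  Measure_isFinite.Build _ _ _ (measure_add P Q) fin_num_fun_measure_add.

End sum_finite_measures.

Section classification.
Context d (T : measurableType d) (R : realType).
Implicit Types P Q : probability T R.

Definition equivalent_measures P Q : Prop := P `<< Q /\ Q `<< P.

Definition density P (mu : {sigma_finite_measure set T -> \bar R}) : T -> \bar R :=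
  Radon_Nikodym (charge_of_finite_measure P) mu.

(* \int |dP - dQ|, computed with the dominating measure P + Q. *)
Definition dist1 P Q : \bar R :=
  (\int[measure_add P Q]_x
     `| density P (measure_add P Q) x - density Q (measure_add P Q) x |)%E.

Definition log_ratio P1 P0 (x : T) : \bar R := lne (density P1 P0 x).

Definition optimal_rule P1 P0 (x : T) : bool := (0 <= log_ratio P1 P0 x)%E.

Definition cost P1 P0 (g : T -> bool) : R :=
  2^-1 * (fine (P1 [set x | g x <> true]) + fine (P0 [set x | g x <> false])).

Definition learning_error P1 P0 (g : T -> bool) : R :=
  2^-1 * (fine (P1 [set x | g x <> true /\ optimal_rule P1 P0 x = true]) +
          fine (P0 [set x | g x <> false /\ optimal_rule P1 P0 x = false])).

End classification.

Definition separated_gaussians {R : realType} {p : nat} (c1 : R) :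
    set (probability (Rvec R p) R * probability (Rvec R p) R) :=
  [set PQ | [/\ gaussian PQ.1, gaussian PQ.2 & (c1%:E < dist1 PQ.1 PQ.2)%E]].

(* Main.v *)
Require Import Defs.
From HB Require Import structures.
From mathcomp Require Import all_boot all_order all_algebra ring lra.
From mathcomp Require Import complex spectral.
From mathcomp Require Import all_classical all_reals all_analysis.
From mathcomp Require Import measurable_realfun.
Set Implicit Arguments.
Unset Strict Implicit.
Unset Printing Implicit Defensive.
Import Order.TTheory GRing.Theory Num.Theory.
Import numFieldNormedType.Exports.
Local Open Scope classical_set_scope.
Local Open Scope ring_scope.

(** Let l be the logarithm of dP1/dP0 and let r be the learning error of g.
    Where g disagrees with the optimal rule it loses |exp l - 1| times the mass
    of P0, so that a disagreement of total mass r can be cheap only if it sits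
    where |l| is small. Hence a small-ball bound P0 (|l| <= s^k) <= K s yields
    a gap of order r^(k+1) (excess_cost_small_ball), and all the rest is about
    small balls of l under P0.

    When the covariances are equal, choose A with A A^T = C as a chart. Then l
    is h.z - |h|^2/2 for a standard Gaussian z, with |h| = |C^(-1/2) m10|; it
    is normal, and near l = 0 its density is governed by the standard normal
    density at |h|/2, which gives the factor exp (|h|^2/8) with k = 1.

    In general, equivalent Gaussian laws have the same affine support
    (affine_law_dominates_range), and simultaneous diagonalization of their
    covariances gives coordinates of this support in which P0 is standard and
    P1 is a product of laws N(m_i, lam_i^2) (gaussian_pair_coordinates). Then l
    is a quadratic polynomial, up to a constant the sum of a_i z_i^2/2 + b_i z_i
    with a_i = 1 - lam_i^(-2) and b_i = m_i/lam_i^2. Let V be the sum of the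
    a_i^2 + b_i^2. The Fourier transform phi of this polynomial satisfies
    |phi u|^4 <= 1/(1 + u^2 V), and Gaussian smoothing turns this decay into a
    small-ball bound with k = 3 and a constant that depends on V only, not on
    the dimension (quadratic_small_ball). Finally V is bounded below in terms of
    c1: the Hellinger affinity of P1 and P0 is at least 1 - V/2 unless some
    lam_i is large, in which case V >= 1/4, and an affinity close to 1 makes the
    total variation small (dist1_affinity, separated_coefficients). The
    resulting gap is of order r^4, and r^4 >= r^8 since r <= 1.

    The law N(mu, C) is the image of a standard Gaussian vector by mu + A z for
    some A with A A^T = C. Changing coordinates requires that any other factor
    of C, possibly rectangular, gives the same law (affine_law_eq); this is
    deduced from the uniqueness of the Fourier transform (fourier_unique). *)

(** * Excess cost and small balls of the log-likelihood ratio *)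

Section probability_real.
Context d (T : measurableType d) (R : realType) (P : probability T R).

Lemma fine_prob_setIC (A B : set T) : measurable A -> measurable B ->
  fine (P A) = fine (P (A `&` B)) + fine (P (A `&` ~` B)).
Proof.
move=> mA mB; rewrite -fineD ?fin_num_measure//; last 2 first.
- exact: measurableI.
- by apply: measurableI => //; exact: measurableC.
by rewrite (measureDI P mA mB) addeC -setDE.
Qed.

Lemma fine_prob_le (A B : set T) : measurable A -> measurable B ->
  A `<=` B -> fine (P A) <= fine (P B).
Proof.
move=> mA mB AB; apply: fine_le; rewrite ?fin_num_measure//.
by apply: le_measure => //; rewrite inE.
Qed.

Lemma fine_prob_ge0 (A : set T) : 0 <= fine (P A).
Proof. exact: fine_ge0. Qed.

Lemma fine_prob_le1 (A : set T) : measurable A -> fine (P A) <= 1.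
Proof.
move=> mA; have := probability_le1 P mA.
by rewrite -[P A]fineK ?fin_num_measure// lee_fin.
Qed.

End probability_real.

Lemma expR1_le3 (R : realType) : expR 1 <= 3 :> R.
Proof.
(* (8/7)^8 < 3, and exp (1/8) <= 1/(1 - 1/8) *)
have h : expR (8^-1) <= 8 / 7 :> R.
  have := expR_ge1Dx (- (8^-1 : R)).
  rewrite expRN => h; rewrite -[leLHS]invrK -[leRHS]invrK lef_pV2 ?posrE ?invr_gt0 ?expR_gt0//.
  lra.
have -> : (1 : R) = 8%:R * 8^-1 by rewrite mulfV ?pnatr_eq0.
rewrite expRM_natl.
apply: le_trans (_ : (8 / 7) ^+ 8 <= _); last lra.
by rewrite lerXn2r// nnegrE ?expR_ge0// divr_ge0.
Qed.

Section log_density.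
Context d (T : measurableType d) (R : realType).
Variables (P1 P0 : probability T R) (l : T -> R).
Hypothesis P10 : equivalent_measures P1 P0.
Hypothesis ml : measurable_fun setT l.
Hypothesis P1E : forall B, measurable B ->
  P1 B = (\int[P0]_(x in B) (expR (l x))%:E)%E.

Let mexpl : measurable_fun setT (fun x => (expR (l x))%:E).
Proof. exact/measurable_EFinP/measurableT_comp. Qed.

Let integrable_expl : P0.-integrable setT (fun x => (expR (l x))%:E).
Proof.
apply/integrableP; split => //.
under eq_integral do rewrite gee0_abs ?lee_fin ?expR_ge0//.
by rewrite -P1E// probability_setT ltry.
Qed.

(** Only an almost sure version of the density is available, whereas the optimal
    rule is defined from one particular version; this makes the sign of l a
    substitute for the rule. *)
Lemma density_log_density :
  {ae P0, forall x, density P1 P0 x = (expR (l x))%:E}.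
Proof.
have h : ae_eq P0 setT (density P1 P0) (fun x => (expR (l x))%:E).
  apply: integral_ae_eq => //.
    by apply: Radon_Nikodym_integrable; case: P10.
  move=> E _ mE; rewrite -P1E// -Radon_Nikodym_integral//.
  by case: P10.
by apply: filterS h => x; exact.
Qed.

Lemma measurable_optimal_rule (b : bool) :
  measurable [set x | optimal_rule P1 P0 x = b].
Proof.
have -> : [set x | optimal_rule P1 P0 x = b] =
    setT `&` density P1 P0 @^-1` [set y | (1 <= y)%E = b].
  by rewrite setTI; apply/seteqP; split => x /=;
    rewrite /optimal_rule /log_ratio lne_ge0.
have mf : measurable_fun setT (density P1 P0).
  by apply: (measurable_int P0); apply: Radon_Nikodym_integrable; case: P10.
apply: mf => //.
case: b.
  rewrite (_ : mkset _ = `[1%E, +oo%E]%classic); first exact: emeasurable_itv.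
  by apply/seteqP; split => x /=; rewrite in_itv/= leey andbT.
rewrite (_ : mkset _ = `[-oo%E, 1%E[%classic); first exact: emeasurable_itv.
by apply/seteqP; split => x /=; rewrite in_itv/= leNye/= ltNge; [move=> ->|move/negbTE].
Qed.

Lemma ae_prob_eq0 (A : set T) : measurable A ->
  A `<=` [set x | density P1 P0 x <> (expR (l x))%:E] -> P0 A = 0 /\ P1 A = 0.
Proof.
move=> mA AN; have P0A : P0 A = 0.
  have [N [mN N0 sN]] := density_log_density.
  apply/eqP; rewrite -measure_le0 -N0; apply: le_measure; rewrite ?inE//.
  by apply: subset_trans AN _; move=> x /= h; apply: sN.
split => //.
by have /null_content_dominatesP := P10.1; exact.
Qed.

Lemma optimal_rule_prob (b : bool) (A : set T) : measurable A ->
  A `<=` [set x | optimal_rule P1 P0 x = b] ->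
  let A' := A `&` [set x | (0 <= l x) = b] in
  fine (P0 A) = fine (P0 A') /\ fine (P1 A) = fine (P1 A').
Proof.
move=> mA Ab A'.
have mB : measurable [set x | (0 <= l x) = b].
  have -> : [set x | (0 <= l x) = b] =
      setT `&` l @^-1` [set y | (0 <= y) = b] by rewrite setTI.
  apply: ml => //; case: b {Ab A'}.
    by rewrite (_ : mkset _ = `[0, +oo[%classic) // set_itv_c_infty.
  rewrite (_ : mkset _ = `]-oo, 0[%classic) // set_itv_infty_o.
  by apply/seteqP; split => x /=; rewrite ltNge; [move=> ->|move/negbTE].
have mA'' : measurable (A `&` ~` [set x | (0 <= l x) = b]).
  by apply: measurableI => //; exact: measurableC.
have [||P0A P1A] := @ae_prob_eq0 (A `&` ~` [set x | (0 <= l x) = b]) => //.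
  move=> x /= [Ax nb] lE; apply: nb; rewrite -(Ab _ Ax)/=.
  rewrite /optimal_rule /log_ratio lne_ge0 lE lee_fin.
  by rewrite -expR0 ler_expR.
by split; rewrite (fine_prob_setIC _ mA mB) ?P0A ?P1A addr0.
Qed.

Lemma prob_ge_log_density (c : R) (B : set T) : measurable B ->
  (forall x, B x -> c <= l x) -> expR c * fine (P0 B) <= fine (P1 B).
Proof.
move=> mB cl; rewrite -lee_fin EFinM !fineK ?fin_num_measure// P1E//.
rewrite -integral_cst//; apply: ge0_le_integral => //.
- by move=> x _; rewrite lee_fin expR_ge0.
- exact: measurable_funTS.
- by move=> x Bx; rewrite lee_fin ler_expR cl.
Qed.

Lemma prob_le_log_density (c : R) (B : set T) : measurable B ->
  (forall x, B x -> l x <= c) -> fine (P1 B) <= expR c * fine (P0 B).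
Proof.
move=> mB cl; rewrite -lee_fin EFinM !fineK ?fin_num_measure// P1E//.
rewrite -integral_cst//; apply: ge0_le_integral => //.
- exact: measurable_funTS.
- by move=> x Bx; rewrite lee_fin ler_expR cl.
Qed.

(** Off the ball |l| <= t the density ratio is at least exp t, so that P0 is
    there at most exp (-t) times P1; on the ball, P1 <= exp t P0. *)
Let excess_pos (t : R) (A : set T) : 0 <= t -> measurable A ->
  A `<=` [set x | 0 <= l x] ->
  (1 - expR (- t)) * (fine (P1 A) -
     expR t * fine (P0 (A `&` [set x | `|l x| <= t])))
  <= fine (P1 A) - fine (P0 A).
Proof.
move=> t0 mA Al.
have mB : measurable [set x | `|l x| <= t].
  have -> : [set x | `|l x| <= t] = setT `&` l @^-1` `[- t, t].
    by rewrite setTI; apply/seteqP; split => x /=; rewrite in_itv/= ler_norml.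
  exact: ml.
have mAB := measurableI _ _ mA mB.
have mAC := measurableI _ _ mA (measurableC mB).
have a1 : fine (P1 (A `&` [set x | `|l x| <= t])) <=
    expR t * fine (P0 (A `&` [set x | `|l x| <= t])).
  by apply: prob_le_log_density => // x [_ /=]; apply: le_trans; exact: ler_norm.
have a2 : expR 0 * fine (P0 (A `&` [set x | `|l x| <= t])) <=
    fine (P1 (A `&` [set x | `|l x| <= t])).
  by apply: prob_ge_log_density => // x [/Al].
have a3 : expR t * fine (P0 (A `&` ~` [set x | `|l x| <= t])) <=
    fine (P1 (A `&` ~` [set x | `|l x| <= t])).
  apply: prob_ge_log_density => // x [/Al/= l0].
  by rewrite ger0_norm// => /negP; rewrite -ltNge => /ltW.
have a4 : fine (P0 (A `&` ~` [set x | `|l x| <= t])) <=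
    expR (- t) * fine (P1 (A `&` ~` [set x | `|l x| <= t])).
  by rewrite expRN mulrC ler_pdivlMr ?expR_gt0// mulrC.
have e1 : expR (- t) <= 1 by rewrite -expR0 ler_expR oppr_le0.
rewrite (fine_prob_setIC P1 mA mB) (fine_prob_setIC P0 mA mB).
rewrite expR0 mul1r in a2.
set u := fine (P1 (A `&` _)) in a1 a2 *.
set v := fine (P0 (A `&` _)) in a1 a2 *.
set u' := fine (P1 (A `&` _)) in a3 a4 *.
set v' := fine (P0 (A `&` _)) in a3 a4 *.
have := ler_wpM2l (_ : 0 <= 1 - expR (- t)) a1.
rewrite subr_ge0 => /(_ e1).
nra.
Qed.

Let excess_neg (t : R) (A : set T) : 0 <= t -> measurable A ->
  A `<=` [set x | l x <= 0] ->
  (1 - expR (- t)) * (fine (P0 A) - fine (P0 (A `&` [set x | `|l x| <= t])))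
  <= fine (P0 A) - fine (P1 A).
Proof.
move=> t0 mA Al.
have mB : measurable [set x | `|l x| <= t].
  have -> : [set x | `|l x| <= t] = setT `&` l @^-1` `[- t, t].
    by rewrite setTI; apply/seteqP; split => x /=; rewrite in_itv/= ler_norml.
  exact: ml.
have mAB := measurableI _ _ mA mB.
have mAC := measurableI _ _ mA (measurableC mB).
have a2 : fine (P1 (A `&` [set x | `|l x| <= t])) <=
    expR 0 * fine (P0 (A `&` [set x | `|l x| <= t])).
  by apply: prob_le_log_density => // x [/Al].
have a3 : fine (P1 (A `&` ~` [set x | `|l x| <= t])) <=
    expR (- t) * fine (P0 (A `&` ~` [set x | `|l x| <= t])).
  apply: prob_le_log_density => // x [/Al/= l0].
  by rewrite ler0_norm// => /negP; rewrite -ltNge => /ltW; rewrite lerNr.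
rewrite (fine_prob_setIC P1 mA mB) (fine_prob_setIC P0 mA mB).
rewrite expR0 mul1r in a2.
lra.
Qed.

(** The excess cost is half the integral of |dP1 - dP0| over the set of
    disagreement. Its parts where the optimal decision is 1 and 0 are treated
    by excess_pos and excess_neg; their masses under P1 and P0 respectively add
    up to twice the learning error. *)
Lemma excess_cost_margin (g : T -> bool) (t : R) : measurable_fun setT g ->
  0 <= t ->
  2^-1 * (1 - expR (- t)) *
    (2 * learning_error P1 P0 g - expR t * fine (P0 [set x | `|l x| <= t]))
  <= cost P1 P0 g - cost P1 P0 (optimal_rule P1 P0).
Proof.
move=> mg t0.
have mgb b : measurable [set x | g x <> b].
  rewrite (_ : mkset _ = setT `&` g @^-1` [set b' | b' <> b]) ?setTI//.
  by rewrite -[X in measurable X]setTI; exact: mg.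
have mo := measurable_optimal_rule.
have mB : measurable [set x | `|l x| <= t].
  have -> : [set x | `|l x| <= t] = setT `&` l @^-1` `[- t, t].
    by rewrite setTI; apply/seteqP; split => x /=; rewrite in_itv/= ler_norml.
  exact: ml.
set opt := optimal_rule P1 P0.
pose G1 := [set x | g x <> true /\ opt x = true].
pose G0 := [set x | g x <> false /\ opt x = false].
have mG1 : measurable G1 by exact: measurableI (mgb true) (mo true).
have mG0 : measurable G0 by exact: measurableI (mgb false) (mo false).
have setE b : [set x | opt x <> b] = [set x | opt x = ~~ b].
  by apply/seteqP; split => x /=; case: (opt x) b => -[].
have costE : cost P1 P0 g - cost P1 P0 opt =
    2^-1 * (fine (P1 G1) - fine (P0 G1) + (fine (P0 G0) - fine (P1 G0))).
  rewrite /cost !setE/=.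
  rewrite (fine_prob_setIC P1 (mgb true) (mo true)).
  rewrite (fine_prob_setIC P0 (mgb false) (mo false)).
  rewrite (fine_prob_setIC P1 (mo false) (mgb false)).
  rewrite (fine_prob_setIC P0 (mo true) (mgb true)).
  have -> : [set x | g x <> true] `&` [set x | opt x = true] = G1 by [].
  have -> : [set x | g x <> false] `&` [set x | opt x = false] = G0 by [].
  have -> : [set x | opt x = true] `&` [set x | g x <> true] = G1.
    by rewrite setIC.
  have -> : [set x | opt x = false] `&` [set x | g x <> false] = G0.
    by rewrite setIC.
  have -> : [set x | opt x = false] `&` ~` [set x | g x <> false] =
      [set x | g x <> true] `&` ~` [set x | opt x = true].
    by apply/seteqP; split => x /=; case: (g x) (opt x) => -[]; intuition.
  have -> : [set x | opt x = true] `&` ~` [set x | g x <> true] =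
      [set x | g x <> false] `&` ~` [set x | opt x = false].
    by apply/seteqP; split => x /=; case: (g x) (opt x) => -[]; intuition.
  lra.
have [|P0G1 P1G1] := @optimal_rule_prob true G1 mG1; first by move=> x [].
have [|P0G0 P1G0] := @optimal_rule_prob false G0 mG0; first by move=> x [].
set H1 := G1 `&` _ in P0G1 P1G1.
set H0 := G0 `&` _ in P0G0 P1G0.
have ml0 b : measurable [set x | (0 <= l x) = b].
  have -> : [set x | (0 <= l x) = b] =
      setT `&` l @^-1` [set y | (0 <= y) = b] by rewrite setTI.
  apply: ml => //; case: b.
    by rewrite (_ : mkset _ = `[0, +oo[%classic) // set_itv_c_infty.
  rewrite (_ : mkset _ = `]-oo, 0[%classic) // set_itv_infty_o.
  by apply/seteqP; split => x /=; rewrite ltNge; [move=> ->|move/negbTE].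
have mH1 : measurable H1 by exact: measurableI.
have mH0 : measurable H0 by exact: measurableI.
have h1 := @excess_pos t H1 t0 mH1 (@subIsetr _ _ _).
have h0 : H0 `<=` [set x | l x <= 0].
  by move=> x [_ /= /negbT]; rewrite -ltNge => /ltW.
have {}h0 := @excess_neg t H0 t0 mH0 h0.
rewrite costE /learning_error -/G1 -/G0.
rewrite P0G1 P1G1 P0G0 P1G0.
have e1 : expR (- t) <= 1 by rewrite -expR0 ler_expR oppr_le0.
have e2 : 1 <= expR t by rewrite -{1}expR0 ler_expR.
have mHB A : measurable A -> measurable (A `&` [set x | `|l x| <= t]).
  by move=> mA; exact: measurableI.
have sum_le : fine (P0 (H1 `&` [set x | `|l x| <= t])) +
    fine (P0 (H0 `&` [set x | `|l x| <= t])) <= fine (P0 [set x | `|l x| <= t]).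
  rewrite [leRHS](fine_prob_setIC P0 mB (ml0 true)); apply: lerD.
    apply: fine_prob_le; [exact: mHB|exact: measurableI|].
    by move=> x [[_ ?] ?]; split.
  apply: fine_prob_le; [exact: mHB| |].
    by apply: measurableI => //; exact: measurableC.
  by move=> x [[_ /= ->] ?]; split.
have := fine_prob_ge0 P0 (H0 `&` [set x | `|l x| <= t]).
set w0 := fine (P0 (H0 `&` _)) in h0 sum_le *.
set w1 := fine (P0 (H1 `&` _)) in h1 sum_le *.
set w := fine (P0 [set x | _]) in sum_le *.
move=> w00.
have : expR t * w1 + w0 <= expR t * w by nra.
move=> hw.
have := ler_wpM2l (_ : 0 <= 1 - expR (- t)) hw.
rewrite subr_ge0 => /(_ e1).
nra.
Qed.

(** The margin inequality at t = s^k, with s chosen so that the ball costs at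
    most half of the learning error r, that is 3 K s = r. If this s exceeds 1,
    s = 1 is used and the bound is linear in r. The factor 3 bounds exp t. *)
Lemma excess_cost_small_ball (k : nat) (K : R) : 0 < K ->
  (forall s : R, 0 < s -> s <= 1 -> fine (P0 [set x | `|l x| <= s ^+ k]) <= K * s) ->
  forall g : T -> bool, measurable_fun setT g ->
  Num.min (learning_error P1 P0 g ^+ k.+1 / (4 * (3 * K) ^+ k))
          (learning_error P1 P0 g / 4)
  <= cost P1 P0 g - cost P1 P0 (optimal_rule P1 P0).
Proof.
move=> K0 small g mg; set r := learning_error P1 P0 g.
have r0 : 0 <= r.
  by rewrite /r /learning_error mulr_ge0// addr_ge0// fine_prob_ge0.
have K30 : 0 < 3 * K by rewrite mulr_gt0.
have key (s : R) : 0 < s -> s <= 1 -> 3 * K * s <= r ->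
    s ^+ k * r / 4 <= cost P1 P0 g - cost P1 P0 (optimal_rule P1 P0).
  move=> s0 s1 Ksr.
  have t0 : 0 <= s ^+ k by rewrite exprn_ge0 ?ltW.
  have t1 : s ^+ k <= 1 by apply: exprn_ile1 => //; exact: ltW.
  apply: le_trans (excess_cost_margin mg t0).
  rewrite -/r; set t := s ^+ k in t0 t1 *.
  have e3 : expR t <= 3.
    by apply: le_trans (expR1_le3 R); rewrite ler_expR.
  have e1 : t / 2 <= 1 - expR (- t).
    have e := expR_ge1Dx t.
    have : expR (- t) <= (1 + t)^-1.
      by rewrite expRN lef_pV2 ?posrE ?expR_gt0// ltr_wpDr.
    have : (1 + t)^-1 <= 1 - t / 2.
      rewrite -[_^-1]mul1r ler_pdivrMr ?ltr_wpDr//; nra.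
    lra.
  have sm := small s s0 s1; rewrite -/t in sm.
  have p0 := fine_prob_ge0 P0 [set x | `|l x| <= t].
  set p := fine _ in sm p0 *.
  have : expR t * p <= r by nra.
  nra.
have [rK|rK] := leP r (3 * K).
  have [->|rn0] := eqVneq r 0.
    rewrite expr0n/= mul0r mul0r minxx.
    have := excess_cost_margin mg (lexx 0).
    by rewrite oppr0 expR0 subrr mulr0 mul0r.
  rewrite ge_min; apply/orP; left.
  have s0 : 0 < r / (3 * K) by rewrite divr_gt0// lt_neqAle eq_sym rn0.
  apply: le_trans (key (r / (3 * K)) s0 _ _).
  - by rewrite expr_div_n exprSr invfM; set a := _^-1; set b := (_ ^+ k)^-1; lra.
  - by rewrite ler_pdivrMr// mul1r.
  - by rewrite mulrCA divff ?mulr1 ?gt_eqF.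
rewrite ge_min; apply/orP; right.
apply: le_trans (key 1 ltr01 (lexx _) _); last by rewrite mulr1 ltW.
by rewrite expr1n mul1r.
Qed.

End log_density.

(** * Total variation and the Hellinger affinity *)
Section dist1_bound.
Context d (T : measurableType d) (R : realType).
Variables (P1 P0 : probability T R) (l : T -> R).
Hypothesis ml : measurable_fun setT l.
Hypothesis P1E : forall B, measurable B ->
  P1 B = (\int[P0]_(x in B) (expR (l x))%:E)%E.

Let mexpl : measurable_fun setT (fun x => (expR (l x))%:E).
Proof. exact/measurable_EFinP/measurableT_comp. Qed.

Let integrable_expl : P0.-integrable setT (fun x => (expR (l x))%:E).
Proof.
apply/integrableP; split => //.
under eq_integral do rewrite gee0_abs ?lee_fin ?expR_ge0//.
by rewrite -P1E// probability_setT ltry.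
Qed.

Let integrable_diff : P0.-integrable setT (fun x => (expR (l x) - 1)%:E).
Proof.
under eq_fun do rewrite EFinB.
apply: integrableB => //.
exact: finite_measure_integrable_cst.
Qed.

Let prob_diff_le (E : set T) : measurable E ->
  (`|fine (P1 E) - fine (P0 E)|%:E <=
   \int[P0]_(x in E) `|expR (l x) - 1|%:E)%E.
Proof.
move=> mE.
have iE : P0.-integrable E (EFin \o (fun x => expR (l x) - 1)).
  exact: (integrableS measurableT).
have -> : (fine (P1 E) - fine (P0 E) = \int[P0]_(x in E) (expR (l x) - 1))%R.
  rewrite RintegralB//.
  - by rewrite Rintegral_cst// mul1r P1E.
  - exact: (integrableS measurableT).
  - exact: finite_measure_integrable_cst.
rewrite EFin_normr_Rintegral//.
by apply: le_abse_integral => //; case/integrableP : iE.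
Qed.

(** The total variation integral splits along the set where one density is
    below the other, and on each part it telescopes to a difference of
    probabilities; the dominating measure therefore disappears. *)
Lemma density_diff_le (nu : {finite_measure set T -> \bar R}) :
  P1 `<< nu -> P0 `<< nu ->
  (\int[nu]_x `|density P1 nu x - density P0 nu x| <=
   \int[P0]_x `|expR (l x) - 1|%:E)%E.
Proof.
move=> nu1 nu0.
have id1 : nu.-integrable setT (density P1 nu) by exact: Radon_Nikodym_integrable.
have id0 : nu.-integrable setT (density P0 nu) by exact: Radon_Nikodym_integrable.
have mf1 := measurable_int _ id1.
have mf0 := measurable_int _ id0.
have density_diff (P Q : probability T R) (E : set T) :
    P `<< nu -> Q `<< nu -> measurable E ->
  (\int[nu]_(x in E) (density P nu x - density Q nu x) =
   (fine (P E) - fine (Q E))%:E)%E.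
  move=> nuP nuQ mE; rewrite integralB//; [|by apply: (integrableS measurableT) => //; exact: Radon_Nikodym_integrable..].
  by rewrite -!Radon_Nikodym_integral//= EFinB !fineK ?fin_num_measure.
have fin1 x : density P1 nu x \is a fin_num by exact: Radon_Nikodym_fin_num.
have fin0 x : density P0 nu x \is a fin_num by exact: Radon_Nikodym_fin_num.
pose B := [set x | (density P1 nu x < density P0 nu x)%E].
have mB : measurable B by rewrite -[B]setTI; exact: emeasurable_fun_lt.
have mBC := measurableC mB.
have mdiff : measurable_fun setT
    (fun x => (density P1 nu x - density P0 nu x)%E) by exact: emeasurable_funB.
have mabs : measurable_fun setT
    (fun x => `|density P1 nu x - density P0 nu x|%E) by exact: measurableT_comp.
have mabs' : measurable_fun setT (fun x => `|expR (l x) - 1|%:E).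
  apply/measurable_EFinP/measurableT_comp => //; apply/measurable_EFinP.
  by case/integrableP : integrable_diff.
rewrite -(setUv B) ge0_integral_setU//=; [|by rewrite setUv|by apply/disj_setPCl].
rewrite [leRHS]ge0_integral_setU//=;
  [|by rewrite setUv|by apply/disj_setPCl].
apply: leeD.
- apply: le_trans (prob_diff_le mB).
  rewrite distrC; apply: le_trans (_ : (fine (P0 B) - fine (P1 B))%:E <= _)%E; last first.
    by rewrite lee_fin ler_norm.
  rewrite -density_diff//.
  rewrite le_eqVlt; apply/orP; left; apply/eqP; apply: eq_integral => x.
  rewrite inE /B/=; move: (fin1 x) (fin0 x).
  case: (density P1 nu x) => [a| |]//; case: (density P0 nu x) => [b| |]// _ _.
  by rewrite lte_fin => ab; rewrite -!EFinB abse_EFin ltr0_norm ?subr_lt0// opprB.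
- apply: le_trans (prob_diff_le mBC).
  apply: le_trans (_ : (fine (P1 (~` B)) - fine (P0 (~` B)))%:E <= _)%E; last first.
    by rewrite lee_fin ler_norm.
  rewrite -density_diff//.
  rewrite le_eqVlt; apply/orP; left; apply/eqP; apply: eq_integral => x.
  rewrite inE => /negP; rewrite -leNgt => Bx; rewrite gee0_abs// sube_ge0//.
  by rewrite fin1 orbT.
Qed.

Lemma dist1_le_integral :
  (dist1 P1 P0 <= \int[P0]_x `|expR (l x) - 1|%:E)%E.
Proof.
have sumE A : measure_add P1 P0 A = (P1 A + P0 A)%E by rewrite measure_addE.
apply: density_diff_le.
- apply/null_content_dominatesP => A mA; rewrite [LHS]sumE => /eqP.
  by rewrite padde_eq0 ?measure_ge0// => /andP[/eqP].
- apply/null_content_dominatesP => A mA; rewrite [LHS]sumE => /eqP.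
  by rewrite padde_eq0 ?measure_ge0// => /andP[_ /eqP].
Qed.

(** Write u = exp (l/2), so that |exp l - 1| = |u - 1| (u + 1); the weighted
    arithmetic-geometric inequality bounds it by
    (t (u - 1)^2 + (u + 1)^2/t)/2, whose integral is explicit in terms of A.
    The parameter t replaces an optimization that would produce a square
    root. *)
Lemma dist1_affinity (A t : R) :
  (\int[P0]_x (expR (l x / 2))%:E = A%:E)%E -> 0 < t ->
  (dist1 P1 P0 <= (t * (1 - A) + 2 / t)%:E)%E.
Proof.
move=> Aff t0; apply: le_trans dist1_le_integral _.
have mh : measurable_fun setT (fun x => (expR (l x / 2))%:E).
  apply/measurable_EFinP/measurableT_comp => //.
  exact: measurable_funM.
have ih : P0.-integrable setT (fun x => (expR (l x / 2))%:E).
  apply/integrableP; split => //.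
  under eq_integral do rewrite gee0_abs ?lee_fin ?expR_ge0//.
  by rewrite Aff ltry.
have i1 : P0.-integrable setT (EFin \o cst (1 : R)).
  exact: finite_measure_integrable_cst.
have expl2 x : expR (l x) = expR (l x / 2) ^+ 2.
  by rewrite -expRM_natl; congr expR; rewrite mulrC divfK.
have iz (f : T -> R) (c : R) : P0.-integrable setT (EFin \o f) ->
    P0.-integrable setT (EFin \o (fun x => c * f x)).
  by move=> fi; rewrite /comp; under eq_fun do rewrite EFinM; exact: integrableZl.
have iadd (f h : T -> R) : P0.-integrable setT (EFin \o f) ->
    P0.-integrable setT (EFin \o h) ->
    P0.-integrable setT (EFin \o (fun x => f x + h x)).
  by move=> fi hi; rewrite /comp; under eq_fun do rewrite EFinD; exact: integrableD.
have int_expl : \int[P0]_x expR (l x) = 1.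
  by rewrite /Rintegral -P1E// probability_setT.
have int_h : \int[P0]_x expR (l x / 2) = A by rewrite /Rintegral Aff.
have intq a b c : P0.-integrable setT
      (EFin \o (fun x => a * expR (l x) + b + c * expR (l x / 2))) /\
    \int[P0]_x (a * expR (l x) + b + c * expR (l x / 2)) = a + b + c * A.
  have i1' : P0.-integrable setT (EFin \o (fun x => a * expR (l x))).
    exact: iz.
  have i2' : P0.-integrable setT (EFin \o (fun x => c * expR (l x / 2))).
    exact: iz.
  have i3 : P0.-integrable setT (EFin \o cst b).
    exact: finite_measure_integrable_cst.
  split; first exact: (iadd _ _ (iadd _ _ i1' i3) i2').
  rewrite RintegralD//; last exact: (iadd _ _ i1' i3).
  rewrite RintegralD// Rintegral_cst// !RintegralZl//.
  have PT : fine (P0 setT) = 1 by rewrite probability_setT.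
  by rewrite int_expl int_h [X in b * X]PT !mulr1.
have A1 : A <= 1.
  rewrite -int_h -[leRHS]addr0 -[X in X + 0](_ : 2^-1 + 2^-1 + 0 * A = 1); last lra.
  have [i <-] := intq 2^-1 2^-1 0; rewrite addr0.
  apply: le_Rintegral => // x _.
  rewrite expl2; have := sqr_ge0 (expR (l x / 2) - 1); lra.
have [i iE] := intq ((t + t^-1) / 2) ((t + t^-1) / 2) (t^-1 - t).
apply: (@le_trans _ _ (\int[P0]_x
    (((t + t^-1) / 2) * expR (l x) + ((t + t^-1) / 2) +
     (t^-1 - t) * expR (l x / 2))%:E)%E).
  apply: ge0_le_integral => //.
  - by apply/measurable_EFinP; apply: measurableT_comp => //; apply: measurable_funB => //; apply/measurable_EFinP.
  - by case/integrableP : i.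
  - move=> x _; rewrite lee_fin expl2; set u := expR _.
    have u0 : 0 <= u by exact: expR_ge0.
    have ti : t * t^-1 = 1 by rewrite divff// gt_eqF.
    have ti0 : 0 < t^-1 by rewrite invr_gt0.
    set v := t^-1 in ti ti0 *.
    have -> : (t + v) / 2 * u ^+ 2 + (t + v) / 2 + (v - t) * u =
      (t * (u - 1) ^+ 2 + v * (u + 1) ^+ 2) / 2 by field.
    have vt2 : v * t ^+ 2 = t by rewrite expr2 mulrA [v * t]mulrC ti mul1r.
    (* a nonnegative square over t: c = 1 and c = -1 are the two signs of the bound *)
    have sq c : 0 <= t * (u - 1) ^+ 2 + c * (u ^+ 2 - 1) *+ 2
        + c ^+ 2 * (v * (u + 1) ^+ 2).
      have -> : t * (u - 1) ^+ 2 + c * (u ^+ 2 - 1) *+ 2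
          + c ^+ 2 * (v * (u + 1) ^+ 2) = v * (t * (u - 1) + c * (u + 1)) ^+ 2.
        have -> : v * (t * (u - 1) + c * (u + 1)) ^+ 2 =
          (v * t ^+ 2) * (u - 1) ^+ 2 + (c * (t * v) * (u ^+ 2 - 1)) *+ 2
          + c ^+ 2 * (v * (u + 1) ^+ 2) by ring.
        by rewrite vt2 ti mulr1.
      by rewrite mulr_ge0 ?sqr_ge0// ltW.
    rewrite ler_norml; apply/andP; split.
      by have := sq 1; lra.
    by have := sq (-1); lra.
rewrite -[X in (X <= _)%E]fineK; last exact: integrable_fin_num.
rewrite -/(Rintegral _ _ _) iE lee_fin.
have : 0 <= (1 - A) * t^-1 by rewrite mulr_ge0 ?subr_ge0// invr_ge0 ltW.
lra.
Qed.

End dist1_bound.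

(** * Normal laws on the line *)
Section affine_image.
Context {R : realType}.
Implicit Types (m s : R) (B : set (measurableTypeR R)).
Local Notation mu := (@lebesgue_measure R).

Definition affine1 m s (z : measurableTypeR R) : measurableTypeR R := m + s * z.

Lemma measurable_affine1 m s : measurable_fun setT (affine1 m s).
Proof. by apply: measurable_funD => //; apply: measurable_funM. Qed.

Lemma lebesgue_measure_affine m s B : 0 < s -> measurable B ->
  mu (affine1 m s @^-1` B) = (s^-1%:E * mu B)%E.
Proof.
move=> s0 mB.
pose nu := mscale (NngNum (ltW s0))
  (measure_function_pushforward__canonical__measure_function_Measure
     mu (measurable_affine1 m s)).
have : mu B = nu B.
  apply: lebesgue_measure_unique => //= _ [[a b]] _ <-.
  rewrite /nu /mscale/= /pushforward.
  rewrite (_ : affine1 m s @^-1` _ = `]((a - m) / s), ((b - m) / s)]%classic).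
    rewrite !lebesgue_measure_itv/= !lte_fin ltr_pM2r ?invr_gt0// ltrD2r.
    case: ifP => _; last by rewrite mule0.
    by rewrite -!EFinB -EFinM; congr EFin; field; rewrite gt_eqF.
  apply/seteqP; split => x /=; rewrite !in_itv/= /affine1;
    rewrite ltr_pdivrMr// ler_pdivlMr// (mulrC x s).
    by move=> /andP[? ?]; apply/andP; split; lra.
  by move=> /andP[? ?]; apply/andP; split; lra.
rewrite /nu /mscale/= /pushforward => ->.
by rewrite muleA -EFinM mulVf ?gt_eqF// mul1e.
Qed.

Lemma normal_prob_affine m s B : 0 < s -> measurable B ->
  normal_prob 0 1 (affine1 m s @^-1` B) = normal_prob m s B.
Proof.
move=> s0 mB; rewrite /normal_prob.
pose g (y : measurableTypeR R) := (normal_pdf 0 1 ((y - m) / s))%:E.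
have mg : measurable_fun setT g.
  apply/measurable_EFinP; apply: measurableT_comp; first exact: measurable_normal_pdf.
  by apply: measurable_funM => //; apply: measurable_funB.
have g0 y : (0 <= g y)%E by rewrite lee_fin normal_pdf_ge0.
have -> : (\int[mu]_(x in affine1 m s @^-1` B) (normal_pdf 0 1 x)%:E =
    \int[mu]_(x in affine1 m s @^-1` B) (g \o affine1 m s) x)%E.
  apply: eq_integral => x _; rewrite /g /affine1/=.
  by rewrite addrAC subrr add0r mulrAC divff ?mul1r ?gt_eqF.
rewrite -ge0_integral_pushforward//=; last 2 first.
- exact: measurable_affine1.
- exact: measurable_funTS.
have si0 : 0 <= s^-1 by rewrite invr_ge0 ltW.
rewrite (@eq_measure_integral _ _ _ _ (mscale (NngNum si0) mu)); last first.
  by move=> mf A mA _; rewrite /= /pushforward lebesgue_measure_affine.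
  exact: measurable_affine1.
rewrite ge0_integral_mscale//=; last exact: measurable_funTS.
rewrite -ge0_integralZl//=; last exact: measurable_funTS.
apply: eq_integral => x _; rewrite /g -EFinM; congr EFin.
rewrite !normal_pdfE ?gt_eqF// /normal_peak /normal_fun expr1n mul1r subr0.
rewrite -mulrnAr sqrtrM ?sqr_ge0// sqrtr_sqr gtr0_norm// invfM mulrA.
congr (_ * expR _).
rewrite expr_div_n -mulr_natr -[in RHS]mulr_natr; field.
by rewrite gt_eqF.
Qed.

Lemma normal_prob_opp B : measurable B ->
  normal_prob 0 1 (-%R @^-1` B) = normal_prob 0 1 B.
Proof.
move=> mB; rewrite /normal_prob.
pose g (y : measurableTypeR R) := (normal_pdf 0 1 y)%:E.
have mg : measurable_fun setT g.
  apply/measurable_EFinP; exact: measurable_normal_pdf.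
have g0 y : (0 <= g y)%E by rewrite lee_fin normal_pdf_ge0.
pose op : measurableTypeR R -> measurableTypeR R := fun x => - x.
have mop : measurable_fun setT op by exact: measurableT_comp.
rewrite [RHS](_ : _ = \int[mu]_(x in B) g x)%E//.
transitivity (\int[mu]_(x in op @^-1` B) (g \o op) x)%E.
  by apply: eq_integral => x _; rewrite /g/= /op !normal_pdfE// /normal_fun !subr0 sqrrN.
rewrite -ge0_integral_pushforward//=; last exact: measurable_funTS.
by apply: eq_measure_integral => //= A mA _; exact: lebesgue_measureN.
Qed.

End affine_image.

Section integral_density.
Context d (T : measurableType d) (R : realType).
Variables (mu : {sigma_finite_measure set T -> \bar R})
  (nu : {finite_measure set T -> \bar R}) (f : T -> R).
Hypothesis mf : measurable_fun setT f.
Hypothesis f0 : forall x, 0 <= f x.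
Hypothesis nuE : forall B, measurable B -> nu B = (\int[mu]_(x in B) (f x)%:E)%E.

Lemma ge0_integral_density (g : T -> \bar R) (D : set T) : measurable D ->
  measurable_fun D g -> (forall x, (0 <= g x)%E) ->
  (\int[nu]_(x in D) g x = \int[mu]_(x in D) (g x * (f x)%:E))%E.
Proof.
move=> mD mg g0.
have numu : nu `<< mu.
  apply/null_content_dominatesP => A mA A0; rewrite nuE//.
  by apply: null_set_integral => //; apply/measurable_EFinP; exact: measurable_funTS.
have mF : measurable_fun setT (EFin \o f) by exact/measurable_EFinP.
have ifn := Radon_Nikodym_SigmaFinite.f_integrable numu.
have fae : ae_eq mu setT (Radon_Nikodym_SigmaFinite.f nu mu) (EFin \o f).
  apply: integral_ae_eq => // E _ mE.
  by rewrite -Radon_Nikodym_SigmaFinite.f_integral// nuE.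
rewrite -(Radon_Nikodym_SigmaFinite.change_of_variables numu)//.
apply: ae_eq_integral => //.
- apply: emeasurable_funM => //.
  exact: measurable_funTS (measurable_int _ ifn).
- by apply: emeasurable_funM => //; exact: measurable_funTS.
- by apply: filterS fae => x /(_ I) fx _; rewrite fx.
Qed.

End integral_density.

Section gaussian_density.
Context {R : realType}.
Local Notation N01 := (@normal_prob R 0 1).

(** The logarithm of the density of N(m, s^2) with respect to N(0, 1). *)
Definition log_ratio1 (m s : R) (z : measurableTypeR R) : R :=
  - ln s - (z - m) ^+ 2 / (2 * s ^+ 2) + z ^+ 2 / 2.

Lemma measurable_log_ratio1 m s : measurable_fun setT (log_ratio1 m s).
Proof.
by apply: measurable_funD; [apply: measurable_funB => //|];
   apply: measurable_funM => //; apply: measurable_funX => //; apply: measurable_funB.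
Qed.

Lemma normal_prob_log_ratio1 (m s : R) (B : set (measurableTypeR R)) : 0 < s ->
  measurable B ->
  normal_prob m s B = (\int[N01]_(x in B) (expR (log_ratio1 m s x))%:E)%E.
Proof.
move=> s0 mB.
rewrite (@ge0_integral_density _ _ _ lebesgue_measure _ (normal_pdf 0 1))//=.
- apply: eq_integral => x _; rewrite -EFinM; congr EFin.
  rewrite !normal_pdfE ?gt_eqF// /normal_peak /normal_fun expr1n mul1r subr0.
  rewrite -mulrnAr sqrtrM ?sqr_ge0// sqrtr_sqr gtr0_norm// invfM.
  rewrite (mulrC s^-1) -[LHS]mulrA [RHS]mulrCA; congr (_ * _).
  rewrite -[s^-1]lnK ?posrE ?invr_gt0// lnV// -!expRD; congr expR.
  by rewrite /log_ratio1 -mulr_natr -[X in _ = _ + _ / X]mulr_natr; field; rewrite gt_eqF.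
- exact: measurable_normal_pdf.
- apply/measurable_EFinP/measurableT_comp => //; apply: measurable_funTS.
  exact: measurable_log_ratio1.
Qed.

(** Completing the square: the integrand is the density of a normal law of
    variance 1/(1 + a) up to a constant. *)
Lemma integral_expR_quadratic (a b : R) : 0 < 1 + a ->
  (\int[N01]_x (expR (- a * x ^+ 2 / 2 + b * x))%:E =
   ((Num.sqrt (1 + a))^-1 * expR (b ^+ 2 / (2 * (1 + a))))%:E)%E.
Proof.
move=> a0; set s := (Num.sqrt (1 + a))^-1.
have s0 : 0 < s by rewrite invr_gt0 sqrtr_gt0.
have s2 : s ^+ 2 = (1 + a)^-1 by rewrite exprVn sqr_sqrtr// ltW.
set m := b / (1 + a).
have : (\int[N01]_x (expR (log_ratio1 m s x))%:E = 1)%E.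
  by rewrite -normal_prob_log_ratio1//; exact: probability_setT.
move=> total.
have -> : (fun x : R => (expR (- a * x ^+ 2 / 2 + b * x))%:E) = (fun x : R =>
    ((s * expR (b ^+ 2 / (2 * (1 + a))))%:E * (expR (log_ratio1 m s x))%:E)%E).
  apply/funext => x; rewrite -EFinM; congr EFin.
  rewrite -{1}[s]lnK ?posrE// -!expRD; congr expR.
  by rewrite /log_ratio1 s2 /m; field; rewrite gt_eqF.
rewrite ge0_integralZl//=.
- by rewrite total mule1.
- apply/measurable_EFinP/measurableT_comp => //; exact: measurable_log_ratio1.
- by rewrite lee_fin mulr_ge0 ?expR_ge0// ltW.
Qed.

(** Change of variables, with the image measure expressed by its density with
    respect to N(0, 1) itself. *)
Lemma ge0_integral_normal01_affine (m s : R) (g : measurableTypeR R -> \bar R) :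
  0 < s -> measurable_fun setT g -> (forall x, (0 <= g x)%E) ->
  (\int[N01]_x g (m + s * x)%R =
   \int[N01]_x (g x * (expR (log_ratio1 m s x))%:E))%E.
Proof.
move=> s0 mg g0.
transitivity (\int[normal_prob m s]_x g x)%E; last first.
  apply: ge0_integral_density => //.
  - apply: measurableT_comp => //; exact: measurable_log_ratio1.
  - by move=> B mB; rewrite /= normal_prob_log_ratio1.
have pf := @ge0_integral_pushforward _ _ _ _ R _ (measurable_affine1 m s)
  N01 setT g measurableT mg (fun y _ => g0 y).
rewrite preimage_setT in pf; rewrite -[LHS]pf.
apply: eq_measure_integral; first exact: measurable_affine1.
by move=> mf A mA _; rewrite /= /pushforward normal_prob_affine.
Qed.

End gaussian_density.

(** * The Fourier transform of the standard normal law *)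
Section bounded.
Context d (T : measurableType d) (R : realType) (P : probability T R).

Lemma bounded_integrable (f : T -> R) (M : R) : measurable_fun setT f ->
  (forall x, `|f x| <= M) -> P.-integrable setT (EFin \o f).
Proof.
move=> mf fM; apply: measurable_bounded_integrable => //.
  by rewrite [X in (X < _)%E]probability_setT ltry.
exists M; split; first exact: num_real.
by move=> x Mx y _ /=; rewrite (le_trans (fM y))// ltW.
Qed.

End bounded.

Section gaussian_fourier.
Context {R : realType}.
Local Notation N01 := (@normal_prob R 0 1).

Let mcos (u : R) : measurable_fun setT (fun x : measurableTypeR R => cos (u * x)).
Proof.
apply: (@measurableT_comp _ _ _ _ _ _ (@cos R)).
  exact: continuous_measurable_fun (@continuous_cos R).
by apply: measurable_funM.
Qed.

Let msin (u : R) : measurable_fun setT (fun x : measurableTypeR R => sin (u * x)).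
Proof.
apply: (@measurableT_comp _ _ _ _ _ _ (@sin R)).
  exact: continuous_measurable_fun (@continuous_sin R).
by apply: measurable_funM.
Qed.

Let icos (u : R) : N01.-integrable setT (EFin \o (fun x => cos (u * x))).
Proof.
apply: (@bounded_integrable _ _ _ _ _ 1); first exact: mcos.
by move=> x; rewrite ler_norml cos_geN1 cos_le1.
Qed.

Let isin (u : R) : N01.-integrable setT (EFin \o (fun x => sin (u * x))).
Proof.
apply: (@bounded_integrable _ _ _ _ _ 1); first exact: msin.
by move=> x; rewrite ler_norml sin_geN1 sin_le1.
Qed.

Lemma integral_expR_linear (b : R) :
  (\int[N01]_x (expR (b * x))%:E = (expR (b ^+ 2 / 2))%:E)%E.
Proof.
have := @integral_expR_quadratic R 0 b; rewrite addr0 => /(_ ltr01).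
rewrite sqrtr1 invr1 mul1r mulr1 => <-; apply: eq_integral => x _.
by rewrite oppr0 !mul0r add0r.
Qed.

Let iexp b : N01.-integrable setT (EFin \o (fun x => expR (b * x))).
Proof.
apply/integrableP; split.
  by apply/measurable_EFinP/measurableT_comp => //; apply: measurable_funM.
under eq_integral do rewrite /= ger0_norm ?expR_ge0//.
by rewrite integral_expR_linear ltry.
Qed.

(** A common dominating function for the two differentiations below. *)
Let dom (x : R) := expR (2 * x) + expR (- 2 * x).

Let idom : N01.-integrable setT (EFin \o dom).
Proof.
have -> : EFin \o dom = (fun x => (expR (2 * x))%:E + (expR (- 2 * x))%:E)%E.
  by apply/funext.
by apply: integrableD => //; exact: iexp.
Qed.

Let dom_ge (h x : R) : `|h| <= 1 -> (`|x| + 1) * expR (h * x) <= dom x.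
Proof.
move=> h1; apply: (@le_trans _ _ (expR (2 * `|x|))).
  have -> : 2 * `|x| = `|x| + `|x| by ring.
  rewrite expRD ler_pM ?expR_ge0// ?addr_ge0//.
    by rewrite addrC expR_ge1Dx.
  rewrite ler_expR; apply: le_trans (ler_norm _) _.
  by rewrite normrM -{2}[`|x|]mul1r ler_wpM2r.
rewrite /dom; case: (leP 0 x) => x0.
  by rewrite ger0_norm// lerDl expR_ge0.
by rewrite ltr0_norm// mulrN -mulNr lerDr expR_ge0.
Qed.

Lemma integral_sin_normal (u : R) : \int[N01]_x sin (u * x) = 0.
Proof.
suff : \int[N01]_x sin (u * x) = - \int[N01]_x sin (u * x) by lra.
pose op : measurableTypeR R -> measurableTypeR R := fun x => - x.
have mop : measurable_fun setT op by exact: measurableT_comp.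
have sinop (x : R) : sin (u * op x) = - sin (u * x) by rewrite /op mulrN sinN.
have pf := @integral_pushforward _ _ _ _ R _ mop N01 setT
  (EFin \o (fun x : measurableTypeR R => sin (u * x))).
rewrite preimage_setT in pf.
rewrite -mulN1r -RintegralZl//.
rewrite /Rintegral; congr fine.
transitivity (\int[pushforward N01 op]_y (sin (u * y))%:E)%E.
  apply: (@eq_measure_integral _ _ _ _ (measure_function_pushforward__canonical__measure_function_Measure N01 mop)).
  by move=> A mA _; rewrite /= /pushforward normal_prob_opp.
rewrite [LHS]pf//.
- by apply: eq_integral => x _ /=; rewrite sinop mulN1r.
- by apply/measurable_EFinP; exact: msin.
- have -> : (EFin \o (fun x => sin (u * x))) \o op = EFin \o (fun x => sin (- u * x)).
    by apply/funext => x /=; rewrite /op mulrN mulNr.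
  exact: isin.
Qed.

Let expE (h x : R) := expR (h * x - h ^+ 2 / 2).

Let expEM h x : expE h x = expR (- (h ^+ 2 / 2)) * expR (h * x).
Proof. by rewrite /expE addrC expRD. Qed.

Let iexpE h : N01.-integrable setT (EFin \o expE h).
Proof.
have -> : EFin \o expE h =
    (fun x => (expR (- (h ^+ 2 / 2)))%:E * (expR (h * x))%:E)%E.
  by apply/funext => x /=; rewrite expEM.
by apply: integrableZl => //; exact: iexp.
Qed.

Let int_expE h : \int[N01]_x expE h x = 1.
Proof.
have -> : (fun x => expE h x) = (fun x => expR (- (h ^+ 2 / 2)) * expR (h * x)).
  by apply/funext => x; rewrite expEM.
rewrite RintegralZl//.
by rewrite /Rintegral integral_expR_linear/= -expRD addNr expR0.
Qed.

Let iexpE_sin h u : N01.-integrable setT (EFin \o (fun x => expE h x * sin (u * x))).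
Proof.
apply: (le_integrable _ _ _ (iexpE h)) => //.
  apply/measurable_EFinP; apply: measurable_funM; last exact: msin.
  by have /integrableP[/measurable_EFinP] := iexpE h.
move=> x _ /=; rewrite lee_fin normrM ler_piMr//.
by rewrite ler_norml sin_geN1 sin_le1.
Qed.

(** The Cameron-Martin shift by h: expE h is the density of N(h, 1) with
    respect to N(0, 1), and the sine of a shifted variable expands by the
    addition formula. The constant 1 is added to the sine to integrate
    nonnegative functions. *)
Let shift_sin (h u : R) : \int[N01]_x (expE h x * sin (u * x)) =
  sin (u * h) * \int[N01]_x cos (u * x).
Proof.
have i1 : N01.-integrable setT (EFin \o cst (1 : R)).
  exact: finite_measure_integrable_cst.
have N1 : fine (N01 setT) = 1 by rewrite [X in fine X]probability_setT.
have mg : measurable_fun setT (fun x : measurableTypeR R => (1 + sin (u * x))%:E).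
  by apply/measurable_EFinP/measurable_funD => //; exact: msin.
have g0 (x : measurableTypeR R) : (0 <= (1 + sin (u * x))%:E)%E.
  by rewrite lee_fin -lerBlDl sub0r sin_geN1.
have /(congr1 fine) := @ge0_integral_normal01_affine R h 1 _ ltr01 mg g0.
rewrite -[LHS]/(\int[N01]_x (1 + sin (u * (h + 1 * x)))).
have -> : (fun x : measurableTypeR R => 1 + sin (u * (h + 1 * x))) =
    (fun x => 1 + (cos (u * h) * sin (u * x) + sin (u * h) * cos (u * x))).
  by apply/funext => x; rewrite mul1r mulrDr sinD addrC [in RHS]addrC; congr (_ + _); rewrite addrC mulrC.
have -> : (fun x : measurableTypeR R =>
      ((1 + sin (u * x))%:E * (expR (log_ratio1 h 1 x))%:E)%E) =
    (fun x => (expE h x + expE h x * sin (u * x))%:E).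
  apply/funext => x; rewrite -EFinM; congr EFin.
  rewrite mulrDl mul1r [sin _ * _]mulrC.
  have -> : expR (log_ratio1 h 1 x) = expE h x; last by [].
  by congr expR; rewrite /log_ratio1 ln1 oppr0; field.
rewrite -/(Rintegral _ _ _).
have is' : N01.-integrable setT (EFin \o (fun x : R => cos (u * h) * sin (u * x))).
  rewrite /comp; under eq_fun do rewrite EFinM.
  by apply: integrableZl => //; exact: isin.
have ic' : N01.-integrable setT (EFin \o (fun x : R => sin (u * h) * cos (u * x))).
  rewrite /comp; under eq_fun do rewrite EFinM.
  by apply: integrableZl => //; exact: icos.
have isc : N01.-integrable setT (EFin \o (fun x : R =>
    cos (u * h) * sin (u * x) + sin (u * h) * cos (u * x))).
  by rewrite /comp; under eq_fun do rewrite EFinD; exact: integrableD.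
rewrite RintegralD// RintegralD// RintegralD//.
rewrite Rintegral_cst// mul1r [fine _]N1 int_expE.
rewrite RintegralZl// RintegralZl//.
by rewrite integral_sin_normal mulr0 add0r => /addrI.
Qed.

Let derive_expE_sin (u h x : R) : is_derive h (1 : R)
  (fun h => expE h x * sin (u * x)) ((x - h) * (expE h x * sin (u * x))).
Proof.
rewrite /expE.
apply: trigger_derive.
by rewrite /GRing.scale/=; field.
Qed.

(** Stein's identity for the sine, obtained by differentiating shift_sin at
    h = 0. *)
Let mul_sin (u : R) :
  \int[N01]_x (x * sin (u * x)) = u * \int[N01]_x cos (u * x).
Proof.
pose f (h : R) (x : measurableTypeR R) := expE h x * sin (u * x).
have d1f h x : partial1of2 f h x = (x - h) * (expE h x * sin (u * x)).
  by rewrite partial1of2E; exact: (@derive_val _ _ _ _ _ _ _ (derive_expE_sin u h x)).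
have d0 : (fun h : R => sin (u * h) * \int[N01]_x cos (u * x))^`()%classic 0 =
    \int[N01]_x cos (u * x) * u.
  rewrite derive1E; apply: derive_val; apply: trigger_derive.
  by rewrite mulr0 cos0 /GRing.scale/=; ring.
have F1 : (fun x' => \int[N01]_y f x' y) =
    (fun h => sin (u * h) * \int[N01]_x cos (u * x)).
  by apply/funext => h; rewrite shift_sin.
rewrite mulrC -d0 -F1 (@differentiation_under_integral R _ _ N01 f setT measurableT 0 (-1) 1 _ _ _ dom)//.
- by apply: eq_Rintegral => x _; rewrite d1f /expE expr0n/= !(mul0r, subr0) expR0 mul1r.
- by rewrite /= in_itv/= ltrN10 ltr01.
- by move=> h _; exact: iexpE_sin.
- by move=> x; rewrite addr_ge0 ?expR_ge0.
- move=> h x /=; rewrite in_itv/= => /andP[h1 h2] _; rewrite d1f.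
  have hle1 : `|h| <= 1 by rewrite ler_norml !ltW.
  apply: le_trans (dom_ge x hle1).
  rewrite normrM ler_pM//.
    by rewrite (le_trans (ler_normB _ _))// lerD2l.
  rewrite normrM ger0_norm ?expR_ge0//.
  rewrite (le_trans (ler_piMr _ _)) ?expR_ge0//.
    by rewrite ler_norml sin_geN1 sin_le1.
  by rewrite ler_expR lerBlDr lerDl divr_ge0// sqr_ge0.
Qed.

Let derive_cos (u : R) : is_derive u (1 : R) (fun u : R => \int[N01]_x cos (u * x))
  (- \int[N01]_x (x * sin (u * x))).
Proof.
pose f (v : R) (x : measurableTypeR R) := cos (v * x).
have d1 (v x : R) : is_derive v (1 : R) (f ^~ x) (- x * sin (v * x)).
  rewrite /f; apply: trigger_derive.
  by rewrite /GRing.scale/=; ring.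
have d1f v x : partial1of2 f v x = - x * sin (v * x).
  by rewrite partial1of2E; exact: (@derive_val _ _ _ _ _ _ _ (d1 v x)).
have domf (v x : R) : `|partial1of2 f v x| <= dom x.
  rewrite d1f normrM normrN.
  have := @dom_ge 0 x; rewrite normr0 mul0r expR0 mulr1 => /(_ ler01).
  apply: le_trans; rewrite (@le_trans _ _ `|x|)// ?lerDl//.
  by rewrite ler_piMr// ler_norml sin_geN1 sin_le1.
have ixs : N01.-integrable setT (EFin \o (fun x => x * sin (u * x))).
  apply: (le_integrable _ _ _ idom) => //.
    by apply/measurable_EFinP; apply: measurable_funM => //; exact: msin.
  move=> x _ /=; rewrite lee_fin [leRHS]ger0_norm ?addr_ge0 ?expR_ge0//.
  by have := domf u x; rewrite d1f mulNr normrN.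
have Iu : `]u - 1, u + 1[%classic u.
  by rewrite /= in_itv/= ltrBlDr ltrDl ltr01.
have df x y : `]u - 1, u + 1[%classic x -> setT y -> derivable (f ^~ y) x 1.
  by move=> _ _; have := d1 x y; case.
have dom0 y : 0 <= dom y by rewrite addr_ge0 ?expR_ge0.
have cf x : `]u - 1, u + 1[%classic x -> N01.-integrable setT (EFin \o f x).
  by move=> _; exact: icos.
have db x y : `]u - 1, u + 1[%classic x -> setT y -> `|partial1of2 f x y| <= dom y.
  by move=> _ _; exact: domf.
apply: DeriveDef.
  exact: (@derivable_under_integral R _ _ N01 f setT measurableT u _ _ Iu cf df dom dom0 idom db).
rewrite -derive1E.
rewrite (@differentiation_under_integral R _ _ N01 f setT measurableT u _ _ Iu cf df dom dom0 idom db).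
rewrite -mulN1r -RintegralZl//.
by apply: eq_Rintegral => x _; rewrite d1f mulN1r mulNr.
Qed.

(** The transform satisfies F' u = - u F u and F 0 = 1. *)
Lemma integral_cos_normal (u : R) : \int[N01]_x cos (u * x) = expR (- u ^+ 2 / 2).
Proof.
have h (v : R) : is_derive v (1 : R)
    (fun u : R => (\int[N01]_x cos (u * x)) * expR (u ^+ 2 / 2)) 0.
  have hc := derive_cos v.
  apply: trigger_derive; rewrite mul_sin.
  by rewrite /GRing.scale/=; field.
have := is_derive_0_is_cst u 0 h.
rewrite expr0n/= mul0r expR0 mulr1.
have -> : \int[N01]_x cos (0 * x) = 1.
  under eq_Rintegral do rewrite mul0r cos0.
  by rewrite Rintegral_cst// mul1r [X in fine X]probability_setT.
set c := \int[N01]_x _ => cE.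
have e0 : expR (u ^+ 2 / 2) != 0 by rewrite gt_eqF// expR_gt0.
by apply: (mulIf e0); rewrite cE mulNr expRN mulVf.
Qed.

End gaussian_fourier.

(** * The standard Gaussian law on tuples *)
Section tuple_uniqueness.
Context {R : realType} {n : nat}.
Local Notation T := (n.-tuple (measurableTypeR R)).

Definition box (B : 'I_n -> set (measurableTypeR R)) : set T :=
  [set z | forall i, B i (tnth z i)].

Lemma measurable_box B : (forall i, measurable (B i)) -> measurable (box B).
Proof.
move=> mB.
have -> : box B = \bigcap_(i in [set: 'I_n]) ((fun z : T => tnth z i) @^-1` B i).
  by apply/seteqP; split=> [z zB i _|z zB i]; [exact: zB|exact: (zB i I)].
apply: fin_bigcap_measurable; first exact: finite_finset.
move=> i _; rewrite -[X in measurable X]setTI.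
exact: measurable_tnth.
Qed.

(** Boxes with sides in an intersection-stable generating class form an
    intersection-stable class that generates the product sigma-algebra. *)
Lemma tuple_measure_unique (G : set (set (measurableTypeR R)))
    (P Q : probability T R) :
  G setT -> setI_closed G -> G `<=` measurable -> measurable `<=` <<s G >> ->
  (forall B, (forall i, G (B i)) -> P (box B) = Q (box B)) ->
  forall A, measurable A -> P A = Q A.
Proof.
move=> GT GI Gm mG PQ A mA.
pose boxes := [set C | exists2 B, (forall i, G (B i)) & C = box B].
apply: (@measure_unique _ _ _ boxes (fun=> setT)) => //.
- apply/seteqP; split.
    apply: smallest_sub; first exact: smallest_sigma_algebra.
    rewrite -bigcup_seq => _ [i _ [B mB <-]].
    have : image_set_system setT (fun z : T => tnth z i) <<s boxes >> B.
      have := mG _ mB; apply: smallest_sub.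
        by apply: sigma_algebra_image; exact: smallest_sigma_algebra.
      move=> C GC /=; apply: sub_sigma_algebra.
      exists (fun j => if j == i then C else setT).
        by move=> j; case: ifP.
      rewrite setTI; apply/seteqP; split=> [z zC j|z /(_ i)].
        by case: eqP => [->|].
      by rewrite eqxx.
    by [].
  apply: smallest_sub; first exact: sigma_algebra_measurable.
  by move=> _ [B GB ->]; apply: measurable_box => i; apply: Gm; exact: GB.
- move=> _ _ [B GB ->] [C GC ->]; exists (fun i => B i `&` C i).
    by move=> i; exact: GI.
  by apply/seteqP; split=> z; [move=> [zB zC] i|move=> zBC; split=> i; case: (zBC i)].
- move=> _; exists (fun=> setT) => //.
  by apply/seteqP; split=> z // _ i.
- by rewrite bigcup_const//; exists 0.
- by move=> _ [B GB ->]; exact: PQ.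
- by move=> k; rewrite [X in (X < _)%E]probability_setT ltry.
Qed.

End tuple_uniqueness.

Section std_gaussian_construction.
Context {R : realType}.
Local Notation RT := (measurableTypeR R).

Definition tuple_cons (n : nat) (z : RT * n.-tuple RT) : n.+1.-tuple RT :=
  [tuple of z.1 :: z.2].

Lemma measurable_tuple_cons n : measurable_fun setT (@tuple_cons n).
Proof. exact: measurable_cons. Qed.

HB.instance Definition _ n :=
  isMeasurableFun.Build _ _ _ _ (@tuple_cons n) (@measurable_tuple_cons n).

Fixpoint gaussian_tuple (n : nat) : probability (n.-tuple RT) R :=
  match n with
  | 0 => [the probability _ _ of \d_ [tuple]]
  | n'.+1 => [the probability _ _ of
      distribution [the probability _ _ of
        ((normal_prob 0 1 : probability RT R) \x gaussian_tuple n')%E] (@tuple_cons n')]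
  end.

Lemma std_gaussian_tuple n : std_gaussian (gaussian_tuple n).
Proof.
elim: n => [|n IH] B mB.
  rewrite big_ord0 /= diracE (_ : _ \in _)// inE/= => -[].
  by [].
rewrite big_ord_recl -IH => [|i //].
have pE := @product_measure1E _ _ _ _ R (normal_prob 0 1 : probability RT R)
  (gaussian_tuple n) (B ord0) (box (fun i => B (lift ord0 i))) (mB ord0)
  (measurable_box (fun i => mB (lift ord0 i))).
rewrite -[RHS]pE.
rewrite /= /distribution /pushforward/=; congr (_ _).
apply/seteqP; split => [[x z] /= h|[x z] /= [h0 h] i].
  split; first exact: (h ord0).
  by move=> i; have := h (lift ord0 i); rewrite tnthS.
have [->//|] := eqVneq i ord0 => i0.
have [j ->] : exists j, i = lift ord0 j.
  by case: (unliftP ord0 i) i0 => [j ->|->]; [exists j|rewrite eqxx].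
by rewrite tnthS.
Qed.

(** A standard Gaussian law is unique, so that the recursive construction can
    replace any given one. *)
Lemma std_gaussianE n (gam : probability (n.-tuple RT) R) : std_gaussian gam ->
  forall A, measurable A -> gam A = gaussian_tuple n A.
Proof.
move=> hg; apply: (@tuple_measure_unique R n measurable) => //.
- by move=> A B; exact: measurableI.
- by move=> B mB; rewrite [LHS]hg// [RHS]std_gaussian_tuple.
Qed.

Lemma ge0_integral_gaussian_cons n (f : n.+1.-tuple RT -> \bar R) :
  measurable_fun setT f -> (forall z, (0 <= f z)%E) ->
  (\int[gaussian_tuple n.+1]_z f z =
   \int[normal_prob 0 1]_x \int[gaussian_tuple n]_z f (tuple_cons (x, z)))%E.
Proof.
move=> mf f0 /=.
rewrite ge0_integral_distribution//.
rewrite fubini_tonelli1//; first exact: measurableT_comp.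
by move=> z; exact: f0.
Qed.

Lemma integral_gaussian_cons n (f : n.+1.-tuple RT -> R) (M : R) :
  measurable_fun setT f -> (forall z, `|f z| <= M) ->
  \int[gaussian_tuple n.+1]_z f z =
   \int[normal_prob 0 1]_x \int[gaussian_tuple n]_z f (tuple_cons (x, z)).
Proof.
move=> mf fM; rewrite /Rintegral; congr fine => /=.
have mfc : measurable_fun setT (f \o @tuple_cons n) by exact: measurableT_comp.
rewrite integral_distribution//; last 2 first.
- exact/measurable_EFinP.
- by apply: (@bounded_integrable _ _ _ _ _ M) => // x; exact: fM.
rewrite -integral12_prod_meas1//; last first.
  by apply: (@bounded_integrable _ _ _ _ _ M) => // x; exact: fM.
apply: eq_integral => x _ /=; rewrite /fubini_F/= fineK//.
apply: integrable_fin_num => //.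
apply: (@bounded_integrable _ _ _ _ _ M) => [|z]; last exact: fM.
by apply: measurableT_comp mfc _; exact: pair1_measurable.
Qed.

Lemma tnth_tuple_cons0 n x (z : n.-tuple RT) : tnth (tuple_cons (x, z)) ord0 = x.
Proof. by []. Qed.

Lemma tnth_tuple_consS n x (z : n.-tuple RT) i :
  tnth (tuple_cons (x, z)) (lift ord0 i) = tnth z i.
Proof. by rewrite tnthS. Qed.

Lemma ge0_integral_gaussian_prod n (f : 'I_n -> RT -> R) :
  (forall i, measurable_fun setT (f i)) -> (forall i x, 0 <= f i x) ->
  (\int[gaussian_tuple n]_z (\prod_(i < n) f i (tnth z i))%:E =
   \prod_(i < n) \int[normal_prob 0 1]_x (f i x)%:E)%E.
Proof.
elim: n f => [|n IH] f mf f0.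
  rewrite big_ord0 (_ : (fun=> _) = cst 1%E); last first.
    by apply/funext => z /=; rewrite big_ord0.
  by rewrite integral_cst// mul1e [LHS]probability_setT.
have mprod k (h : 'I_k -> RT -> R) : (forall i, measurable_fun setT (h i)) ->
    measurable_fun setT (fun z : k.-tuple RT => \prod_(i < k) h i (tnth z i)).
  move=> mh; apply: measurable_prod => i _.
  by apply: measurableT_comp => //; exact: measurable_tnth.
have prod0 k (h : 'I_k -> RT -> R) : (forall i x, 0 <= h i x) ->
    forall z : k.-tuple RT, 0 <= \prod_(i < k) h i (tnth z i).
  by move=> h0 z; apply: prodr_ge0.
rewrite ge0_integral_gaussian_cons; last 2 first.
- by apply/measurable_EFinP; exact: (mprod n.+1 f).
- by move=> z; rewrite lee_fin prod0.
have c0 : (0 <= \int[gaussian_tuple n]_z (\prod_(i < n) f (lift ord0 i) (tnth z i))%:E)%E.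
  by apply: integral_ge0 => z _; rewrite lee_fin (prod0 n (fun i => f (lift ord0 i))).
transitivity (\int[normal_prob 0 1]_x ((f ord0 x)%:E *
  \int[gaussian_tuple n]_z (\prod_(i < n) f (lift ord0 i) (tnth z i))%:E))%E.
  apply: eq_integral => x _; rewrite -ge0_integralZl//; last 3 first.
  - apply/measurable_EFinP; exact: (mprod n (fun i => f (lift ord0 i))).
  - by move=> z _; rewrite lee_fin (prod0 n (fun i => f (lift ord0 i))).
  - by rewrite lee_fin.
  apply: eq_integral => z _; rewrite big_ord_recl tnth_tuple_cons0 EFinM.
  by under eq_bigr do rewrite tnth_tuple_consS.
rewrite (IH (fun i => f (lift ord0 i)))// in c0 *.
rewrite big_ord_recl ge0_integralZr//.
- exact/measurable_EFinP.
- by move=> x _; rewrite lee_fin.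
Qed.

End std_gaussian_construction.

(** * The Fourier transform determines a law on tuples *)
Section bounded_fubini.
Context d1 d2 (T1 : measurableType d1) (T2 : measurableType d2) (R : realType).
Variables (P1 : probability T1 R) (P2 : probability T2 R).

Lemma Rintegral_fubini_bounded (f : T1 -> T2 -> R) (M : R) :
  measurable_fun setT (fun z : T1 * T2 => f z.1 z.2) ->
  (forall x y, `|f x y| <= M) ->
  \int[P1]_x \int[P2]_y f x y = \int[P2]_y \int[P1]_x f x y.
Proof.
move=> mf fM; rewrite /Rintegral; congr fine.
have i2 x : P2.-integrable setT (EFin \o f x).
  apply: (@bounded_integrable _ _ _ _ _ M) => //.
  exact: (measurableT_comp mf (pair1_measurable x)).
have i1 y : P1.-integrable setT (EFin \o f ^~ y).
  apply: (@bounded_integrable _ _ _ _ _ M) => //.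
  exact: (measurableT_comp mf (pair2_measurable y)).
transitivity (\int[P1]_x \int[P2]_y (f x y)%:E)%E.
  apply: eq_integral => x _; rewrite fineK//.
  by apply: integrable_fin_num => //; exact: i2.
rewrite -[LHS]/(\int[P1]_x \int[P2]_y (EFin \o (fun z => f z.1 z.2)) (x, y))%E.
rewrite Fubini//; last first.
  by apply: (@bounded_integrable _ _ _ _ _ M).
apply: eq_integral => y _; rewrite /= fineK//.
by apply: integrable_fin_num => //; exact: i1.
Qed.

End bounded_fubini.

Section gaussian_tuple_fourier.
Context {R : realType}.
Local Notation RT := (measurableTypeR R).
Local Notation N01 := (@normal_prob R 0 1).

Lemma measurable_cos_affine (a t : R) :
  measurable_fun setT (fun x : RT => cos (a * x - t)).
Proof.
apply: (@measurableT_comp _ _ _ _ _ _ (@cos R)).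
  exact: continuous_measurable_fun (@continuous_cos R).
by apply: measurable_funB => //; apply: measurable_funM.
Qed.

Lemma integrable_cos_affine (c a t : R) :
  N01.-integrable setT (EFin \o (fun x : RT => c * cos (a * x - t))).
Proof.
apply: (@bounded_integrable _ _ _ _ _ `|c|).
  by apply: measurable_funM => //; exact: measurable_cos_affine.
by move=> x; rewrite normrM ler_piMr// ler_norml cos_geN1 cos_le1.
Qed.

Lemma integral_cos_normal_shift (a t : R) :
  \int[N01]_x cos (a * x - t) = cos t * expR (- a ^+ 2 / 2).
Proof.
have sinE x : sin (a * x) = cos (a * x - pi / 2).
  by rewrite cosB cos_pihalf sin_pihalf mulr0 add0r mulr1.
have ic c : N01.-integrable setT (EFin \o (fun x : R => c * cos (a * x))).
  have := integrable_cos_affine c a 0.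
  by under [in X in X -> _]eq_fun do rewrite subr0.
have isn c : N01.-integrable setT (EFin \o (fun x : R => c * sin (a * x))).
  have := integrable_cos_affine c a (pi / 2).
  by under [in X in X -> _]eq_fun do rewrite -sinE.
under eq_Rintegral do rewrite cosB mulrC [X in _ + X]mulrC.
have ic1 : N01.-integrable setT (EFin \o (fun x : R => cos (a * x))).
  by have := ic 1; under [in X in X -> _]eq_fun do rewrite mul1r.
have is1 : N01.-integrable setT (EFin \o (fun x : R => sin (a * x))).
  by have := isn 1; under [in X in X -> _]eq_fun do rewrite mul1r.
rewrite RintegralD// RintegralZl// RintegralZl//.
by rewrite integral_cos_normal integral_sin_normal mulr0 addr0.
Qed.

Lemma measurable_cos_linear n (u : 'I_n -> R) (t : R) :
  measurable_fun setT
    (fun z : n.-tuple RT => cos (\sum_(i < n) u i * tnth z i - t)).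
Proof.
apply: (@measurableT_comp _ _ _ _ _ _ (@cos R)).
  exact: continuous_measurable_fun (@continuous_cos R).
apply: measurable_funB => //; apply: measurable_sum => i.
by apply: measurable_funM => //; exact: measurable_tnth.
Qed.

Lemma integral_cos_gaussian n (u : 'I_n -> R) (t : R) :
  \int[gaussian_tuple n]_z cos (\sum_(i < n) u i * tnth z i - t) =
  cos t * expR (- (\sum_(i < n) u i ^+ 2) / 2).
Proof.
elim: n u t => [|n IH] u t.
  under eq_Rintegral do rewrite big_ord0 sub0r cosN.
  rewrite Rintegral_cst// [X in fine X]probability_setT mulr1.
  by rewrite big_ord0 oppr0 mul0r expR0 mulr1.
rewrite (@integral_gaussian_cons _ _ _ 1); last 2 first.
- exact: measurable_cos_linear.
- by move=> z; rewrite ler_norml cos_geN1 cos_le1.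
set e := expR (- (\sum_(i < n) u (lift ord0 i) ^+ 2) / 2).
transitivity (\int[N01]_x (e * cos (u ord0 * x - t))).
  apply: eq_Rintegral => x _; rewrite mulrC /e.
  rewrite -cosN opprB -IH; apply: eq_Rintegral => z _; congr cos.
  rewrite big_ord_recl tnth_tuple_cons0.
  under eq_bigr do rewrite tnth_tuple_consS.
  ring.
rewrite RintegralZl//; last first.
  apply: (@bounded_integrable _ _ _ _ _ 1).
    exact: measurable_cos_affine.
  by move=> x; rewrite ler_norml cos_geN1 cos_le1.
rewrite integral_cos_normal_shift mulrCA; congr (_ * _).
by rewrite /e -expRD big_ord_recl; congr expR; ring.
Qed.

End gaussian_tuple_fourier.

Section fourier_uniqueness.
Context {R : realType} {n : nat}.
Local Notation RT := (measurableTypeR R).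
Local Notation T := (n.-tuple RT).
Local Notation N01 := (@normal_prob R 0 1).
Local Notation gam := (@gaussian_tuple R n).

(** The density of N(x, e^2 I) at y up to normalization: symmetric in x and y,
    and a mixture of characters of x by bumpE. *)
Definition bump (e : R) (y x : T) : R :=
  \prod_(i < n) expR (- (tnth x i - tnth y i) ^+ 2 / (2 * e ^+ 2)).

Lemma bumpE (e : R) (y x : T) : 0 < e -> bump e y x =
  \int[gam]_z cos (\sum_(i < n) (tnth x i - tnth y i) / e * tnth z i).
Proof.
move=> e0; have := integral_cos_gaussian
  (fun i => (tnth x i - tnth y i) / e) 0.
rewrite cos0 mul1r => h.
transitivity (expR (- (\sum_(i < n) ((tnth x i - tnth y i) / e) ^+ 2) / 2)).
  rewrite -sumrN mulr_suml expR_sum; apply: eq_bigr => i _; congr expR.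
  by field; rewrite gt_eqF.
by rewrite -h; apply: eq_Rintegral => z _; rewrite subr0.
Qed.

Lemma integral_bump (P : probability T R) (e : R) (y : T) : 0 < e ->
  \int[P]_x bump e y x = \int[gam]_z \int[P]_x
   cos (\sum_(i < n) (tnth z i / e) * tnth x i
        - \sum_(i < n) tnth z i / e * tnth y i).
Proof.
move=> e0; under eq_Rintegral do rewrite bumpE//.
rewrite (@Rintegral_fubini_bounded _ _ _ _ _ _ _ _ 1); last 2 first.
- apply: (@measurableT_comp _ _ _ _ _ _ (@cos R)).
    exact: continuous_measurable_fun (@continuous_cos R).
  apply: measurable_sum => i.
  apply: measurable_funM; last first.
    exact: (measurableT_comp (measurable_tnth i) measurable_snd).
  apply: measurable_funM => //; apply: measurable_funB => //.
  exact: (measurableT_comp (measurable_tnth i) measurable_fst).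
- by move=> x z; rewrite ler_norml cos_geN1 cos_le1.
apply: eq_Rintegral => z _; apply: eq_Rintegral => x _; congr cos.
rewrite -sumrB; apply: eq_bigr => i _; ring.
Qed.

Let Ieps (e : R) (B : 'I_n -> set RT) (x y : T) : R :=
  \prod_(i < n) (\1_(B i) (tnth y i) * expR (log_ratio1 (tnth x i) e (tnth y i))).

Let measurable_Ieps (e : R) (B : 'I_n -> set RT) : (forall i, measurable (B i)) ->
  measurable_fun setT (fun z : T * T => Ieps e B z.1 z.2).
Proof.
move=> mB; apply: measurable_prod => i _.
have m1 : measurable_fun setT (fun z : T * T => tnth z.1 i : RT).
  exact: (measurableT_comp (measurable_tnth i) measurable_fst).
have m2 : measurable_fun setT (fun z : T * T => tnth z.2 i : RT).
  exact: (measurableT_comp (measurable_tnth i) measurable_snd).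
apply: measurable_funM.
  exact: (measurableT_comp (measurable_indic (mB i)) m2).
apply: measurableT_comp => //; apply: measurable_funD.
  apply: measurable_funB => //; apply: measurable_funM => //.
  by apply: measurable_funX; apply: measurable_funB.
by apply: measurable_funM => //; apply: measurable_funX.
Qed.

(** The left-hand side is the probability of a box for the sum of a vector of law
    P and an independent N(0, e^2 I) vector; by Tonelli it only involves P
    through the integrals of bumps. The density is taken with respect to the
    standard Gaussian law, hence the factor exp (y_i^2/2). *)
Lemma integral_smoothed_box (P : probability T R) (e : R) (B : 'I_n -> set RT) :
  0 < e -> (forall i, measurable (B i)) ->
  (\int[P]_x (\prod_(i < n) normal_prob (tnth x i) e (B i)) =
   \int[gam]_y ((\prod_(i < n) (\1_(B i) (tnth y i) *
      expR (- ln e + tnth y i ^+ 2 / 2))) * \int[P]_x bump e y x)%:E)%E.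
Proof.
move=> e0 mB.
have Ieps0 x y : 0 <= Ieps e B x y.
  by apply: prodr_ge0 => i _; rewrite mulr_ge0 ?expR_ge0// indicE.
transitivity (\int[P]_x \int[gam]_y (Ieps e B x y)%:E)%E.
  apply: eq_integral => x _; rewrite (@ge0_integral_gaussian_prod R n
    (fun i z => \1_(B i) z * expR (log_ratio1 (tnth x i) e z))); last 2 first.
  - move=> i; apply: measurable_funM; first exact: measurable_indic.
    by apply: measurableT_comp => //; exact: measurable_log_ratio1.
  - by move=> i z; rewrite mulr_ge0 ?expR_ge0// indicE.
  apply: eq_bigr => i _; rewrite normal_prob_log_ratio1//.
  rewrite [LHS]integral_mkcond; apply: eq_integral => z _.
  rewrite patchE indicE; case: ifP => _; by rewrite ?mul1r ?mul0r.
rewrite -[LHS]/(\int[P]_x \int[gam]_y ((fun z => (Ieps e B z.1 z.2)%:E) (x, y)))%E.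
rewrite fubini_tonelli//; last 2 first.
- by apply/measurable_EFinP; exact: measurable_Ieps.
- by move=> z; rewrite lee_fin.
apply: eq_integral => y _ /=.
have IepsE x : Ieps e B x y = (\prod_(i < n) (\1_(B i) (tnth y i) *
      expR (- ln e + tnth y i ^+ 2 / 2))) * bump e y x.
  rewrite /Ieps /bump -big_split/=; apply: eq_bigr => i _.
  rewrite -mulrA -expRD; congr (_ * expR _).
  by rewrite /log_ratio1; ring.
under eq_integral do rewrite IepsE EFinM.
have ib : P.-integrable setT (EFin \o bump e y).
  apply: (@bounded_integrable _ _ _ _ _ 1).
    apply: measurable_prod => i _; apply: measurableT_comp => //.
    apply: measurable_funM => //; apply: measurableT_comp => //.
    apply: measurable_funX; apply: measurable_funB => //.
    exact: measurable_tnth.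
  move=> x; rewrite ger0_norm; last by apply: prodr_ge0 => i _; exact: expR_ge0.
  apply: prodr_ile1 => i _; rewrite expR_ge0/= -expR0 ler_expR mulNr oppr_le0.
  by rewrite divr_ge0 ?sqr_ge0// mulr_ge0 ?sqr_ge0.
rewrite integralZl// EFinM; congr (_ * _)%E.
by rewrite /Rintegral fineK//; exact: integrable_fin_num.
Qed.

(** Sets whose indicator is, at every point, the eventual value of indicators
    of measurable sets evaluated at a perturbed point: the perturbation
    is of smaller order than the displacement of the end points, so no point
    of the boundary is lost. *)
Definition stable_set (B : set RT) : Prop :=
  exists2 I : nat -> set RT, (forall k, measurable (I k)) &
    forall x z : RT, \forall k \near \oo,
      I k (x + (k.+1%:R ^- 2) * z) <-> B x.

Lemma stable_setT : stable_set setT.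
Proof. by exists (fun=> setT) => // x z; apply: nearW. Qed.

Lemma stable_setI : setI_closed stable_set.
Proof.
move=> A B [I mI IA] [J mJ JB]; exists (fun k => I k `&` J k).
  by move=> k; exact: measurableI.
move=> x z; near=> k.
have h1 : I k (x + (k.+1%:R ^- 2) * z) <-> A x by near: k.
have h2 : J k (x + (k.+1%:R ^- 2) * z) <-> B x by near: k.
by split=> -[/h1 ? /h2 ?].
Unshelve. all: by end_near. Qed.

Lemma near_perturbed_lt (c x z : R) : \forall k \near \oo,
  (c + k.+1%:R^-1 < x + (k.+1%:R ^- 2) * z) = (c < x).
Proof.
have z0 : 0 < 1 + `|z| by rewrite ltr_wpDr.
have e1 : 0 < (1 + `|z|)^-1 by rewrite invr_gt0.
have [cx|xc] := ltP c x.
  have e2 : 0 < (x - c) / (1 + `|z|) by rewrite divr_gt0 ?subr_gt0.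
  near=> k; apply/idP.
  have : k.+1%:R^-1 < (PosNum e1)%:num by near: k; exact: near_infty_natSinv_lt.
  have : k.+1%:R^-1 < (PosNum e2)%:num by near: k; exact: near_infty_natSinv_lt.
  rewrite /= -exprVn.
  have : 0 < k.+1%:R^-1 :> R by rewrite invr_gt0.
  have zle : - `|z| <= z by rewrite lerNl -normrN ler_norm.
  set dl := k.+1%:R^-1 => d0.
  rewrite ltr_pdivlMr// => h2; rewrite -[X in _ < X]mul1r ltr_pdivlMr// => h1.
  have az := normr_ge0 z; set w := `|z| in zle h1 h2 az *.
  have dw : dl ^+ 2 * w <= dl * w by rewrite ler_wpM2r// expr2; nra.
  have : dl ^+ 2 * - w <= dl ^+ 2 * z by rewrite ler_wpM2l// sqr_ge0.
  lra.
near=> k; apply/negbTE; rewrite -leNgt.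
have : k.+1%:R^-1 < (PosNum e1)%:num by near: k; exact: near_infty_natSinv_lt.
rewrite /= -exprVn.
have : 0 < k.+1%:R^-1 :> R by rewrite invr_gt0.
have zle : z <= `|z| by rewrite ler_norm.
set dl := k.+1%:R^-1 => d0.
rewrite -[X in _ < X]mul1r ltr_pdivlMr// => h1.
have az := normr_ge0 z; set w := `|z| in zle h1 az *.
have : dl ^+ 2 * z <= dl ^+ 2 * w by rewrite ler_wpM2l// sqr_ge0.
have : dl ^+ 2 * w <= dl.
  have : dl * (dl * w) <= dl * 1 by rewrite ler_wpM2l ?ltW//; lra.
  by rewrite mulrA -expr2 mulr1.
lra.
Unshelve. all: by end_near. Qed.

Lemma stable_itv_oc (a b : R) : stable_set `]a, b]%classic.
Proof.
exists (fun k => `]a + k.+1%:R^-1, b + k.+1%:R^-1]%classic) => [k|x z].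
  exact: measurable_itv.
near=> k; rewrite /= !in_itv/=.
have -> : (a + k.+1%:R^-1 < x + (k.+1%:R ^- 2) * z) = (a < x).
  by near: k; exact: near_perturbed_lt.
rewrite leNgt.
have -> : (b + k.+1%:R^-1 < x + (k.+1%:R ^- 2) * z) = (b < x).
  by near: k; exact: near_perturbed_lt.
by rewrite -leNgt.
Unshelve. all: by end_near. Qed.

(** Smoothing at scale (k + 1)^(-2), while the end points of the box move by
    1/(k + 1): by stability the indicators converge everywhere, without any
    continuity assumption on P at the boundary. *)
Lemma smoothed_box_cvg (P : probability T R) (B : 'I_n -> set RT)
    (I : 'I_n -> nat -> set RT) :
  (forall i, measurable (B i)) -> (forall i k, measurable (I i k)) ->
  (forall i (x z : RT), \forall k \near \oo,
      I i k (x + (k.+1%:R ^- 2) * z) <-> B i x) ->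
  (\int[P]_x (\prod_(i < n) normal_prob (tnth x i) (k.+1%:R ^- 2) (I i k)))%E
    @[k --> \oo] --> P (box B).
Proof.
move=> mB mI IB.
pose A k : set (T * T) :=
  [set z | forall i, I i k (tnth z.1 i + (k.+1%:R ^- 2) * tnth z.2 i)].
have mA k : measurable (A k).
  have -> : A k = \bigcap_(i in [set: 'I_n])
      ((fun z : T * T => tnth z.1 i + (k.+1%:R ^- 2) * tnth z.2 i : RT) @^-1` I i k).
    by apply/seteqP; split=> [z zB i _|z zB i]; [exact: zB|exact: (zB i Logic.I)].
  apply: fin_bigcap_measurable; first exact: finite_finset.
  move=> i _; rewrite -[X in measurable X]setTI.
  suff : measurable_fun setT
      (fun z : T * T => tnth z.1 i + (k.+1%:R ^- 2) * tnth z.2 i : RT) by exact.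
  apply: measurable_funD.
    exact: (measurableT_comp (measurable_tnth i) measurable_fst).
  apply: measurable_funM => //.
  exact: (measurableT_comp (measurable_tnth i) measurable_snd).
have AE k : (\int[P]_x (\prod_(i < n) normal_prob (tnth x i) (k.+1%:R ^- 2) (I i k)) =
    (P \x gam) (A k))%E.
  rewrite /product_measure1/=; apply: eq_integral => x _ /=.
  have -> : xsection (A k) x =
      box (fun i => affine1 (tnth x i) (k.+1%:R ^- 2) @^-1` I i k).
    by apply/seteqP; split=> z; rewrite /xsection/= inE.
  have e0 : 0 < k.+1%:R ^- 2 :> R by rewrite invr_gt0 exprn_gt0.
  rewrite [RHS]std_gaussian_tuple.
    by apply: eq_bigr => i _; rewrite normal_prob_affine.
  move=> i; rewrite -[X in measurable X]setTI.
  exact: measurable_affine1.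
have -> : P (box B) = (\int[(P \x gam)]_z (\1_(box B `*` setT) z)%:E)%E.
  rewrite integral_indic//; last by apply: measurableX => //; exact: measurable_box.
  have pE := @product_measure1E _ _ _ _ R P gam (box B) setT
    (measurable_box mB) measurableT.
  rewrite setIT [RHS]pE.
  by rewrite [X in (_ * X)%E]probability_setT mule1.
have AI k : (P \x gam)%E (A k) = (\int[(P \x gam)]_z (\1_(A k) z)%:E)%E.
  by rewrite integral_indic// setIT.
under eq_fun do rewrite (etrans (AE _) (AI _)).
apply: (@dominated_cvg _ _ _ _ _ _ _ _ (EFin \o cst (1 : R))) => //.
- move=> k; apply/measurable_EFinP; exact: measurable_indic.
- move=> z _; apply: cvg_near_cst.
  have : \forall k \near \oo, forall i,
      I i k (tnth z.1 i + (k.+1%:R ^- 2) * tnth z.2 i) <-> B i (tnth z.1 i).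
    by apply: filter_forall => i; exact: IB.
  apply: filterS => k h; congr EFin; rewrite !indicE; congr (nat_of_bool _)%:R.
  apply/idP/idP; rewrite !inE /A /box/=.
    by move=> zA; split=> // i; apply/h.
  by move=> [zB _] i; apply/h.
- by apply: (@bounded_integrable _ _ _ _ _ 1) => // z; rewrite /= normr1.
- by move=> k z _; rewrite /= lee_fin indicE normr_nat lern1 leq_b1.
Qed.

(** A probability measure on tuples is determined by its Fourier transform:
    smoothing by an independent Gaussian vector makes box probabilities
    computable from the transform, and the smoothing can be undone along boxes
    of stable sets. *)
Theorem fourier_unique (P Q : probability T R) :
  (forall (u : 'I_n -> R) (t : R),
    \int[P]_x cos (\sum_(i < n) u i * tnth x i - t) =
    \int[Q]_x cos (\sum_(i < n) u i * tnth x i - t)) ->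
  forall A, measurable A -> P A = Q A.
Proof.
move=> PQ.
apply: (@tuple_measure_unique R n [set B | measurable B /\ stable_set B]).
- by split => //; exact: stable_setT.
- by move=> A B [mA sA] [mB sB]; split; [exact: measurableI|exact: stable_setI].
- by move=> A [].
- apply: smallest_sub; first exact: smallest_sigma_algebra.
  move=> _ [[a b] _ <-]; apply: sub_sigma_algebra; split.
    exact: measurable_itv.
  exact: stable_itv_oc.
- move=> B hB; have mB i := (hB i).1.
  have /choice[I hI] : forall i, exists I : nat -> set RT,
      (forall k, measurable (I k)) /\ forall x z : RT, \forall k \near \oo,
      I k (x + (k.+1%:R ^- 2) * z) <-> B i x.
    by move=> i; have [_ [I mI IB]] := hB i; exists I.
  have cP := @smoothed_box_cvg P B I mB (fun i => (hI i).1) (fun i => (hI i).2).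
  have cQ := @smoothed_box_cvg Q B I mB (fun i => (hI i).1) (fun i => (hI i).2).
  apply: (cvg_unique _ cP); rewrite //.
  suff -> : (fun k => \int[P]_x \prod_(i < n) normal_prob (tnth x i) (k.+1%:R ^- 2) (I i k))%E =
    (fun k => \int[Q]_x \prod_(i < n) normal_prob (tnth x i) (k.+1%:R ^- 2) (I i k))%E by [].
  apply/funext => k.
  have e0 : 0 < k.+1%:R ^- 2 :> R by rewrite invr_gt0 exprn_gt0.
  rewrite !integral_smoothed_box//; [|by move=> i; exact: (hI i).1..].
  apply: eq_integral => y _; congr (_ * _)%:E.
  rewrite !integral_bump//; apply: eq_Rintegral => z _; exact: PQ.
Qed.

End fourier_uniqueness.

(** * Affine images of a standard Gaussian vector *)
Section affine_laws.
Context {R : realType}.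
Local Notation RT := (measurableTypeR R).

Definition affine_tuple {p q : nat} (mu : 'cV[R]_p) (A : 'M[R]_(p, q))
    (z : q.-tuple RT) : p.-tuple RT :=
  [tuple (mu + A *m (\col_j (tnth z j : R))) i 0 | i < p].

Lemma tnth_affine_tuple p q (mu : 'cV[R]_p) (A : 'M[R]_(p, q)) z i :
  tnth (affine_tuple mu A z) i = mu i 0 + \sum_j A i j * tnth z j.
Proof.
rewrite tnth_mktuple !mxE; congr (_ + _).
by apply: eq_bigr => j _; rewrite mxE.
Qed.

Lemma measurable_affine_tuple p q (mu : 'cV[R]_p) (A : 'M[R]_(p, q)) :
  measurable_fun setT (affine_tuple mu A).
Proof.
apply/measurable_fun_tnthP => i.
rewrite (_ : _ \o _ = fun z => mu i 0 + \sum_j A i j * tnth z j); last first.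
  by apply/funext => z /=; rewrite tnth_affine_tuple.
apply: measurable_funD => //; apply: measurable_sum => j.
by apply: measurable_funM => //; exact: measurable_tnth.
Qed.

HB.instance Definition _ p q (mu : 'cV[R]_p) (A : 'M[R]_(p, q)) :=
  isMeasurableFun.Build _ _ _ _ (affine_tuple mu A) (measurable_affine_tuple mu A).

Definition affine_law {p q : nat} (mu : 'cV[R]_p) (A : 'M[R]_(p, q)) :
    probability (p.-tuple RT) R :=
  [the probability _ _ of distribution (gaussian_tuple q) (affine_tuple mu A)].

Lemma Rintegral_affine_law p q (mu : 'cV[R]_p) (A : 'M[R]_(p, q)) (f : p.-tuple RT -> R) (M : R) :
  measurable_fun setT f -> (forall x, `|f x| <= M) ->
  \int[affine_law mu A]_x f x = \int[gaussian_tuple q]_z f (affine_tuple mu A z).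
Proof.
move=> mf fM; rewrite /Rintegral; congr fine.
rewrite [LHS]integral_distribution//; first exact/measurable_EFinP.
apply: (@bounded_integrable _ _ _ _ _ M) => [|z]; last exact: fM.
by apply: measurableT_comp => //; exact: measurable_affine_tuple.
Qed.

Lemma gram_sum p q (A : 'M[R]_(p, q)) (u : 'I_p -> R) :
  \sum_i \sum_k u i * u k * (A *m A^T) i k = \sum_j (\sum_i u i * A i j) ^+ 2.
Proof.
transitivity (\sum_i \sum_k \sum_j (u i * A i j) * (u k * A k j)).
  apply: eq_bigr => i _; apply: eq_bigr => k _; rewrite mxE mulr_sumr.
  by apply: eq_bigr => j _; rewrite mxE; ring.
under eq_bigr do rewrite exchange_big.
rewrite exchange_big; apply: eq_bigr => j _.
rewrite expr2 mulr_suml; apply: eq_bigr => i _.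
by rewrite mulr_sumr.
Qed.

(** The transform depends on A through A A^T only. *)
Lemma fourier_affine_law p q (mu : 'cV[R]_p) (A : 'M[R]_(p, q)) (u : 'I_p -> R) (t : R) :
  \int[affine_law mu A]_x cos (\sum_(i < p) u i * tnth x i - t) =
  cos (t - \sum_i u i * mu i 0) *
    expR (- (\sum_i \sum_k u i * u k * (A *m A^T) i k) / 2).
Proof.
rewrite (@Rintegral_affine_law _ _ _ _ _ 1); last 2 first.
- exact: measurable_cos_linear.
- by move=> x; rewrite ler_norml cos_geN1 cos_le1.
rewrite gram_sum -integral_cos_gaussian; apply: eq_Rintegral => z _; congr cos.
under eq_bigr do rewrite tnth_affine_tuple mulrDr.
rewrite big_split/= opprB [in RHS]addrA [RHS]addrAC [RHS]addrC addrA; congr (_ + _ - _).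
under eq_bigr do rewrite mulr_sumr.
rewrite exchange_big; apply: eq_bigr => j _; rewrite mulr_suml.
by apply: eq_bigr => i _; ring.
Qed.

(** The law of an affine image of a standard Gaussian vector only depends on
    the mean and on the covariance, whatever the number of columns. *)
Lemma affine_law_eq p q q' (mu : 'cV[R]_p) (A : 'M[R]_(p, q)) (B : 'M[R]_(p, q')) :
  A *m A^T = B *m B^T -> forall D, measurable D -> affine_law mu A D = affine_law mu B D.
Proof.
move=> AB; apply: fourier_unique => u t.
by rewrite !fourier_affine_law AB.
Qed.

Lemma gaussian_lawE p q (mu : 'cV[R]_p) (C : 'M[R]_p) (P : probability (p.-tuple RT) R)
    (A : 'M[R]_(p, q)) : gaussian_law mu C P -> A *m A^T = C ->
  forall D, measurable D -> P D = gaussian_tuple q (affine_tuple mu A @^-1` D).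
Proof.
move=> [gam [A' [hg A'C PE]]] AC D mD; rewrite PE//.
rewrite [LHS](std_gaussianE hg); last first.
  by rewrite -[X in measurable X]setTI; exact: measurable_affine_tuple.
by rewrite -AC in A'C; exact: (affine_law_eq mu A'C mD).
Qed.

End affine_laws.

(** * Small balls of quadratic polynomials in a Gaussian vector *)
Lemma eq_prob_Rintegral d (T : measurableType d) (R : realType)
    (P Q : probability T R) (f : T -> R) :
  (forall D, measurable D -> P D = Q D) -> \int[P]_x f x = \int[Q]_x f x.
Proof.
move=> PQ; rewrite /Rintegral; congr fine.
by apply: eq_measure_integral => D mD _; exact: PQ.
Qed.

Section gaussian_pair.
Context {R : realType}.
Local Notation RT := (measurableTypeR R).
Local Notation N01 := (@normal_prob R 0 1).

Lemma integral_gaussian_pair (F : RT -> RT -> R) (M : R) :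
  measurable_fun setT (fun z : RT * RT => F z.1 z.2) ->
  (forall x y, `|F x y| <= M) ->
  \int[gaussian_tuple 2]_z F (tnth z ord0) (tnth z (lift ord0 ord0)) =
  \int[N01]_x \int[N01]_y F x y.
Proof.
move=> mF FM.
have mF' : measurable_fun setT
    (fun z : 2.-tuple RT => F (tnth z ord0) (tnth z (lift ord0 ord0))).
  have mp : measurable_fun setT
      (fun z : 2.-tuple RT => (tnth z ord0, tnth z (lift ord0 ord0)) : RT * RT).
    by apply: measurable_fun_pair; exact: measurable_tnth.
  exact: (measurableT_comp mF mp).
rewrite (integral_gaussian_cons (M := M) mF'); last by move=> z; exact: FM.
apply: eq_Rintegral => x _.
under eq_Rintegral do rewrite tnth_tuple_cons0 tnth_tuple_consS.
rewrite (@integral_gaussian_cons _ _ _ M); last 2 first.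
- exact: (measurableT_comp (measurableT_comp mF (pair1_measurable x)) (measurable_tnth ord0)).
- by move=> z; exact: FM.
apply: eq_Rintegral => y _.
under eq_Rintegral do rewrite tnth_tuple_cons0.
by rewrite Rintegral_cst// [X in fine X]probability_setT mulr1.
Qed.

(** The orthogonal matrix with entries 1, 1, 1, -1 over the square root of 2. *)
Definition rotation45 : 'M[R]_2 :=
  \matrix_(i, j) ((Num.sqrt 2)^-1 * (-1) ^+ ((i == 1) && (j == 1))).

(** The law of a standard Gaussian pair is invariant by orthogonal maps, as an
    instance of affine_law_eq. *)
Lemma integral_gaussian_rotation (F : RT -> RT -> R) (M : R) :
  measurable_fun setT (fun z : RT * RT => F z.1 z.2) ->
  (forall x y, `|F x y| <= M) ->
  \int[N01]_x \int[N01]_y F x y = \int[N01]_x \int[N01]_y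
    F ((Num.sqrt 2)^-1 * (x + y)) ((Num.sqrt 2)^-1 * (x - y)).
Proof.
move=> mF FM; rewrite -(integral_gaussian_pair mF FM).
set r := (Num.sqrt 2)^-1.
have r2 : r * r = 2^-1 by rewrite -expr2 exprVn sqr_sqrtr.
have rot : rotation45 *m rotation45^T = 1%:M *m 1%:M^T.
  rewrite trmx1 mulmx1; apply/matrixP => i j.
  rewrite !mxE !big_ord_recl big_ord0 !mxE/= -/r.
  by case: i => [[|[|i]] hi] //; case: j => [[|[|j]] hj] //=;
    rewrite ?mulr0n ?mulr1n; lra.
have mF' : measurable_fun setT
    (fun z : 2.-tuple RT => F (tnth z ord0) (tnth z (lift ord0 ord0))).
  have mp : measurable_fun setT
      (fun z : 2.-tuple RT => (tnth z ord0, tnth z (lift ord0 ord0)) : RT * RT).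
    by apply: measurable_fun_pair; exact: measurable_tnth.
  exact: (measurableT_comp mF mp).
transitivity (\int[affine_law 0 1%:M]_z F (tnth z (ord0 : 'I_2)) (tnth z (lift ord0 (ord0 : 'I_1)))).
  rewrite (Rintegral_affine_law _ _ mF' (fun z => FM _ _)).
  apply: eq_Rintegral => z _; congr F; rewrite tnth_affine_tuple mxE add0r.
    by rewrite !big_ord_recl big_ord0 !mxE/=; ring.
  by rewrite !big_ord_recl big_ord0 !mxE/=; ring.
transitivity (\int[affine_law 0 rotation45]_z F (tnth z (ord0 : 'I_2)) (tnth z (lift ord0 (ord0 : 'I_1)))).
  by apply: eq_prob_Rintegral => D mD; apply/esym/affine_law_eq.
rewrite (Rintegral_affine_law _ _ mF' (fun z => FM _ _)).
have mG : measurable_fun setT (fun z : RT * RT => F (r * (z.1 + z.2)) (r * (z.1 - z.2))).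
  have mp : measurable_fun setT
      (fun z : RT * RT => (r * (z.1 + z.2), r * (z.1 - z.2)) : RT * RT).
    apply: measurable_fun_pair.
      by apply: measurable_funM => //; apply: measurable_funD.
    by apply: measurable_funM => //; apply: measurable_funB.
  exact: (measurableT_comp mF mp).
rewrite -(integral_gaussian_pair mG (fun x y => FM _ _)).
apply: eq_Rintegral => z _; congr F; rewrite tnth_affine_tuple mxE add0r.
  by rewrite !big_ord_recl big_ord0 !mxE/= -/r; ring.
by rewrite !big_ord_recl big_ord0 !mxE/= -/r; ring.
Qed.

End gaussian_pair.

Section characteristic_modulus.
Context {R : realType}.
Local Notation RT := (measurableTypeR R).
Local Notation N01 := (@normal_prob R 0 1).

Lemma measurable_cosT d (T : measurableType d) (f : T -> R) :
  measurable_fun setT f -> measurable_fun setT (fun x => cos (f x)).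
Proof.
apply: measurableT_comp; exact: continuous_measurable_fun (@continuous_cos R).
Qed.

Lemma measurable_sinT d (T : measurableType d) (f : T -> R) :
  measurable_fun setT f -> measurable_fun setT (fun x => sin (f x)).
Proof.
apply: measurableT_comp; exact: continuous_measurable_fun (@continuous_sin R).
Qed.

Section integrable.
Context d (T : measurableType d) (P : probability T R) (f : T -> R).
Hypothesis mf : measurable_fun setT f.

Lemma integrable_cosZ (c : R) : P.-integrable setT (EFin \o (fun x => c * cos (f x))).
Proof.
apply: (@bounded_integrable _ _ _ _ _ `|c|).
  by apply: measurable_funM => //; exact: measurable_cosT.
by move=> x; rewrite normrM ler_piMr// ler_norml cos_geN1 cos_le1.
Qed.

Lemma integrable_sinZ (c : R) : P.-integrable setT (EFin \o (fun x => c * sin (f x))).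
Proof.
apply: (@bounded_integrable _ _ _ _ _ `|c|).
  by apply: measurable_funM => //; exact: measurable_sinT.
by move=> x; rewrite normrM ler_piMr// ler_norml sin_geN1 sin_le1.
Qed.

Lemma integrable_cos : P.-integrable setT (EFin \o (fun x => cos (f x))).
Proof. by have := integrable_cosZ 1; under [in X in X -> _]eq_fun do rewrite mul1r. Qed.

Lemma integrable_sin : P.-integrable setT (EFin \o (fun x => sin (f x))).
Proof. by have := integrable_sinZ 1; under [in X in X -> _]eq_fun do rewrite mul1r. Qed.

Lemma Rintegral_cosB (t : R) : \int[P]_x cos (f x - t) =
  (\int[P]_x cos (f x)) * cos t + (\int[P]_x sin (f x)) * sin t.
Proof.
under eq_Rintegral do rewrite cosB mulrC [X in _ + X]mulrC.
rewrite RintegralD//; [|exact: integrable_cosZ|exact: integrable_sinZ].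
rewrite RintegralZl//; last exact: integrable_cos.
rewrite RintegralZl//; last exact: integrable_sin.
by rewrite mulrC [X in _ + X]mulrC.
Qed.

Lemma Rintegral_sinB (t : R) : \int[P]_x sin (f x - t) =
  (\int[P]_x sin (f x)) * cos t - (\int[P]_x cos (f x)) * sin t.
Proof.
under eq_Rintegral do rewrite sinB mulrC [X in _ - X]mulrC.
rewrite RintegralB//; [|exact: integrable_sinZ|exact: integrable_cosZ].
rewrite RintegralZl//; last exact: integrable_sin.
rewrite RintegralZl//; last exact: integrable_cos.
by rewrite mulrC [X in _ - X]mulrC.
Qed.

End integrable.

(** The squared modulus of the transform of a sum of independent variables is
    the product of the squared moduli: in real form, the identity
    (c c0 - s s0)^2 + (s c0 + c s0)^2 = (c^2 + s^2) (c0^2 + s0^2). *)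
Lemma fourier_sum_modulus n (f : 'I_n -> RT -> R) (r : 'I_n -> R) :
  (forall i, measurable_fun setT (f i)) ->
  (forall i, (\int[N01]_x cos (f i x)) ^+ 2 + (\int[N01]_x sin (f i x)) ^+ 2 <= r i) ->
  (\int[gaussian_tuple n]_z cos (\sum_(i < n) f i (tnth z i))) ^+ 2 +
  (\int[gaussian_tuple n]_z sin (\sum_(i < n) f i (tnth z i))) ^+ 2 <= \prod_(i < n) r i.
Proof.
elim: n f r => [|n IH] f r mf fr.
  under eq_Rintegral do rewrite big_ord0 cos0.
  under [X in _ + X ^+ 2]eq_Rintegral do rewrite big_ord0 sin0.
  rewrite !Rintegral_cst// [X in fine X]probability_setT.
  by rewrite mul0r expr0n addr0 mulr1 expr1n big_ord0.
have msum k (h : 'I_k -> RT -> R) : (forall i, measurable_fun setT (h i)) ->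
    measurable_fun setT (fun z : k.-tuple RT => \sum_(i < k) h i (tnth z i)).
  move=> mh; apply: measurable_sum => i.
  by apply: measurableT_comp => //; exact: measurable_tnth.
rewrite (@integral_gaussian_cons _ _ _ 1); last 2 first.
- by apply: measurable_cosT; exact: (msum n.+1 f).
- by move=> z; rewrite ler_norml cos_geN1 cos_le1.
rewrite [X in _ + X ^+ 2](@integral_gaussian_cons _ _ _ 1); last 2 first.
- by apply: measurable_sinT; exact: (msum n.+1 f).
- by move=> z; rewrite ler_norml sin_geN1 sin_le1.
have {IH} := IH (fun i => f (lift ord0 i)) (fun i => r (lift ord0 i))
  (fun i => mf _) (fun i => fr _).
have mS := msum n (fun i => f (lift ord0 i)) (fun i => mf _).
set S := fun z : n.-tuple RT => _ in mS.
set c := \int[gaussian_tuple n]_z cos _.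
set s := \int[gaussian_tuple n]_z sin _ => csr.
have sumE x z : \sum_(i < n.+1) f i (tnth (tuple_cons (x, z)) i) = S z - (- f ord0 x).
  rewrite big_ord_recl tnth_tuple_cons0 opprK addrC; congr (_ + _).
  by apply: eq_bigr => i _; rewrite tnth_tuple_consS.
have mf0 := mf ord0.
have -> : \int[N01]_x \int[gaussian_tuple n]_z
    cos (\sum_(i < n.+1) f i (tnth (tuple_cons (x, z)) i)) =
    c * (\int[N01]_x cos (f ord0 x)) - s * (\int[N01]_x sin (f ord0 x)).
  rewrite -RintegralZl//; last exact: integrable_cos.
  rewrite -RintegralZl//; last exact: integrable_sin.
  rewrite -RintegralB//; [|exact: integrable_cosZ|exact: integrable_sinZ].
  apply: eq_Rintegral => x _; under eq_Rintegral do rewrite sumE.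
  by rewrite Rintegral_cosB// cosN sinN mulrN.
have -> : \int[N01]_x \int[gaussian_tuple n]_z
    sin (\sum_(i < n.+1) f i (tnth (tuple_cons (x, z)) i)) =
    s * (\int[N01]_x cos (f ord0 x)) + c * (\int[N01]_x sin (f ord0 x)).
  rewrite -RintegralZl//; last exact: integrable_cos.
  rewrite -RintegralZl//; last exact: integrable_sin.
  rewrite -RintegralD//; [|exact: integrable_cosZ|exact: integrable_sinZ].
  apply: eq_Rintegral => x _; under eq_Rintegral do rewrite sumE.
  by rewrite Rintegral_sinB// cosN sinN mulrN opprK.
rewrite big_ord_recl.
have := fr ord0.
set c0 := \int[N01]_x _; set s0 := \int[N01]_x _ => cs0.
have -> : (c * c0 - s * s0) ^+ 2 + (s * c0 + c * s0) ^+ 2 =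
  (c0 ^+ 2 + s0 ^+ 2) * (c ^+ 2 + s ^+ 2) by ring.
by rewrite ler_pM// addr_ge0// sqr_ge0.
Qed.

(** The squared modulus is the transform of the difference of two independent
    copies; after a rotation by 45 degrees the quadratic phase becomes
    bilinear, so that the transform is a mixture of Gaussian transforms. *)
Lemma quadratic_modulus (a b u : R) :
  (\int[N01]_x cos (u * (a * x ^+ 2 / 2 + b * x))) ^+ 2 +
  (\int[N01]_x sin (u * (a * x ^+ 2 / 2 + b * x))) ^+ 2 <=
  (Num.sqrt (1 + u ^+ 2 * (a ^+ 2 + b ^+ 2)))^-1.
Proof.
pose f (x : RT) := u * (a * x ^+ 2 / 2 + b * x).
have mf : measurable_fun setT f.
  apply: measurable_funM => //; apply: measurable_funD; last exact: measurable_funM.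
  by apply: measurable_funM => //; apply: measurable_funM => //; apply: measurable_funX.
have -> : (\int[N01]_x cos (u * (a * x ^+ 2 / 2 + b * x))) ^+ 2 +
  (\int[N01]_x sin (u * (a * x ^+ 2 / 2 + b * x))) ^+ 2 =
  \int[N01]_x \int[N01]_y cos (f y - f x).
  rewrite !expr2 -RintegralZl//; last exact: integrable_cos.
  rewrite -RintegralZl//; last exact: integrable_sin.
  rewrite -RintegralD//; [|exact: integrable_cosZ|exact: integrable_sinZ].
  by apply: eq_Rintegral => x _; rewrite Rintegral_cosB.
have mff : measurable_fun setT (fun z : RT * RT => cos (f z.2 - f z.1)).
  apply: measurable_cosT; apply: measurable_funB.
    exact: (measurableT_comp mf measurable_snd).
  exact: (measurableT_comp mf measurable_fst).
rewrite (integral_gaussian_rotation (M := 1) mff); last first.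
  by move=> x y; rewrite ler_norml cos_geN1 cos_le1.
set r := (Num.sqrt 2)^-1.
have r2 : r ^+ 2 = 2^-1 by rewrite exprVn sqr_sqrtr.
have s2 : Num.sqrt 2 ^+ 2 = 2 :> R by rewrite sqr_sqrtr.
have rs : r * Num.sqrt 2 = 1 by rewrite /r mulVf// gt_eqF// sqrtr_gt0.
have -> : \int[N01]_x \int[N01]_y cos (f (r * (x - y)) - f (r * (x + y))) =
    \int[N01]_x expR (- (u * (a * x + Num.sqrt 2 * b)) ^+ 2 / 2).
  apply: eq_Rintegral => x _; rewrite -integral_cos_normal; apply: eq_Rintegral => y _.
  rewrite -cosN; congr cos; rewrite /f.
  have -> : Num.sqrt 2 = 2 * r by rewrite -[X in X * r]s2 expr2 -mulrA (mulrC _ r) rs mulr1.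
  by rewrite !exprMn r2; field.
have a0 : 0 < 1 + u ^+ 2 * a ^+ 2 by rewrite ltr_pwDl// mulr_ge0// sqr_ge0.
set al := u ^+ 2 * a ^+ 2 in a0 *.
pose y := u ^+ 2 * b ^+ 2 / (1 + al).
have y0 : 0 <= y.
  by apply: divr_ge0; [rewrite mulr_ge0 ?sqr_ge0|exact: ltW].
have -> : \int[N01]_x expR (- (u * (a * x + Num.sqrt 2 * b)) ^+ 2 / 2) =
    (Num.sqrt (1 + al) * expR y)^-1.
  have := integral_expR_quadratic (- Num.sqrt 2 * u ^+ 2 * a * b) a0.
  rewrite /Rintegral => quad.
  have -> : (\int[N01]_x (expR (- (u * (a * x + Num.sqrt 2 * b)) ^+ 2 / 2))%:E =
    \int[N01]_x ((expR (- (u ^+ 2 * b ^+ 2)))%:E *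
      (expR (- al * x ^+ 2 / 2 + (- Num.sqrt 2 * u ^+ 2 * a * b) * x))%:E))%E.
    apply: eq_integral => x _; rewrite -EFinM -expRD; congr (expR _)%:E.
    have -> : u ^+ 2 * b ^+ 2 = u ^+ 2 * Num.sqrt 2 ^+ 2 * b ^+ 2 / 2.
      by rewrite s2; field.
    by rewrite /al; field.
  have mq : measurable_fun setT (fun x : RT =>
      (expR (- al * x ^+ 2 / 2 + (- Num.sqrt 2 * u ^+ 2 * a * b) * x))%:E).
    apply/measurable_EFinP/measurableT_comp => //.
    apply: measurable_funD; last exact: measurable_funM.
    by apply: measurable_funM => //; apply: measurable_funM => //; apply: measurable_funX.
  rewrite ge0_integralZl ?lee_fin ?expR_ge0//=.
  rewrite quad/= mulrCA -expRD [in RHS]invfM -[in RHS]expRN; congr (_ * expR _).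
  have -> : (- Num.sqrt 2 * u ^+ 2 * a * b) ^+ 2 = 2 * al * (u ^+ 2 * b ^+ 2).
    by rewrite !exprMn sqrrN s2 /al; ring.
  by rewrite /y; field; rewrite gt_eqF.
rewrite lef_pV2 ?posrE ?mulr_gt0 ?sqrtr_gt0 ?expR_gt0//; last first.
  by rewrite ltr_pwDl// mulr_ge0 ?addr_ge0 ?sqr_ge0.
rewrite -(@ler_pXn2r _ 2)// ?nnegrE ?mulr_ge0 ?sqrtr_ge0 ?expR_ge0//.
rewrite exprMn !sqr_sqrtr; last 2 first.
- exact: ltW.
- by rewrite addr_ge0// mulr_ge0 ?addr_ge0 ?sqr_ge0.
have -> : 1 + u ^+ 2 * (a ^+ 2 + b ^+ 2) = (1 + al) * (1 + y).
  have h : (1 + al) * y = u ^+ 2 * b ^+ 2 by rewrite /y mulrC divfK// gt_eqF.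
  by rewrite [in RHS]mulrDr h /al; ring.
rewrite ler_pM2l//.
have e1 : 1 + y <= expR y by exact: expR_ge1Dx.
nra.
Qed.

End characteristic_modulus.

Section small_ball.
Context {R : realType}.
Local Notation RT := (measurableTypeR R).
Local Notation N01 := (@normal_prob R 0 1).

Lemma normal01_itv_le (c d M : R) : c <= d ->
  (forall x, c <= x <= d -> expR (- x ^+ 2 / 2) <= M) ->
  fine (N01 `[c, d]%classic) <= (d - c) * (M / Num.sqrt (2 * pi)).
Proof.
move=> cd xM; rewrite -lee_fin fineK ?fin_num_measure//.
have M0 : 0 <= M by apply: le_trans (xM c _); rewrite ?expR_ge0// lexx.
have p0 : 0 <= (Num.sqrt (2 * pi))^-1 :> R by rewrite invr_ge0 sqrtr_ge0.
have -> : ((d - c) * (M / Num.sqrt (2 * pi)))%:E =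
    (\int[lebesgue_measure]_(x in `[c, d]) (M / Num.sqrt (2 * pi))%:E)%E.
  rewrite integral_cst//= lebesgue_measure_itv/= lte_fin.
  rewrite EFinM muleC; congr (_ * _)%E.
  by case: ltgtP cd => // -> _; rewrite subrr.
apply: ge0_le_integral => //.
- by move=> x _; rewrite lee_fin normal_pdf_ge0.
- by apply/measurable_EFinP; apply: measurable_funTS; exact: measurable_normal_pdf.
- move=> x; rewrite /= in_itv/= => cxd; rewrite lee_fin.
  rewrite normal_pdfE// /normal_peak /normal_fun expr1n mul1r subr0 mulrC.
  rewrite -[pi *+ 2]mulr_natl; apply: ler_wpM2r => //.
  exact: xM.
Qed.

Lemma prod_1D_ge_sum n (x : 'I_n -> R) : (forall i, 0 <= x i) ->
  1 + \sum_(i < n) x i <= \prod_(i < n) (1 + x i).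
Proof.
elim: n x => [|n IH] x x0; first by rewrite !big_ord0 addr0.
rewrite !big_ord_recl.
have h := IH (fun i => x (lift ord0 i)) (fun i => x0 _).
have s0 : 0 <= \sum_(i < n) x (lift ord0 i) by apply: sumr_ge0.
have := ler_wpM2l (_ : 0 <= 1 + x ord0) h.
rewrite addr_ge0// => /(_ isT); apply: le_trans.
have := x0 ord0; move: (x ord0) (\sum_(i < n) _) s0 => u v v0 u0.
have := mulr_ge0 u0 v0; lra.
Qed.

Lemma expR_half_ge (w : R) : - 2^-1 <= w -> 1 <= 2 * expR w.
Proof. by have := expR_ge1Dx w; lra. Qed.

Lemma small_ball_arith (J k s : R) : 0 < s -> 1 <= k -> J <= s + k * s ->
  2 * J <= 4 * k * s.
Proof.
move=> s0 k1 Jk; have : s <= k * s by rewrite ler_peMl// ltW.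
lra.
Qed.

(** Up to the factor 2 >= exp (1/2), the probability of the ball of radius t =
    s^3 is bounded by the mean of exp (- (X - x)^2/(2 t^2)), which is the mean of
    the real Fourier transform phi of X - x at frequency y/t for a normal y. The
    frequencies |y| <= s have normal mass at most s, and the other ones satisfy
    |y/t| >= s^(-2), where the transform is at most max(1, 1/V) s. *)
Lemma quadratic_small_ball n (a b : 'I_n -> R) (V x s : R) :
  0 < V -> V <= \sum_(i < n) (a i ^+ 2 + b i ^+ 2) -> 0 < s ->
  fine (gaussian_tuple n [set z : n.-tuple RT |
    `|\sum_(i < n) (a i * tnth z i ^+ 2 / 2 + b i * tnth z i) - x| <= s ^+ 3])
  <= 4 * Num.max 1 V^-1 * s.
Proof.
move=> V0 Vle s0.
set X := fun z : n.-tuple RT => \sum_(i < n) (a i * tnth z i ^+ 2 / 2 + b i * tnth z i).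
have mX : measurable_fun setT X.
  apply: measurable_sum => i; apply: measurable_funD; apply: measurable_funM => //.
    by apply: measurable_funM => //; apply: measurable_funX; exact: measurable_tnth.
  exact: measurable_tnth.
set t := s ^+ 3; have t0 : 0 < t by rewrite exprn_gt0.
have tn0 : t != 0 by rewrite gt_eqF.
set B := [set z | _].
have mB : measurable B.
  have -> : B = setT `&` X @^-1` `[x - t, x + t].
    by rewrite setTI; apply/seteqP; split => z /=; rewrite in_itv/= /B/= -/(X z) ler_distl.
  exact: mX.
pose k := Num.max 1 V^-1.
have k1 : 1 <= k by rewrite le_max lexx.
have kV : V^-1 <= k by rewrite le_max lexx orbT.
pose phi (y : R) := \int[gaussian_tuple n]_z cos (y / t * X z - y / t * x).
have phiE z : expR (- (X z - x) ^+ 2 / (2 * t ^+ 2)) =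
    \int[N01]_y cos (y / t * X z - y / t * x).
  transitivity (expR (- ((X z - x) / t) ^+ 2 / 2)); first by congr expR; field.
  rewrite -integral_cos_normal; apply: eq_Rintegral => y _; congr cos.
  by field.
pose F (z : n.-tuple RT) (y : RT) := cos (y / t * X z - y / t * x).
have F1 z y : `|F z y| <= 1 by rewrite ler_norml cos_geN1 cos_le1.
have mF : measurable_fun setT (fun p : n.-tuple RT * RT => F p.1 p.2).
  have m2 : measurable_fun setT (fun p : n.-tuple RT * RT => p.2 / t : R).
    by apply: measurable_funM => //; exact: measurable_snd.
  apply: measurable_cosT; apply: measurable_funB; apply: measurable_funM => //.
  exact: (measurableT_comp mX measurable_fst).
have swap : \int[gaussian_tuple n]_z expR (- (X z - x) ^+ 2 / (2 * t ^+ 2)) =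
    \int[N01]_y phi y.
  under eq_Rintegral do rewrite phiE.
  exact: (Rintegral_fubini_bounded _ _ mF F1).
have mFz y : measurable_fun setT (F ^~ y).
  exact: (measurableT_comp mF (pair2_measurable y)).
have phi_le1 y : `|phi y| <= 1.
  have iF : (gaussian_tuple n).-integrable setT (EFin \o F ^~ y).
    exact: (@bounded_integrable _ _ _ _ _ 1).
  apply: le_trans (le_normr_Rintegral _ iF) _ => //.
  apply: (@le_trans _ _ (\int[gaussian_tuple n]_z 1)).
    apply: le_Rintegral => //.
      by have := integrable_norm iF.
    exact: finite_measure_integrable_cst.
  by rewrite Rintegral_cst// [X in fine X]probability_setT mulr1.
have phi_small y : s < `|y| -> phi y <= k * s.
  move=> sy; rewrite leNgt; apply/negP => ks.
  have ks0 : 0 <= k * s by rewrite mulr_ge0 ?ltW// (lt_le_trans ltr01).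
  (* fourth powers remove the square roots of the modulus bound *)
  have : (k * s) ^+ 4 < phi y ^+ 4 by rewrite ltrXn2r// nnegrE ltW// (le_lt_trans ks0).
  apply/negP; rewrite -leNgt.
  set w := (y / t) ^+ 2.
  have w0 : 0 <= w by exact: sqr_ge0.
  have mod := fourier_sum_modulus
    (f := fun i (z : RT) => y / t * (a i * z ^+ 2 / 2 + b i * z))
    (r := fun i => (Num.sqrt (1 + w * (a i ^+ 2 + b i ^+ 2)))^-1) _
    (fun i => quadratic_modulus (a i) (b i) (y / t)).
  have {mod} : (\int[gaussian_tuple n]_z cos (y / t * X z)) ^+ 2 +
      (\int[gaussian_tuple n]_z sin (y / t * X z)) ^+ 2 <=
      \prod_(i < n) (Num.sqrt (1 + w * (a i ^+ 2 + b i ^+ 2)))^-1.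
    under eq_Rintegral do rewrite /X mulr_sumr.
    under [X in _ + X ^+ 2]eq_Rintegral do rewrite /X mulr_sumr.
    apply: mod => i; apply: measurable_funM => //; apply: measurable_funD.
      by apply: measurable_funM => //; apply: measurable_funM => //; apply: measurable_funX.
    exact: measurable_funM.
  have -> : phi y = (\int[gaussian_tuple n]_z cos (y / t * X z)) * cos (y / t * x) +
      (\int[gaussian_tuple n]_z sin (y / t * X z)) * sin (y / t * x).
    by apply: Rintegral_cosB; exact: measurable_funM.
  set c := \int[gaussian_tuple n]_z cos _; set d := \int[gaussian_tuple n]_z sin _.
  set r := \prod_(i < n) _ => cdr.
  have r2 : r ^+ 2 <= k * s ^+ 4.
    have vi i : 0 <= w * (a i ^+ 2 + b i ^+ 2) by rewrite mulr_ge0// addr_ge0// sqr_ge0.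
    have -> : r ^+ 2 = (\prod_(i < n) (1 + w * (a i ^+ 2 + b i ^+ 2)))^-1.
      rewrite -prodrXl -prodfV; apply: eq_bigr => i _.
      by rewrite exprVn sqr_sqrtr// addr_ge0.
    have wV : s ^- 4 * V <= \prod_(i < n) (1 + w * (a i ^+ 2 + b i ^+ 2)).
      apply: le_trans (prod_1D_ge_sum vi); rewrite -mulr_sumr ler_wpDl//.
      apply: ler_pM => //; first by rewrite invr_ge0 exprn_ge0// ltW.
        exact: ltW.
      rewrite /w /t expr_div_n -exprM ler_pdivlMr ?exprn_gt0//.
      have -> : s ^- 4 * s ^+ (3 * 2) = s ^+ 2 by field; rewrite gt_eqF.
      by rewrite -[leRHS]real_normK ?num_real// lerXn2r// ?nnegrE ltW.
    have sV0 : 0 < s ^- 4 * V by rewrite mulr_gt0// invr_gt0 exprn_gt0.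
    apply: (@le_trans _ _ (s ^- 4 * V)^-1).
      by rewrite lef_pV2 ?posrE// (lt_le_trans sV0).
    by rewrite invfM invrK mulrC ler_wpM2r// exprn_ge0// ltW.
  have r0 : 0 <= r by apply: prodr_ge0 => i _; rewrite invr_ge0 sqrtr_ge0.
  apply: (@le_trans _ _ (r ^+ 2)).
    rewrite (_ : 4 = 2 * 2)%N// exprM lerXn2r// ?nnegrE ?sqr_ge0//.
    apply: le_trans cdr.
    have := cos2Dsin2 (y / t * x).
    have := sqr_ge0 (c * sin (y / t * x) - d * cos (y / t * x)).
    move: (cos _) (sin _) => p q h1 h2.
    have -> : c ^+ 2 + d ^+ 2 = (c ^+ 2 + d ^+ 2) * (p ^+ 2 + q ^+ 2) by rewrite h2 mulr1.
    move: h1; nra.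
  apply: le_trans r2 _; rewrite exprMn; apply: ler_wpM2r.
    by rewrite exprn_ge0// ltW.
  by rewrite -[leLHS]expr1 ler_weXn2l.
have mphi : measurable_fun setT (phi : RT -> R).
  have iF : (gaussian_tuple n \x N01)%E.-integrable setT
      (EFin \o (fun p : n.-tuple RT * RT => F p.1 p.2)).
    by apply: (@bounded_integrable _ _ _ _ _ 1) => // p; exact: F1.
  have := measurable_fubini_G iF => mG.
  apply/measurable_EFinP; rewrite [X in measurable_fun _ X](_ : _ =
    fubini_G (gaussian_tuple n) (EFin \o (fun p : n.-tuple RT * RT => F p.1 p.2)))//.
  apply/funext => y; rewrite /= /phi /Rintegral fineK//.
  apply: integrable_fin_num => //.
  exact: (@bounded_integrable _ _ _ _ _ 1 (mFz y) (F1 ^~ y)).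
have int_phi : \int[N01]_y phi y <= s + k * s.
  pose h (y : RT) : R := \1_(`[- s, s]%classic : set RT) y + k * s.
  have mi : measurable_fun setT (\1_(`[- s, s]%classic : set RT) : RT -> R).
    exact: measurable_indic.
  have ii : N01.-integrable setT (EFin \o (\1_(`[- s, s]%classic : set RT) : RT -> R)).
    apply: (@bounded_integrable _ _ _ _ _ 1) => // y.
    by rewrite indicE normr_nat lern1 leq_b1.
  apply: (@le_trans _ _ (\int[N01]_y h y)).
    apply: le_Rintegral => //.
    - exact: (@bounded_integrable _ _ _ _ _ 1).
    - rewrite /comp; under eq_fun do rewrite EFinD.
      by apply: integrableD => //; exact: finite_measure_integrable_cst.
    - move=> y _; rewrite /h indicE; case: (boolP (y \in _)) => [_|].
        rewrite (le_trans (ler_norm _))// (le_trans (phi_le1 y))//=.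
        by rewrite lerDl mulr_ge0 ?ltW// (lt_le_trans ltr01).
      rewrite notin_setE/= in_itv/= -ler_norml => /negP; rewrite -ltNge => sy.
      by rewrite add0r phi_small.
  rewrite RintegralD//; last exact: finite_measure_integrable_cst.
  rewrite Rintegral_cst// [X in _ * fine X]probability_setT mulr1 lerD2r.
  rewrite /Rintegral integral_indic// setIT.
  apply: le_trans (normal01_itv_le (M := 1) _ _) _.
  - by rewrite ge0_cp// ltW.
  - by move=> y _; rewrite -expR0 ler_expR mulNr oppr_le0 divr_ge0// sqr_ge0.
  - have p2 : 2 <= Num.sqrt (2 * pi) :> R.
      have s4 : Num.sqrt (2 ^+ 2) = 2 :> R by rewrite sqrtr_sqr ger0_norm.
      by rewrite -[leLHS]s4 ler_wsqrtr// expr2 ler_pM2l// pi_ge2.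
    have : (Num.sqrt (2 * pi))^-1 <= 2^-1 :> R.
      by rewrite lef_pV2 ?posrE// (lt_le_trans _ p2).
    rewrite opprK mul1r => p2'.
    have := ler_wpM2l (ltW s0) p2'; lra.
have iexp : (gaussian_tuple n).-integrable setT
    (EFin \o (fun z => expR (- (X z - x) ^+ 2 / (2 * t ^+ 2)))).
  apply: (@bounded_integrable _ _ _ _ _ 1).
    apply: measurableT_comp => //; apply: measurable_funM => //.
    apply: measurableT_comp => //; apply: measurable_funX.
    exact: measurable_funB.
  move=> z; rewrite ger0_norm ?expR_ge0// -expR0 ler_expR mulNr oppr_le0.
  by rewrite divr_ge0 ?sqr_ge0// mulr_ge0 ?sqr_ge0.
have : fine (gaussian_tuple n B) <= 2 *
    \int[gaussian_tuple n]_z expR (- (X z - x) ^+ 2 / (2 * t ^+ 2)).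
  have -> : fine (gaussian_tuple n B) = \int[gaussian_tuple n]_z \1_B z.
    by rewrite /Rintegral integral_indic// setIT.
  rewrite -RintegralZl//; apply: le_Rintegral => //.
  - apply: (@bounded_integrable _ _ _ _ _ 1); first exact: measurable_indic.
    by move=> z; rewrite indicE normr_nat lern1 leq_b1.
  - by rewrite /comp; under eq_fun do rewrite EFinM; exact: integrableZl.
  - move=> z _; rewrite indicE; case: (boolP (z \in B)) => [|_]; last first.
      by rewrite mulr_ge0 ?expR_ge0.
    rewrite inE /B/= -/(X z) => Xt.
    have h : - 2^-1 <= - (X z - x) ^+ 2 / (2 * t ^+ 2).
      rewrite mulNr lerN2 ler_pdivrMr ?mulr_gt0 ?exprn_gt0// mulKf//.
      by rewrite -real_normK ?num_real// lerXn2r// ?nnegrE// ltW.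
    exact: expR_half_ge.
rewrite swap => h; apply: le_trans h _.
exact: small_ball_arith.
Qed.

End small_ball.

(** * The log-likelihood ratio of a product of normal laws *)
Section affinity1.
Context {R : realType}.
Local Notation N01 := (@normal_prob R 0 1).

(** The affinity is explicit: with s = lam^(-2), its square is the product of
    2 sqrt s/(1 + s) and exp (- m^2 s/(2 (1 + s))). The first factor is compared
    with exp (- (1 - s)^2) through (1 + s)^2/(4 s) = 1 + (1 - s)^2/(4 s), and
    both comparisons use s >= 1/2. *)
Lemma affinity_log_ratio1 (m lam : R) : 0 < lam -> 2^-1 <= lam ^- 2 ->
  exists A : R, (\int[N01]_z (expR (log_ratio1 m lam z / 2))%:E = A%:E)%E /\
    expR (- ((1 - lam ^- 2) ^+ 2 + (m / lam ^+ 2) ^+ 2) / 2) <= A.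
Proof.
move=> lam0 hs; pose s := lam ^- 2.
have s0 : 0 < s by rewrite invr_gt0 exprn_gt0.
pose al := (s - 1) / 2; pose be := m * s / 2.
have al1 : 1 + al = (1 + s) / 2 by rewrite /al; field.
have al0 : 0 < 1 + al by rewrite al1 divr_gt0// ltr_pwDl// ltW.
pose A := expR (- ln lam / 2 - m ^+ 2 * s / 4) *
  ((Num.sqrt (1 + al))^-1 * expR (be ^+ 2 / (2 * (1 + al)))).
exists A; split.
  rewrite /A EFinM -integral_expR_quadratic// -ge0_integralZl//=.
  - apply: eq_integral => z _; rewrite -EFinM -expRD; congr (expR _)%:E.
    by rewrite /log_ratio1 /al /be /s; field; rewrite gt_eqF.
  - apply/measurable_EFinP/measurableT_comp => //; apply: measurable_funD.
      by apply: measurable_funM => //; apply: measurable_funM => //; apply: measurable_funX.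
    exact: measurable_funM.
have A0 : 0 <= A by rewrite /A !mulr_ge0 ?expR_ge0// invr_ge0 sqrtr_ge0.
rewrite -(@ler_pXn2r _ 2)// ?nnegrE ?expR_ge0//.
have A2 : A ^+ 2 = lam^-1 * (1 + al)^-1 * expR (- (m ^+ 2 * s / (2 * (1 + s)))).
  rewrite /A !exprMn exprVn sqr_sqrtr; last exact: ltW.
  rewrite -!expRM_natl mulrCA -[RHS]mulrA [in RHS]mulrCA; congr (_ * _).
  rewrite -expRD -[lam^-1]lnK ?posrE ?invr_gt0// lnV ?posrE// -expRD; congr expR.
  rewrite al1 /be; field.
  by rewrite gt_eqF// addr_gt0.
rewrite A2 -expRM_natl.
have -> : 2%:R * (- ((1 - lam ^- 2) ^+ 2 + (m / lam ^+ 2) ^+ 2) / 2) =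
   - (1 - s) ^+ 2 + - (m * s) ^+ 2 by rewrite /s; field; rewrite gt_eqF.
rewrite expRD ler_pM ?expR_ge0//.
  have w0 : 0 <= (1 - s) ^+ 2 by exact: sqr_ge0.
  rewrite -(@ler_pXn2r _ 2)// ?nnegrE ?expR_ge0//; last first.
    by rewrite mulr_ge0// invr_ge0 ltW.
  have -> : (lam^-1 / (1 + al)) ^+ 2 = (4 * s) / (1 + s) ^+ 2.
    by rewrite al1 expr_div_n exprVn -/s; field; rewrite gt_eqF// addr_gt0.
  rewrite -expRM_natl mulrN expRN -[leRHS]invrK lef_pV2 ?posrE ?expR_gt0//; last first.
    rewrite invr_gt0; apply: divr_gt0; first by rewrite mulr_gt0.
    by rewrite exprn_gt0// addr_gt0.
  apply: le_trans (expR_ge1Dx _); rewrite invf_div ler_pdivrMr ?mulr_gt0//.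
  have hs' : 2^-1 <= s by [].
  have : 0 <= (s - 2^-1) * (1 - s) ^+ 2 by rewrite mulr_ge0// subr_ge0.
  have -> : (1 + s) ^+ 2 = (1 - s) ^+ 2 + 4 * s by ring.
  move: ((1 - s) ^+ 2) w0 => w w0; nra.
rewrite ler_expR lerN2 ler_pdivrMr ?mulr_gt0 ?addr_gt0//.
have hs' : 2^-1 <= s by [].
have : 0 <= m ^+ 2 * s by rewrite mulr_ge0 ?sqr_ge0// ltW.
rewrite exprMn; move: (m ^+ 2) => q qs0.
have -> : q * s ^+ 2 * (2 * (1 + s)) = (q * s) * (2 * s * (1 + s)) by ring.
have : 1 <= 2 * s * (1 + s) by nra.
by move=> h; rewrite ler_peMr.
Qed.

End affinity1.

Section product_ratio.
Context {R : realType} {n : nat}.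
Local Notation RT := (measurableTypeR R).
Local Notation T := (n.-tuple RT).
Local Notation N01 := (@normal_prob R 0 1).
Local Notation gam := (@gaussian_tuple R n).
Variables (m lam : 'I_n -> R).
Hypothesis lam0 : forall i, 0 < lam i.

Definition log_ratio_tuple (z : T) : R :=
  \sum_(i < n) log_ratio1 (m i) (lam i) (tnth z i).

Lemma measurable_log_ratio_tuple : measurable_fun setT log_ratio_tuple.
Proof.
apply: measurable_sum => i.
exact: (measurableT_comp (measurable_log_ratio1 _ _) (measurable_tnth i)).
Qed.

Definition diag_affine : T -> T :=
  affine_tuple (\col_i m i) (diag_mx (\row_i lam i)).

Lemma tnth_diag_affine z i : tnth (diag_affine z) i = m i + lam i * tnth z i.
Proof.
rewrite tnth_affine_tuple mxE; congr (_ + _).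
rewrite (bigD1 i)//= big1 ?addr0; first by rewrite !mxE eqxx mulr1n.
by move=> j ji; rewrite !mxE eq_sym (negbTE ji) mulr0n mul0r.
Qed.

(** Affinities multiply over independent coordinates, and 1 + x <= exp x makes
    the bound additive. *)
Lemma affinity_log_ratio_tuple : (forall i, 2^-1 <= lam i ^- 2) ->
  exists A : R, (\int[gam]_z (expR (log_ratio_tuple z / 2))%:E = A%:E)%E /\
    1 - (\sum_(i < n) ((1 - lam i ^- 2) ^+ 2 + (m i / lam i ^+ 2) ^+ 2)) / 2 <= A.
Proof.
move=> hs.
have /choice[A hA] : forall i, exists A : R,
    (\int[N01]_z (expR (log_ratio1 (m i) (lam i) z / 2))%:E = A%:E)%E /\
    expR (- ((1 - lam i ^- 2) ^+ 2 + (m i / lam i ^+ 2) ^+ 2) / 2) <= A.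
  by move=> i; exact: affinity_log_ratio1.
exists (\prod_(i < n) A i); split.
  rewrite -prodEFin; under [RHS]eq_bigr do rewrite -(hA _).1.
  rewrite -(@ge0_integral_gaussian_prod R n (fun i z => expR (log_ratio1 (m i) (lam i) z / 2))).
  - by apply: eq_integral => z _; rewrite -expR_sum mulr_suml.
  - move=> i; apply: measurableT_comp => //; apply: measurable_funM => //.
    exact: measurable_log_ratio1.
  - by move=> i x; exact: expR_ge0.
apply: (@le_trans _ _ (\prod_(i < n)
    expR (- ((1 - lam i ^- 2) ^+ 2 + (m i / lam i ^+ 2) ^+ 2) / 2))); last first.
  by apply: ler_prod => i _; rewrite expR_ge0/=; exact: (hA i).2.
by rewrite -expR_sum -mulr_suml sumrN mulNr expR_ge1Dx.
Qed.

(** Up to a constant, the log-likelihood ratio is a quadratic polynomial with the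
    coefficients 1 - lam_i^(-2) and m_i/lam_i^2. *)
Lemma log_ratio_small_ball (V : R) : 0 < V ->
  V <= \sum_(i < n) ((1 - lam i ^- 2) ^+ 2 + (m i / lam i ^+ 2) ^+ 2) ->
  forall s, 0 < s ->
  fine (gam [set z | `|log_ratio_tuple z| <= s ^+ 3]) <= 4 * Num.max 1 V^-1 * s.
Proof.
move=> V0 Vle s s0.
pose x := \sum_(i < n) (ln (lam i) + m i ^+ 2 / (2 * lam i ^+ 2)).
have := quadratic_small_ball x V0 Vle s0.
suff -> : [set z : T | `|\sum_(i < n) ((1 - lam i ^- 2) * tnth z i ^+ 2 / 2 + m i / lam i ^+ 2 * tnth z i) - x|
   <= s ^+ 3] = [set z | `|log_ratio_tuple z| <= s ^+ 3] by [].
apply/seteqP; split=> z /=; rewrite /x -sumrB; congr (`|_| <= _);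
  apply: eq_bigr => i _; rewrite /log_ratio1; field; by rewrite gt_eqF.
Qed.

End product_ratio.

Section product_ratio_density.
Context {R : realType}.
Local Notation RT := (measurableTypeR R).

Lemma ge0_integral_diag_affine n (m lam : 'I_n -> R) (g : n.-tuple RT -> \bar R) :
  (forall i, 0 < lam i) -> measurable_fun setT g -> (forall z, (0 <= g z)%E) ->
  (\int[gaussian_tuple n]_z g (diag_affine m lam z) =
   \int[gaussian_tuple n]_z (g z * (expR (log_ratio_tuple m lam z))%:E))%E.
Proof.
elim: n m lam g => [|n IH] m lam g lam0 mg g0.
  apply: eq_integral => z _; rewrite /log_ratio_tuple big_ord0 expR0 mule1.
  by rewrite (tuple0 z) (tuple0 (diag_affine _ _ _)).
pose m' i := m (lift ord0 i); pose lam' i := lam (lift ord0 i).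
have mgd : measurable_fun setT (fun z => g (diag_affine m lam z)).
  by apply: measurableT_comp => //; exact: measurable_affine_tuple.
have mge : measurable_fun setT (fun z => (g z * (expR (log_ratio_tuple m lam z))%:E)%E).
  apply: emeasurable_funM => //; apply/measurable_EFinP/measurableT_comp => //.
  exact: measurable_log_ratio_tuple.
rewrite ge0_integral_gaussian_cons//.
rewrite ge0_integral_gaussian_cons//; last by move=> z; rewrite mule_ge0// lee_fin expR_ge0.
have diagE x z : diag_affine m lam (tuple_cons (x, z)) =
    tuple_cons (m ord0 + lam ord0 * x, diag_affine m' lam' z).
  apply: eq_from_tnth => i; rewrite tnth_diag_affine.
  case: (unliftP ord0 i) => [j ->|->].
    by rewrite !tnth_tuple_consS tnth_diag_affine.
  by rewrite !tnth_tuple_cons0.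
have ratioE x z : log_ratio_tuple m lam (tuple_cons (x, z)) =
    log_ratio_tuple m' lam' z + log_ratio1 (m ord0) (lam ord0) x.
  rewrite /log_ratio_tuple big_ord_recl tnth_tuple_cons0 addrC; congr (_ + _).
  by apply: eq_bigr => i _; rewrite tnth_tuple_consS.
pose h (p : RT * n.-tuple RT) := (g (tuple_cons p) * (expR (log_ratio_tuple m' lam' p.2))%:E)%E.
have mh : measurable_fun setT h.
  apply: emeasurable_funM; first exact: measurableT_comp.
  apply/measurable_EFinP/measurableT_comp => //.
  exact: (measurableT_comp (measurable_log_ratio_tuple _ _) measurable_snd).
have h0 p : (0 <= h p)%E by rewrite mule_ge0// lee_fin expR_ge0.
pose G x := (\int[gaussian_tuple n]_z h (x, z))%E.
have mG : measurable_fun setT G by exact: measurable_fun_fubini_tonelli_F.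
have G0 x : (0 <= G x)%E by apply: integral_ge0.
transitivity (\int[normal_prob 0 1]_x G (m ord0 + lam ord0 * x)%R)%E.
  apply: eq_integral => x _; rewrite /G.
  under eq_integral do rewrite diagE.
  rewrite (IH m' lam' (fun z => g (tuple_cons (m ord0 + lam ord0 * x, z))))//.
  - by move=> i; exact: lam0.
  - exact: (measurableT_comp (measurableT_comp mg (@measurable_tuple_cons R n)) (pair1_measurable _)).
rewrite ge0_integral_normal01_affine//.
apply: eq_integral => x _; rewrite /G -ge0_integralZr//=.
- apply: eq_integral => z _; rewrite /h/= ratioE expRD EFinM muleA//.
- exact: (measurableT_comp mh (pair1_measurable x)).
Qed.

(** Change of measure between two product normal laws. *)
Lemma diag_affine_log_ratio n (m lam : 'I_n -> R) (D : set (n.-tuple RT)) :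
  (forall i, 0 < lam i) -> measurable D ->
  gaussian_tuple n (diag_affine m lam @^-1` D) =
  (\int[gaussian_tuple n]_(z in D) (expR (log_ratio_tuple m lam z))%:E)%E.
Proof.
move=> lam0 mD.
have mpre : measurable (diag_affine m lam @^-1` D).
  by rewrite -[X in measurable X]setTI; exact: measurable_affine_tuple.
have h := @ge0_integral_diag_affine n m lam (fun z => (\1_D z)%:E) lam0.
transitivity (\int[gaussian_tuple n]_z (\1_(diag_affine m lam @^-1` D) z)%:E)%E.
  by rewrite integral_indic// setIT.
transitivity (\int[gaussian_tuple n]_z (\1_D (diag_affine m lam z))%:E)%E.
  by apply: eq_integral => z _; rewrite !indicE.
rewrite h.
- rewrite [RHS]integral_mkcond; apply: eq_integral => z _.
  by rewrite patchE indicE; case: ifP; rewrite ?mul1e ?mul0e.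
- by apply/measurable_EFinP; exact: measurable_indic.
- by move=> z; rewrite lee_fin indicE.
Qed.

End product_ratio_density.

(** * Simultaneous diagonalization of positive definite forms *)
Section posdef.
Context {R : realType}.

Lemma quadratic_formE n (D : 'M[R]_n) (x : 'rV[R]_n) : sym_posdef D -> x != 0 ->
  0 < (x *m D *m x^T) 0 0.
Proof.
move=> [_ Dpos] x0; have := Dpos x^T; rewrite trmxK; apply.
by apply: contra x0 => /eqP xT; rewrite -[x]trmxK xT trmx0.
Qed.

Lemma sym_posdef_unit n (D : 'M[R]_n) : sym_posdef D -> D \in unitmx.
Proof.
move=> Dpos; rewrite -row_free_unit; apply: inj_row_free => x xD.
apply/eqP; apply: contraT => x0.
by have := quadratic_formE Dpos x0; rewrite xD mul0mx mxE ltxx.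
Qed.

Lemma sym_posdef_congr n p (D : 'M[R]_n) (W : 'M[R]_(p, n)) : sym_posdef D ->
  row_free W -> sym_posdef (W *m D *m W^T).
Proof.
move=> Dpos Wfree; split.
  by rewrite !trmx_mul trmxK Dpos.1 mulmxA.
move=> v v0; have := @quadratic_formE n D (v^T *m W) Dpos.
rewrite trmx_mul trmxK !mulmxA; apply.
apply: contra v0 => /eqP /(congr1 (mulmx^~ (pinvmx W))).
by rewrite mul0mx mulmxKp// => /(congr1 trmx); rewrite trmxK trmx0 => ->.
Qed.

Lemma sym_posdef_gram n p (W : 'M[R]_(n, p)) : row_free W -> sym_posdef (W *m W^T).
Proof.
move=> Wfree; rewrite -[W in W *m _]mulmx1; apply: sym_posdef_congr => //.
split=> [|v v0]; first by rewrite trmx1.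
rewrite mulmx1 mxE; under eq_bigr do rewrite mxE -expr2.
rewrite lt_neqAle sumr_ge0 ?andbT; last by move=> i _; exact: sqr_ge0.
apply: contra v0; rewrite eq_sym psumr_eq0; last by move=> i _; exact: sqr_ge0.
move=> /allP h; apply/eqP/matrixP => i j; rewrite ord1 mxE.
by have := h i (mem_index_enum _); rewrite sqrf_eq0 => /eqP.
Qed.

(** Two positive definite forms have a common eigenvector: a complex
    generalized eigenvector exists, its eigenvalue is real because both forms
    are symmetric, and then its real or imaginary part is one as well. *)
Lemma generalized_eigenvector n (D0 D1 : 'M[R]_n.+1) : sym_posdef D0 -> sym_posdef D1 ->
  exists v : 'rV[R]_n.+1, exists2 mu : R, v != 0 & 0 < mu /\ v *m D1 = mu *: (v *m D0).
Proof.
move=> D0pos D1pos.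
have D0u := sym_posdef_unit D0pos.
pose toC := map_mx (real_complex R).
have [a /eigenvalueP[x xE x0]] := @eigenvalue_closed _ _ (map_mx (real_complex R) (invmx D0 *m D1)) isT.
pose y := x *m map_mx (real_complex R) (invmx D0).
have yE : y *m map_mx (real_complex R) D1 = a *: (y *m map_mx (real_complex R) D0).
  rewrite /y -!mulmxA -!map_mxM mulVmx// map_mx1 mulmx1 -xE.
  by rewrite map_mxM.
have y0 : y != 0.
  apply: contra x0 => /eqP yz; apply/eqP.
  have : y *m map_mx (real_complex R) D0 = x.
    by rewrite /y -mulmxA -map_mxM mulVmx// map_mx1 mulmx1.
  by rewrite yz mul0mx => <-.
clearbody y.
pose p : 'rV[R]_n.+1 := map_mx (@complex.Re R) y.
pose q : 'rV[R]_n.+1 := map_mx (@complex.Im R) y.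
pose al := complex.Re a; pose be := complex.Im a.
have reE (D : 'M[R]_n.+1) i j :
    complex.Re ((y *m map_mx (real_complex R) D) i j) = (p *m D) i j.
  rewrite !mxE raddf_sum/=; apply: eq_bigr => k _; rewrite !mxE.
  by case: (y i k) => u w /=; rewrite mulr0 subr0.
have imE (D : 'M[R]_n.+1) i j :
    complex.Im ((y *m map_mx (real_complex R) D) i j) = (q *m D) i j.
  rewrite !mxE raddf_sum/=; apply: eq_bigr => k _; rewrite !mxE.
  by case: (y i k) => u w /=; rewrite mulr0 add0r.
have pE : p *m D1 = al *: (p *m D0) - be *: (q *m D0).
  apply/matrixP => i j; rewrite -reE yE [RHS]mxE [X in _ = X + _]mxE.
  rewrite [X in _ = _ + X]mxE [X in _ = _ - X]mxE -reE -imE mxE /al /be.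
  by case: a {yE xE al be} => ? ?; case: ((y *m _) i j).
have qE : q *m D1 = al *: (q *m D0) + be *: (p *m D0).
  apply/matrixP => i j; rewrite -imE yE [RHS]mxE [X in _ = X + _]mxE.
  rewrite [X in _ = _ + X]mxE -reE -imE mxE /al /be.
  by case: a {yE xE al be pE} => ? ?; case: ((y *m _) i j).
have pq0 : (p != 0) || (q != 0).
  apply: contraNT y0; rewrite negb_or !negbK => /andP[/eqP/matrixP p0 /eqP/matrixP q0].
  apply/eqP/matrixP => i j; move: (p0 i j) (q0 i j); rewrite !mxE.
  by case: (y i j) => ? ? /= -> ->.
have symE (D : 'M[R]_n.+1) (u v : 'rV[R]_n.+1) : sym_posdef D ->
    (u *m D *m v^T) 0 0 = (v *m D *m u^T) 0 0.
  move=> [Ds _]; rewrite -{2}Ds.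
  transitivity ((u *m D *m v^T)^T 0 0); first by rewrite [RHS]mxE.
  by rewrite !trmx_mul trmxK mulmxA Ds.
have ge0 (D : 'M[R]_n.+1) (u : 'rV[R]_n.+1) : sym_posdef D -> 0 <= (u *m D *m u^T) 0 0.
  move=> Dpos; have [->|u0] := eqVneq u 0; first by rewrite !mul0mx mxE.
  exact/ltW/quadratic_formE.
(* pairing the two equations shows that be times a positive quantity is 0 *)
have be0 : be = 0.
  have := symE D1 p q D1pos.
  have lin (b c : R) (M N : 'M[R]_1) : (b *: M + c *: N) 0 0 = b * M 0 0 + c * N 0 0.
    by rewrite !mxE.
  rewrite pE qE -scaleNr !mulmxDl -!scalemxAl !lin (symE D0 p q)// mulNr.
  move=> /addrI /eqP; rewrite eq_sym -addr_eq0 -mulrDr mulf_eq0 => /orP[/eqP//|].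
  rewrite paddr_eq0 ?ge0// => /andP[/eqP pp /eqP qq].
  by case/orP: pq0 => /(quadratic_formE D0pos); rewrite ?pp ?qq ltxx.
have main (u : 'rV[R]_n.+1) : u != 0 -> u *m D1 = al *: (u *m D0) ->
    exists v : 'rV[R]_n.+1, exists2 mu : R, v != 0 & 0 < mu /\ v *m D1 = mu *: (v *m D0).
  move=> u0 uE; exists u, al => //; split=> //.
  have := quadratic_formE D1pos u0; rewrite uE -scalemxAl mxE.
  by rewrite pmulr_lgt0// quadratic_formE.
rewrite be0 scale0r subr0 in pE; rewrite be0 scale0r addr0 in qE.
by case/orP: pq0 => /main; apply.
Qed.

Lemma orthogonal_complement n (u : 'cV[R]_n.+1) : u != 0 ->
  exists2 W : 'M[R]_(n, n.+1), row_free W & W *m u = 0.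
Proof.
move=> u0.
have key r (B : 'M[R]_(r, n.+1)) : r = n -> row_free B -> B *m u = 0 ->
    exists2 W : 'M[R]_(n, n.+1), row_free W & W *m u = 0.
  by move=> rn; subst r => Bf Bu; exists B.
apply: (key _ (row_base (kermx u))).
- rewrite mxrank_ker (_ : \rank u = 1)%N ?subn1//.
  apply/eqP; rewrite eqn_leq rank_leq_col lt0n mxrank_eq0 u0//.
- exact: row_base_free.
- by apply/sub_kermxP; rewrite eq_row_base.
Qed.

(** By induction: split off a common eigenvector v and restrict both forms to
    the complement W of v, which is orthogonal to v for D0, hence for D1 as well
    because v D1 is proportional to v D0. *)
Lemma simultaneous_diag n (D0 D1 : 'M[R]_n) : sym_posdef D0 -> sym_posdef D1 ->
  exists G : 'M[R]_n, exists2 L : 'rV[R]_n, (forall i, 0 < L 0 i) &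
    [/\ G \in unitmx, D0 = G *m G^T &
        D1 = (G *m diag_mx L) *m (G *m diag_mx L)^T].
Proof.
elim: n D0 D1 => [|n IH] D0 D1 D0pos D1pos.
  exists 1%:M, 0; first by case.
  split; [exact: unitmx1| |]; by apply/matrixP => -[].
have [v [mu v0 [mu0 vD1]]] := generalized_eigenvector D0pos D1pos.
pose u := D0 *m v^T.
pose d := (v *m u) 0 0.
have d0 : 0 < d by rewrite /d /u mulmxA; exact: quadratic_formE.
have [|W Wf Wu] := @orthogonal_complement n u.
  by apply/eqP => uz; move: d0; rewrite /d uz mulmx0 mxE ltxx.
have [G [L L0 [Gu D0E D1E]]] := IH _ _ (sym_posdef_congr D0pos Wf) (sym_posdef_congr D1pos Wf).
pose Q : 'M[R]_(1 + n) := col_mx v W.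
have scE (M : 'M[R]_1) : M = (M 0 0)%:M by exact: mx11_scalar.
have vuE : v *m D0 *m v^T = d%:M by rewrite -mulmxA [LHS]scE.
have WD0 : W *m D0 *m v^T = 0 by rewrite -mulmxA.
have vD0 : v *m D0 *m W^T = 0.
  by have /(congr1 trmx) := WD0; rewrite !trmx_mul trmxK D0pos.1 mulmxA trmx0.
have vD1W : v *m D1 *m W^T = 0 by rewrite vD1 -scalemxAl vD0 scaler0.
have WD1 : W *m D1 *m v^T = 0.
  by have /(congr1 trmx) := vD1W; rewrite !trmx_mul trmxK D1pos.1 mulmxA trmx0.
have Qu : Q \in unitmx.
  rewrite -row_free_unit; apply: inj_row_free => x.
  rewrite -[x]hsubmxK mul_row_col => xQ.
  have l0 : lsubmx x = 0.
    have /(congr1 (mulmx^~ u)) := xQ.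
    rewrite mulmxDl -!mulmxA Wu mulmx0 addr0 mul0mx (scE (v *m u)) mul_mx_scalar.
    by move=> /eqP; rewrite scaler_eq0 gt_eqF//= => /eqP.
  move: xQ; rewrite l0 mul0mx add0r => /(congr1 (mulmx^~ (pinvmx W))).
  by rewrite mulmxKp// mul0mx => ->; rewrite row_mx0.
have Q0 : Q *m D0 *m Q^T = block_mx d%:M 0 0 (W *m D0 *m W^T).
  by rewrite /Q tr_col_mx !mul_col_mx !mul_mx_row vuE WD0 vD0.
have Q1 : Q *m D1 *m Q^T = block_mx (mu * d)%:M 0 0 (W *m D1 *m W^T).
  rewrite /Q tr_col_mx !mul_col_mx !mul_mx_row WD1 vD1W vD1 -scalemxAl vuE.
  by rewrite scale_scalar_mx.
pose G' : 'M[R]_(1 + n) := block_mx (Num.sqrt d)%:M 0 0 G.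
pose L' : 'rV[R]_(1 + n) := row_mx (Num.sqrt mu)%:M L.
have back (D M : 'M[R]_(1 + n)) : Q *m D *m Q^T = M *m M^T ->
    D = (invmx Q *m M) *m (invmx Q *m M)^T.
  move=> QE; rewrite trmx_mul mulmxA -(mulmxA _ M) -QE !mulmxA mulVmx// mul1mx.
  by rewrite -mulmxA -trmx_mul mulVmx// trmx1 mulmx1.
exists (invmx Q *m G'), L'.
  move=> i; rewrite mxE; case: fintype.splitP => j _; last exact: L0.
  by rewrite ord1 mxE eqxx mulr1n sqrtr_gt0.
split.
- rewrite unitmx_mul unitmx_inv Qu/=.
  rewrite unitmxE (@det_ublock R 1 n) det_scalar1 unitrM.
  by rewrite -unitmxE Gu andbT unitfE gt_eqF// sqrtr_gt0.
- apply: back; rewrite Q0 /G' tr_block_mx mulmx_block !trmx0 !mulmx0 !mul0mx.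
  rewrite !addr0 add0r -D0E tr_scalar_mx -scalar_mxM -expr2 sqr_sqrtr//.
  exact: ltW.
- have dL : diag_mx L' = block_mx (Num.sqrt mu)%:M 0 0 (diag_mx L) :> 'M[R]_(1 + n).
    rewrite [LHS](@diag_mx_row _ n 1 (Num.sqrt mu)%:M L); congr block_mx.
    by apply/matrixP => i j; rewrite !ord1 !mxE.
  pose M : 'M[R]_(1 + n) := block_mx (Num.sqrt d * Num.sqrt mu)%:M 0 0 (G *m diag_mx L).
  have -> : invmx Q *m G' *m diag_mx L' = invmx Q *m M.
    rewrite -mulmxA; congr (_ *m _); rewrite dL /G' (@mulmx_block R 1 n 1 n 1 n).
    by rewrite !mulmx0 !mul0mx !addr0 add0r -scalar_mxM.
  apply: back; rewrite Q1 /M tr_block_mx !trmx0 mulmx_block.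
  rewrite !mulmx0 !mul0mx !addr0 add0r -D1E tr_scalar_mx -scalar_mxM mulrACA -!expr2.
  by rewrite !sqr_sqrtr// ?ltW// mulrC.
Qed.

End posdef.

(** * Coordinates for a pair of equivalent Gaussian laws *)
Section ranges.
Context {R : realType}.
Local Notation RT := (measurableTypeR R).

Lemma affine_tuple_comp p q r (mu : 'cV[R]_p) (A : 'M[R]_(p, q)) (nu : 'cV[R]_q)
    (B : 'M[R]_(q, r)) z :
  affine_tuple mu A (affine_tuple nu B z) = affine_tuple (mu + A *m nu) (A *m B) z.
Proof.
apply: eq_from_tnth => i; rewrite !tnth_mktuple; congr (fun_of_matrix _ i 0).
rewrite -addrA; congr (_ + _); rewrite -mulmxA -mulmxDr; congr (_ *m _).
by apply/matrixP => j k; rewrite !ord1 mxE tnth_mktuple.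
Qed.

Lemma affine_tuple_id p (z : p.-tuple RT) : affine_tuple 0 1%:M z = z.
Proof.
by apply: eq_from_tnth => i; rewrite tnth_mktuple mul1mx add0r mxE.
Qed.

(** A linear form k that is constant under the dominating law is constant under
    the dominated one, with the same value. Almost sure constancy forces the
    Fourier transform of the form to have modulus 1, hence its variance to
    vanish. *)
Lemma affine_law_dominates_range p q q' (mu0 mu1 : 'cV[R]_p) (A0 : 'M[R]_(p, q))
    (A1 : 'M[R]_(p, q')) (P0 P1 : probability (p.-tuple RT) R) :
  (forall D, measurable D -> P0 D = gaussian_tuple q (affine_tuple mu0 A0 @^-1` D)) ->
  (forall D, measurable D -> P1 D = gaussian_tuple q' (affine_tuple mu1 A1 @^-1` D)) ->
  P1 `<< P0 -> forall k : 'rV[R]_p, k *m A0 = 0 ->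
  k *m A1 = 0 /\ k *m (mu1 - mu0) = 0.
Proof.
move=> P0E P1E P10 k kA0.
pose c0 : R := (k *m mu0) 0 0.
pose D : set (p.-tuple RT) := [set x | \sum_i k 0 i * tnth x i <> c0].
have mS : measurable_fun setT (fun x : p.-tuple RT => \sum_i k 0 i * tnth x i : RT).
  apply: measurable_sum => i; apply: measurable_funM => //.
  exact: measurable_tnth.
have mD : measurable D.
  have -> : D = setT `&` (fun x : p.-tuple RT => \sum_i k 0 i * tnth x i : RT) @^-1` (~` [set c0]).
    by rewrite setTI; apply/seteqP; split.
  by apply: mS => //; apply: measurableC; exact: measurable_set1.
have linE r (mu : 'cV[R]_p) (A : 'M[R]_(p, r)) z :
    \sum_i k 0 i * tnth (affine_tuple mu A z) i =
    (k *m mu) 0 0 + (k *m A *m (\col_j (tnth z j : R))) 0 0.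
  have -> : \sum_i k 0 i * tnth (affine_tuple mu A z) i =
     (k *m (mu + A *m (\col_j (tnth z j : R)))) 0 0.
    by rewrite [RHS]mxE; apply: eq_bigr => i _; rewrite tnth_mktuple.
  by rewrite mulmxDr mulmxA mxE.
have P0D : P0 D = 0%E.
  rewrite P0E// (_ : _ @^-1` D = set0) ?measure0//.
  apply/seteqP; split=> // z; rewrite /D/= linE kA0 mul0mx [X in _ + X]mxE addr0; exact.
have P1D : P1 D = 0%E.
  by move: P10 => /null_content_dominatesP; apply.
have kA1 : k *m A1 = 0.
  have := @fourier_affine_law R p q' mu1 A1 (fun i => k 0 i) c0.
  have -> : \int[affine_law mu1 A1]_x cos (\sum_(i < p) k 0 i * tnth x i - c0) = 1.
    transitivity (\int[affine_law mu1 A1]_x 1); last first.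
      by rewrite Rintegral_cst// [X in _ * fine X]probability_setT mulr1.
    rewrite /Rintegral; congr fine; apply: ae_eq_integral => //.
      by apply/measurable_EFinP; exact: measurable_cos_linear.
    exists D; split=> //; first by rewrite -[RHS]P1D P1E.
    move=> x /= nx; rewrite /D/= => e; apply: nx => _.
    by rewrite e subrr cos0.
  rewrite gram_sum (_ : \sum_j _ ^+ 2 = \sum_j (k *m A1) 0 j ^+ 2); last first.
    by apply: eq_bigr => j _; rewrite mxE.
  move: (cos _) (cos_le1 (c0 - \sum_i k 0 i * mu1 i 0)) => c c1 e1.
  have Q0 : \sum_j (k *m A1) 0 j ^+ 2 <= 0.
    rewrite leNgt; apply/negP => Q0.
    have : c * expR (- (\sum_j (k *m A1) 0 j ^+ 2) / 2) < 1.
      apply: (@le_lt_trans _ _ (expR (- (\sum_j (k *m A1) 0 j ^+ 2) / 2))).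
        by rewrite ler_piMl// expR_ge0.
      by rewrite expR_lt1 mulNr oppr_lt0 divr_gt0.
    by rewrite -e1 ltxx.
  have /eqP : \sum_j (k *m A1) 0 j ^+ 2 = 0.
    by apply/eqP; rewrite eq_le Q0 sumr_ge0// => j _; exact: sqr_ge0.
  rewrite psumr_eq0; last by move=> j _; exact: sqr_ge0.
  move=> /allP h; apply/matrixP => i j; rewrite ord1 [RHS]mxE.
  by have := h j (mem_index_enum _); rewrite sqrf_eq0 => /eqP.
split=> //; apply/eqP; rewrite mulmxBr subr_eq0; apply/eqP.
have [//|ne] := eqVneq (k *m mu1) (k *m mu0).
have : P1 D = 1%E.
  rewrite P1E// (_ : _ @^-1` D = setT) ?probability_setT//.
  apply/seteqP; split=> // z _; rewrite /D/= linE kA1 mul0mx [X in _ + X]mxE addr0.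
  move=> e; move/eqP: ne; apply; apply/matrixP => i j; rewrite !ord1; exact: e.
by rewrite P1D => /eqP; rewrite eq_sym onee_eq0.
Qed.

Lemma colspan_factor p q r (A : 'M[R]_(p, q)) (M : 'M[R]_(p, r)) :
  (forall k : 'rV[R]_p, k *m A = 0 -> k *m M = 0) -> exists T, M = A *m T.
Proof.
move=> h; have sMA : (M^T <= A^T)%MS.
  rewrite submxE -trmx_eq0 trmx_mul trmxK; apply/eqP/row_matrixP => i.
  rewrite row_mul row0; apply: h; rewrite -row_mul.
  have -> : (cokermx A^T)^T *m A = (A^T *m cokermx A^T)^T.
    by rewrite [RHS]trmx_mul trmxK.
  by rewrite mulmx_coker trmx0 row0.
exists (M^T *m pinvmx A^T)^T.
by rewrite -[LHS]trmxK -[in LHS](mulmxKpV sMA) trmx_mul trmxK.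
Qed.

(** The columns of a basis of the range of A0, composed with the matrix G that
    diagonalizes both covariances in that basis, give coordinates of the common
    affine support in which the first law is standard and the second one is a
    product. K reads these coordinates off. *)
Lemma simultaneous_affine_form p (mu0 mu1 : 'cV[R]_p) (A0 A1 : 'M[R]_p) :
  (forall k : 'rV[R]_p, k *m A0 = 0 -> k *m A1 = 0 /\ k *m (mu1 - mu0) = 0) ->
  (forall k : 'rV[R]_p, k *m A1 = 0 -> k *m A0 = 0) ->
  exists r (B : 'M[R]_(p, r)) (K : 'M[R]_(r, p)) (m : 'cV[R]_r) (L : 'rV[R]_r),
    [/\ K *m B = 1%:M, forall i, 0 < L 0 i, B *m B^T = A0 *m A0^T,
        (B *m diag_mx L) *m (B *m diag_mx L)^T = A1 *m A1^T & mu1 = mu0 + B *m m].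
Proof.
move=> h01 h10.
have [T A1E] := @colspan_factor _ _ _ A0 A1 (fun k h => (h01 k h).1).
have [w muE] := @colspan_factor _ _ _ A0 (mu1 - mu0) (fun k h => (h01 k h).2).
pose cb := col_base A0; pose rb := row_base A0.
have A0E : A0 = cb *m rb by rewrite mulmx_base.
pose K0 := pinvmx cb.
have K0cb : K0 *m cb = 1%:M by apply: mulVpmx; exact: col_base_full.
pose W := rb *m T.
have A1W : A1 = cb *m W by rewrite /W mulmxA -A0E.
have Wf : row_free W.
  apply: inj_row_free => x xW.
  have : x *m K0 *m A0 = 0.
    by apply: h10; rewrite A1W mulmxA -(mulmxA x) K0cb mulmx1.
  rewrite {2}A0E mulmxA -(mulmxA x) K0cb mulmx1 => /(congr1 (mulmx^~ (pinvmx rb))).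
  by rewrite mulmxKp ?mul0mx//; exact: row_base_free.
have [G [L L0 [Gu D0E D1E]]] :=
  simultaneous_diag (sym_posdef_gram (row_base_free A0)) (sym_posdef_gram Wf).
exists (\rank A0), (cb *m G), (invmx G *m K0), (invmx G *m rb *m w), L; split=> //.
- by rewrite mulmxA -(mulmxA _ K0) K0cb mulmx1 mulVmx.
- have -> : A0 *m A0^T = cb *m (rb *m rb^T) *m cb^T.
    have e : (cb *m rb) *m (cb *m rb)^T = cb *m (rb *m rb^T) *m cb^T.
      by rewrite trmx_mul !mulmxA.
    by rewrite -A0E in e.
  by rewrite D0E trmx_mul !mulmxA.
- have -> : A1 *m A1^T = cb *m (W *m W^T) *m cb^T by rewrite A1W trmx_mul !mulmxA.
  by rewrite D1E !trmx_mul !mulmxA.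
- have -> : cb *m G *m (invmx G *m rb *m w) = mu1 - mu0.
    by rewrite muE [in RHS]A0E !mulmxA mulmxK.
  by rewrite addrC subrK.
Qed.

End ranges.

Section coordinates.
Context {R : realType}.
Local Notation RT := (measurableTypeR R).
Variables (p r : nat) (mu0 mu1 : 'cV[R]_p) (B : 'M[R]_(p, r)) (K : 'M[R]_(r, p))
  (m : 'cV[R]_r) (L : 'rV[R]_r) (P0 P1 : probability (p.-tuple RT) R).
Hypothesis KB : K *m B = 1%:M.
Hypothesis L0 : forall i, 0 < L 0 i.
Hypothesis mu1E : mu1 = mu0 + B *m m.
Hypothesis P0E : forall D, measurable D ->
  P0 D = gaussian_tuple r (affine_tuple mu0 B @^-1` D).
Hypothesis P1E : forall D, measurable D ->
  P1 D = gaussian_tuple r (affine_tuple mu1 (B *m diag_mx L) @^-1` D).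

Let F := affine_tuple mu0 B.
Let H := affine_tuple (- (K *m mu0)) K.
Let lrt := log_ratio_tuple (fun i => m i 0) (fun i => L 0 i).

Let mF : measurable_fun setT F. Proof. exact: measurable_affine_tuple. Qed.
Let mH : measurable_fun setT H. Proof. exact: measurable_affine_tuple. Qed.

Let FK z : H (F z) = z.
Proof. by rewrite /H /F affine_tuple_comp addNr KB affine_tuple_id. Qed.

Let ge0_integral_P0 (D : set (p.-tuple RT)) (f : p.-tuple RT -> \bar R) :
  measurable D -> measurable_fun setT f -> (forall x, (0 <= f x)%E) ->
  (\int[P0]_(x in D) f x = \int[gaussian_tuple r]_(z in F @^-1` D) f (F z))%E.
Proof.
move=> mD mf f0.
transitivity (\int[affine_law mu0 B]_(x in D) f x)%E.
  by apply: eq_measure_integral => E mE _; exact: P0E.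
rewrite [LHS]ge0_integral_pushforward//.
exact: measurable_funTS.
Qed.

(** In the coordinates H of the affine support, P0 is the standard law and P1 is
    diagonal, so that the log-likelihood ratio is the one of the product laws
    composed with H. Outside the support, which P0 does not charge, H is an
    arbitrary extension. *)
Lemma gaussian_coordinates : exists l : p.-tuple RT -> R,
  [/\ measurable_fun setT l,
      forall D, measurable D -> P1 D = (\int[P0]_(x in D) (expR (l x))%:E)%E,
      forall s : R, P0 [set x | `|l x| <= s] = gaussian_tuple r [set z | `|lrt z| <= s] &
      (\int[P0]_x (expR (l x / 2))%:E = \int[gaussian_tuple r]_z (expR (lrt z / 2))%:E)%E].
Proof.
have mlrt : measurable_fun setT lrt by exact: measurable_log_ratio_tuple.
have ml : measurable_fun setT (lrt \o H) by exact: measurableT_comp.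
exists (lrt \o H); split=> //.
- move=> D mD; rewrite ge0_integral_P0//; last first.
    by apply/measurable_EFinP/measurableT_comp.
  rewrite P1E//.
  have mpre : measurable (F @^-1` D) by rewrite -[X in measurable X]setTI; exact: mF.
  have -> : affine_tuple mu1 (B *m diag_mx L) @^-1` D =
      diag_affine (fun i => m i 0) (fun i => L 0 i) @^-1` (F @^-1` D).
    suff E z : affine_tuple mu1 (B *m diag_mx L) z =
        F (diag_affine (fun i => m i 0) (fun i => L 0 i) z).
      by apply/seteqP; split=> z /=; rewrite E.
    rewrite /F /diag_affine affine_tuple_comp mu1E.
    congr (affine_tuple (_ + B *m _) (B *m diag_mx _) _).
      by apply/matrixP => i j; rewrite !mxE ord1.
    by apply/matrixP => i j; rewrite !mxE ord1.
  rewrite (diag_affine_log_ratio _ L0 mpre).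
  by apply: eq_integral => z _; rewrite /= FK.
- move=> s.
  rewrite P0E; last first.
    have -> : [set x | `|(lrt \o H) x| <= s] = setT `&` (lrt \o H) @^-1` `[- s, s].
      by rewrite setTI; apply/seteqP; split => x /=; rewrite in_itv/= ler_norml.
    exact: ml.
  congr (gaussian_tuple r _); apply/seteqP; split=> z /=; by rewrite FK.
- have h := @ge0_integral_P0 setT (fun x => (expR ((lrt \o H) x / 2))%:E) measurableT.
  rewrite h.
  + by rewrite preimage_setT; apply: eq_integral => z _; rewrite /= FK.
  + by apply/measurable_EFinP; apply: measurableT_comp => //; apply: measurable_funM.
  + by move=> x; rewrite lee_fin expR_ge0.
Qed.

End coordinates.

(** * Equal covariances *)
Section excess_extra.
Context d (T : measurableType d) (R : realType).
Variables (P1 P0 : probability T R).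
Hypothesis P10 : equivalent_measures P1 P0.

Lemma learning_error_ge0 (g : T -> bool) : 0 <= learning_error P1 P0 g.
Proof. by rewrite mulr_ge0// addr_ge0// fine_prob_ge0. Qed.

Lemma learning_error_le1 (g : T -> bool) : measurable_fun setT g ->
  learning_error P1 P0 g <= 1.
Proof.
move=> mg.
have mgb b : measurable [set x | g x <> b].
  rewrite (_ : mkset _ = setT `&` g @^-1` [set b' | b' <> b]) ?setTI//.
  by rewrite -[X in measurable X]setTI; exact: mg.
have le1 (P : probability T R) b :
    fine (P [set x | g x <> b /\ optimal_rule P1 P0 x = b]) <= 1.
  apply: fine_prob_le1.
  exact: measurableI (mgb b) (measurable_optimal_rule P10 b).
by rewrite /learning_error ler_pdivrMl// mulr1; apply: lerD.
Qed.

End excess_extra.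

Section homoscedastic.
Context {R : realType}.
Local Notation RT := (measurableTypeR R).
Local Notation N01 := (@normal_prob R 0 1).

(** The row u and the scalar a have the same Gram matrix, so that affine_law_eq
    identifies a form in n variables with a normal variable. *)
Lemma gaussian_linear_form n (u : 'I_n -> R) (a : R) (D : set RT) :
  a ^+ 2 = \sum_i u i ^+ 2 -> measurable D ->
  gaussian_tuple n [set z | D (\sum_i u i * tnth z i)] = N01 [set x | D (a * x)].
Proof.
move=> aE mD.
pose U : 'M[R]_(1, n) := \row_i u i.
pose D1 : set (1.-tuple RT) := [set w | D (tnth w ord0)].
have mD1 : measurable D1.
  rewrite (_ : D1 = setT `&` (fun w : 1.-tuple RT => tnth w ord0) @^-1` D).
    exact: measurable_tnth.
  by rewrite setTI.
have UE : U *m U^T = a%:M *m (a%:M)^T.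
  apply/matrixP => i j; rewrite !ord1 tr_scalar_mx -scalar_mxM -expr2 aE !mxE/= mulr1n.
  by apply: eq_bigr => k _; rewrite !mxE expr2.
transitivity (affine_law 0 U D1).
  have tE z : tnth (affine_tuple 0 U z) ord0 = \sum_i u i * tnth z i.
    by rewrite tnth_affine_tuple mxE add0r; apply: eq_bigr => i _; rewrite mxE.
  by congr (gaussian_tuple n _); apply/seteqP; split=> z /=; rewrite /D1/= tE.
rewrite (affine_law_eq 0 UE)//.
transitivity (gaussian_tuple 1 [set z : 1.-tuple RT | forall i, [set x | D (a * x)] (tnth z i)]).
  congr (gaussian_tuple 1 _); apply/seteqP; split=> z /=.
    rewrite /D1/= tnth_affine_tuple mxE add0r big_ord1 mxE/= mulr1n => Dz i.
    by rewrite ord1.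
  by rewrite /D1/= tnth_affine_tuple mxE add0r big_ord1 mxE/= mulr1n; exact.
have ma : measurable_fun setT (fun x : RT => a * x : RT) by exact: measurable_funM.
have mS : measurable [set x : RT | D (a * x)].
  rewrite (_ : mkset _ = setT `&` (fun x : RT => a * x : RT) @^-1` D) ?setTI//.
  by rewrite -[X in measurable X]setTI; exact: ma.
have h := @std_gaussian_tuple R 1 (fun=> [set x | D (a * x)]) (fun=> mS).
by rewrite [LHS]h big_ord1.
Qed.

(** All factors B of C give the same norm; this is how the square root of C may
    be replaced by the factor A that comes with the Gaussian law. *)
Lemma eucl_norm_invmx p (C B : 'M[R]_p) (v : 'cV[R]_p) : B \in unitmx ->
  B *m B^T = C -> eucl_norm (invmx B *m v) = Num.sqrt ((v^T *m invmx C *m v) 0 0).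
Proof.
move=> Bu BC; congr Num.sqrt.
have Cu : C \in unitmx by rewrite -BC unitmx_mul Bu unitmx_tr.
have <- : (invmx B)^T *m invmx B = invmx C.
  have e : (invmx B)^T *m invmx B *m C = 1%:M.
    by rewrite -BC mulmxA mulmxKV// -trmx_mul mulmxV// trmx1.
  by rewrite -[LHS](mulmxK Cu) e mul1mx.
rewrite mulmxA -trmx_mul -mulmxA [RHS]mxE.
by apply: eq_bigr => i _; rewrite [in RHS]mxE expr2.
Qed.

(** The interval is centred at a/2 with half-width s/a. By convexity
    x^2 >= a x - a^2/4 >= a^2/4 - s on it, so that the density is at most
    exp (s/2 - a^2/8) over the square root of 2 pi, and exp (s/2) <= 3. *)
Lemma normal01_small_ball (a s : R) : 0 < a -> 0 < s -> s <= 1 ->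
  fine (N01 [set x | `|a * x - a ^+ 2 / 2| <= s]) <=
  6 * expR (- (a ^+ 2 / 8)) / (a * Num.sqrt (2 * pi)) * s.
Proof.
move=> a0 s0 s1.
have an0 : a != 0 by rewrite gt_eqF.
have -> : [set x : RT | `|a * x - a ^+ 2 / 2| <= s] =
    `[a / 2 - s / a, a / 2 + s / a]%classic.
  have e1 : a * (a / 2 - s / a) = a ^+ 2 / 2 - s by field.
  have e2 : a * (a / 2 + s / a) = a ^+ 2 / 2 + s by field.
  by apply/seteqP; split=> x /=; rewrite in_itv/= ler_distl -e1 -e2 !ler_pM2l.
have := @normal01_itv_le R (a / 2 - s / a) (a / 2 + s / a) (3 * expR (- (a ^+ 2 / 8))).
move=> /(_ _ _)/le_trans; apply.
- by rewrite lerD2l (@le_trans _ _ 0)// ?oppr_le0 divr_ge0// ltW.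
- move=> x /andP[x1 _].
  apply: (@le_trans _ _ (expR (1 + - (a ^+ 2 / 8)))); last first.
    by rewrite expRD ler_wpM2r ?expR_ge0// expR1_le3.
  rewrite ler_expR.
  have : a ^+ 2 / 2 - s <= a * x.
    have <- : a * (a / 2 - s / a) = a ^+ 2 / 2 - s by field.
    by rewrite ler_pM2l.
  have := sqr_ge0 (x - a / 2).
  have -> : (x - a / 2) ^+ 2 = x ^+ 2 - a * x + a ^+ 2 / 4 by field.
  lra.
- rewrite le_eqVlt; apply/orP; left; apply/eqP; field.
  by rewrite an0 gt_eqF// sqrtr_gt0 mulr_gt0// pi_gt0.
Qed.

Theorem excess_cost_homoscedastic p (P1 P0 : probability (p.-tuple RT) R)
    (mu1 mu0 : 'cV[R]_p) (C : 'M[R]_p) : equivalent_measures P1 P0 ->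
  sym_posdef C -> gaussian_law mu1 C P1 -> gaussian_law mu0 C P0 ->
  let nrm := eucl_norm (invmx (sqrtmx C) *m (mu1 - mu0)) in
  forall g : p.-tuple RT -> bool, measurable_fun setT g ->
  Num.min (Num.sqrt (2 * pi) / (2 * 16 ^+ 2) * nrm * expR (nrm ^+ 2 / 8) *
           learning_error P1 P0 g ^+ 2)
          (learning_error P1 P0 g / 8) <=
  cost P1 P0 g - cost P1 P0 (optimal_rule P1 P0).
Proof.
move=> P10 Cpos g1 g0 nrm g mg.
have [_ [A [_ AC _]]] := g0.
have Cu := sym_posdef_unit Cpos.
have Au : A \in unitmx by move: Cu; rewrite -AC unitmx_mul => /andP[].
pose m := invmx A *m (mu1 - mu0).
pose L : 'rV[R]_p := const_mx 1.
have L0 i : 0 < L 0 i by rewrite mxE.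
have AL : A *m diag_mx L = A by rewrite diag_const_mx mulmx1.
have muE : mu1 = mu0 + A *m m by rewrite mulKVmx// addrC subrK.
have P1E : forall D, measurable D ->
   P1 D = gaussian_tuple p (affine_tuple mu1 (A *m diag_mx L) @^-1` D).
  by rewrite AL; exact: gaussian_lawE g1 AC.
have [l [ml lE lsmall _]] :=
  gaussian_coordinates (mulVmx Au) L0 muE (gaussian_lawE g0 AC) P1E.
have R0 := learning_error_ge0 P1 P0 g.
have gap0 : 0 <= cost P1 P0 g - cost P1 P0 (optimal_rule P1 P0).
  have := excess_cost_margin P10 ml lE mg (lexx 0).
  by rewrite oppr0 expR0 subrr mulr0 mul0r.
pose a := eucl_norm m.
have aE : a ^+ 2 = \sum_i m i 0 ^+ 2.
  by rewrite sqr_sqrtr// sumr_ge0// => i _; exact: sqr_ge0.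
have [nrm0|nrm0] := leP nrm 0.
  apply: le_trans gap0; rewrite ge_min; apply/orP; left.
  rewrite -mulrA -mulrA mulrCA mulr_le0_ge0//.
  apply: mulr_ge0; first by rewrite divr_ge0// sqrtr_ge0.
  by rewrite mulr_ge0 ?expR_ge0 ?sqr_ge0.
(* if no square root existed, its default value 0 would make nrm vanish *)
have na : nrm = a.
  have [Spos SS] : sym_posdef (sqrtmx C) /\ sqrtmx C *m sqrtmx C = C.
    apply: (@xgetPex _ 0 [set S : 'M[R]_p | sym_posdef S /\ S *m S = C]).
    apply: contrapT => nS; move: nrm0; rewrite /nrm.
    have -> : sqrtmx C = 0 by apply: xgetPN => S hS; apply: nS; exists S.
    have -> : invmx 0 = 0 :> 'M[R]_p.
      have [u|] := boolP ((0 : 'M[R]_p) \in unitmx); last first.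
        by move=> nu; apply: invmx_out; rewrite inE.
      by rewrite -[LHS]mul1mx -(mulVmx u) mulmx0 !mul0mx.
    rewrite mul0mx /eucl_norm big1 ?sqrtr0 ?ltxx// => i _.
    by rewrite mxE expr0n.
  rewrite /nrm /a /m (eucl_norm_invmx _ Au AC).
  by rewrite (@eucl_norm_invmx p C)// ?sym_posdef_unit// Spos.1.
rewrite na in nrm0 *.
(* 12 K = 72 exp (- a^2/8)/(a sqrt (2 pi)), and 72 <= 2 * 16^2 *)
pose K := 6 * expR (- (a ^+ 2 / 8)) / (a * Num.sqrt (2 * pi)).
have q0 : 0 < Num.sqrt (2 * pi) :> R by rewrite sqrtr_gt0 mulr_gt0// pi_gt0.
have K0 : 0 < K by rewrite divr_gt0// mulr_gt0// expR_gt0.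
have lrE z : log_ratio_tuple (fun i => m i 0) (fun i => L 0 i) z =
    \sum_i m i 0 * tnth z i - a ^+ 2 / 2.
  rewrite aE mulr_suml -sumrB; apply: eq_bigr => i _.
  by rewrite /log_ratio1 mxE ln1; field.
have sb (s : R) : 0 < s -> s <= 1 -> fine (P0 [set x | `|l x| <= s ^+ 1]) <= K * s.
  move=> s0 s1; rewrite expr1 lsmall.
  have -> : [set z | `|log_ratio_tuple (fun i => m i 0) (fun i => L 0 i) z| <= s] =
     [set z | [set y : RT | `|y - a ^+ 2 / 2| <= s] (\sum_i m i 0 * tnth z i)].
    by apply/seteqP; split=> z /=; rewrite lrE.
  rewrite (gaussian_linear_form aE); first exact: normal01_small_ball.
  rewrite (_ : mkset _ = `[a ^+ 2 / 2 - s, a ^+ 2 / 2 + s]%classic) //.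
  by apply/seteqP; split=> y /=; rewrite in_itv/= ler_distl.
have := excess_cost_small_ball P10 ml lE K0 sb mg.
apply: le_trans.
set r := learning_error P1 P0 g in R0 *.
rewrite le_min !ge_min; apply/andP; split; apply/orP; [left|right].
  have -> : r ^+ 2 / (4 * (3 * K) ^+ 1) =
      (Num.sqrt (2 * pi) * a * expR (a ^+ 2 / 8) * r ^+ 2) / 72.
    by rewrite /K expRN; field; rewrite !gt_eqF// expR_gt0.
  have : 0 <= Num.sqrt (2 * pi) * a * expR (a ^+ 2 / 8) * r ^+ 2.
    by rewrite mulr_ge0 ?sqr_ge0// mulr_ge0 ?expR_ge0// mulr_ge0 ?sqrtr_ge0// ltW.
  lra.
by rewrite ler_wpM2l// lef_pV2 ?posrE// ler_nat.
Qed.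

End homoscedastic.

(** * Gaussian laws separated in total variation *)
Section separated.
Context {R : realType}.
Local Notation RT := (measurableTypeR R).

Lemma gaussian_pair_coordinates p (P1 P0 : probability (p.-tuple RT) R) :
  equivalent_measures P1 P0 -> gaussian P1 -> gaussian P0 ->
  exists r (m lam : 'I_r -> R) (l : p.-tuple RT -> R), (forall i, 0 < lam i) /\
  [/\ measurable_fun setT l,
      forall D, measurable D -> P1 D = (\int[P0]_(x in D) (expR (l x))%:E)%E,
      forall s : R, P0 [set x | `|l x| <= s] =
        gaussian_tuple r [set z | `|log_ratio_tuple m lam z| <= s] &
      (\int[P0]_x (expR (l x / 2))%:E =
       \int[gaussian_tuple r]_z (expR (log_ratio_tuple m lam z / 2))%:E)%E].
Proof.
move=> [P10 P01] [mu1 [C1 g1]] [mu0 [C0 g0]].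
have [_ [A1 [_ C1E _]]] := g1; have [_ [A0 [_ C0E _]]] := g0.
have P0E := gaussian_lawE g0 C0E; have P1E := gaussian_lawE g1 C1E.
have h01 := affine_law_dominates_range P0E P1E P10.
have h10 k kA := (affine_law_dominates_range P1E P0E P01 (k := k) kA).1.
have [r [B [K [m [L [KB L0 BE BLE muE]]]]]] := simultaneous_affine_form h01 h10.
rewrite C0E in BE; rewrite C1E in BLE.
have [l hl] := gaussian_coordinates KB L0 muE (gaussian_lawE g0 BE) (gaussian_lawE g1 BLE).
by exists r, (fun i => m i 0), (fun i => L 0 i), l.
Qed.

(** Either some variance differs from 1 by a fixed factor, and then one term
    of the sum already exceeds 1/4, or the affinity bound applies to every
    coordinate and a small sum would make the total variation small. *)
Lemma separated_coefficients r (m lam : 'I_r -> R) (c1 : R) d (T : measurableType d)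
    (P1 P0 : probability T R) (l : T -> R) : 0 < c1 -> (forall i, 0 < lam i) ->
  measurable_fun setT l ->
  (forall D, measurable D -> P1 D = (\int[P0]_(x in D) (expR (l x))%:E)%E) ->
  (\int[P0]_x (expR (l x / 2))%:E =
       \int[gaussian_tuple r]_z (expR (log_ratio_tuple m lam z / 2))%:E)%E ->
  (c1%:E < dist1 P1 P0)%E ->
  Num.min 4^-1 (c1 ^+ 2 / 4) <=
    \sum_(i < r) ((1 - lam i ^- 2) ^+ 2 + (m i / lam i ^+ 2) ^+ 2).
Proof.
move=> c10 lam0 ml P1E affE sep.
set V := \sum_(i < r) _.
have [all_lam|/existsNP[i /negP]] :=
    pselect (forall i, 2^-1 <= lam i ^- 2); last first.
  rewrite -ltNge => si.
  rewrite ge_min; apply/orP; left.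
  apply: (@le_trans _ _ ((1 - lam i ^- 2) ^+ 2)).
    by nra.
  rewrite /V (bigD1 i)//= -addrA lerDl addr_ge0 ?sqr_ge0// sumr_ge0// => j _.
  by rewrite addr_ge0// sqr_ge0.
have [A [AE Age]] := affinity_log_ratio_tuple m lam0 all_lam.
rewrite ge_min; apply/orP; right.
rewrite -/V in Age.
(* t = 4/c1 makes the term 2/t equal to c1/2 *)
have t0 : 0 < 4 / c1 by rewrite divr_gt0.
rewrite AE in affE.
have := lt_le_trans sep (dist1_affinity ml P1E affE t0); rewrite lte_fin => h.
have : c1 < 4 / c1 * (V / 2) + 2 / (4 / c1).
  apply: lt_le_trans h _; rewrite lerD2r (ler_wpM2l (ltW t0))//; lra.
have -> : 4 / c1 * (V / 2) + 2 / (4 / c1) = 2 * V / c1 + c1 / 2.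
  by field; rewrite gt_eqF.
rewrite -ltrBlDr ltr_pdivlMr//.
have -> : (c1 - c1 / 2) * c1 = c1 ^+ 2 / 2 by field.
lra.
Qed.

(** The small-ball constant 4 max(1, 1/V) is uniform over all pairs with
    dist1 > c1, whatever the dimension. *)
Theorem excess_cost_separated (c1 : R) : 0 < c1 ->
  exists c : R, 0 < c /\
    forall p (P1 P0 : probability (p.-tuple RT) R),
      equivalent_measures P1 P0 -> (P1, P0) \in separated_gaussians c1 ->
      forall g : p.-tuple RT -> bool, measurable_fun setT g ->
      Num.min (c * learning_error P1 P0 g ^+ 8) (learning_error P1 P0 g / 8) <=
      cost P1 P0 g - cost P1 P0 (optimal_rule P1 P0).
Proof.
move=> c10.
pose V := Num.min 4^-1 (c1 ^+ 2 / 4).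
have V0 : 0 < V by rewrite lt_min invr_gt0 ltr0n divr_gt0// exprn_gt0.
pose K := 4 * Num.max 1 V^-1.
have K0 : 0 < K by rewrite mulr_gt0// lt_max ltr01.
have c0 : 0 < (4 * (3 * K) ^+ 3)^-1.
  by rewrite invr_gt0 mulr_gt0// exprn_gt0// mulr_gt0.
exists (4 * (3 * K) ^+ 3)^-1; split=> // p P1 P0 P10 + g mg.
rewrite inE => -[/= g1 g0 sep].
have [r [m [lam [l [lam0 [ml lE lsmall laff]]]]]] := gaussian_pair_coordinates P10 g1 g0.
have Vle := separated_coefficients c10 lam0 ml lE laff sep.
have sb (s : R) : 0 < s -> s <= 1 -> fine (P0 [set x | `|l x| <= s ^+ 3]) <= K * s.
  by move=> s0 _; rewrite lsmall; exact: log_ratio_small_ball.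
have := excess_cost_small_ball P10 ml lE K0 sb mg.
apply: le_trans.
have R0 := learning_error_ge0 P1 P0 g.
have R1 := learning_error_le1 P10 mg.
rewrite le_min !ge_min; apply/andP; split; apply/orP; [left|right].
  by rewrite mulrC (ler_wpM2r (ltW c0))// ler_wiXn2l.
by rewrite ler_wpM2l// lef_pV2 ?posrE// ler_nat.
Qed.

End separated.

Theorem theorem6p1 (R : realType) :
  (forall (p : nat) (P1 P0 : probability (Rvec R p) R)
      (mu1 mu0 : 'cV[R]_p) (C : 'M[R]_p),
    equivalent_measures P1 P0 ->
    sym_posdef C ->
    gaussian_law mu1 C P1 ->
    gaussian_law mu0 C P0 ->
    let m10 := mu1 - mu0 in
    let nrm := eucl_norm (invmx (sqrtmx C) *m m10) in
    forall g : Rvec R p -> bool, measurable_fun setT g ->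
      cost P1 P0 g - cost P1 P0 (optimal_rule P1 P0) >=
      Num.min
        (Num.sqrt (2 * pi) / (2 * 16 ^+ 2) * nrm * expR (nrm ^+ 2 / 8) *
           learning_error P1 P0 g ^+ 2)
        (learning_error P1 P0 g / 8))
  /\
  (forall c1 : R, 0 < c1 ->
    exists c : R, 0 < c /\
      forall (p : nat) (P1 P0 : probability (Rvec R p) R),
        equivalent_measures P1 P0 ->
        (P1, P0) \in separated_gaussians c1 ->
        forall g : Rvec R p -> bool, measurable_fun setT g ->
          cost P1 P0 g - cost P1 P0 (optimal_rule P1 P0) >=
          Num.min (c * learning_error P1 P0 g ^+ 8)
                  (learning_error P1 P0 g / 8)).
Proof.
split=> [p P1 P0 mu1 mu0 C P10 Cpos g1 g0 m10 nrm g mg|c1 c10].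
  exact: excess_cost_homoscedastic.
exact: excess_cost_separated.
Qed.
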